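(* Let $Y_t=P_{\mathrm{nod},t}\cap\operatorname{OG}(5,10)\subset\mathbb{P}^{15}$, and let $X_1,X_\infty$ and their components be as defined in the context. (1) $Y_1$ is a union of five irreducible components, each of dimension 2: - the span of lines 0 and 9 of $X_1$ (replacing these lines); - replacing lines 1, 10 and 3 of $X_1$: the scroll connecting each point $p$ on line 1 to its image on line 3 under the isomorphism mapping the nodes 0-1, 1-2, 1-10 to 3-9, 3-4, 3-10, respectively; - the span of lines 2 and 4 of $X_1$ (replacing these lines); - the span of lines 5 and 11 of $X_1$ (replacing these lines); - replacing lines 6, 7 and 8 of $X_1$: the scroll connecting each point $p$ on line 6 to its image on line 8 under the isomorphism mapping the nodes 5-6, 6-7, 6-9 to 8-11, 7-8, 0-8, respectively. (2) $Y_\infty$ is a union of eight irreducible components: - lines 0, 1, 2, 7, 10, 11 of $X_\infty$ are irreducible components of $Y_\infty$; - component 34 of $X_\infty$ (an irreducible quadric) is an irreducible component of $Y_\infty$; - lines 5, 6, 8, 9 of $X_\infty$ are replaced by their span, a $\mathbb{P}^2$.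
   Context: Work over $\mathbb{C}$. Here $t=[t_0:t_1]\in\mathbb{P}^1$; $t=0$ means $t_0=0$, $t=1$ means $t_0=t_1$, $t=\infty$ means $t_1=0$. Formulas depend on a representative $(t_0,t_1)$; limits as $t\to1$ (resp. $t\to\infty$) are taken with $(t_0,t_1)\to(1,1)$ (resp. $(t_0,t_1)\to(1,0)$), and at $t=1,\infty$ these representatives are used. Curves in $\mathbb{P}^6$. Let $C_t=\bigcup_vC_t^v\subset\mathbb{P}^6$ (coordinates $y_0,\dots,y_6$), $v\in\{0,1,2,34,5,6,7,8,9,10,11\}$, with ideals of components: $0:\langle y_5,y_4,y_3,y_2,y_1\rangle$; $1:\langle y_6,y_5,y_4,y_3,y_2\rangle$; $2:\langle y_6,y_5,y_4,y_3,y_0-y_1\rangle$; $34:\langle t_0y_2y_3-t_1y_2y_4+(-t_0+t_1)y_3y_4,\ y_6,y_5,y_1-y_2+y_4,y_0-y_2+y_3\rangle$; $5:\langle y_6,y_3-y_4,y_2-y_4+y_5,y_1,y_0\rangle$; $6:\langle y_4-y_5,y_3-y_5+y_6,y_2,y_1,y_0\rangle$; $7:\langle y_5-y_6,y_3,y_2,y_1,y_0\rangle$; $8:\langle y_4,y_3,y_2,y_1,y_0\rangle$; $9:\langle y_5,y_4,y_2,y_1,y_0+y_3+y_6\rangle$; $10:\langle y_6,y_5,y_3,y_2,y_0\rangle$; $11:\langle y_6,y_4,y_3,y_1,y_0\rangle$. The space of quadrics vanishing on $C_t$ has the basis, satisfying $\sum_{i=0}^4g_ig_{i+5}=0$: $g_0=-t_0y_1y_3+t_1y_0y_4$;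 $g_1=-(t_0-t_1)y_0y_3-t_1y_2y_3-(t_0-t_1)y_3^2+t_1y_2y_4+(t_0-t_1)y_3y_4-(t_0-t_1)y_3y_6$; $g_2=(t_0-t_1)y_1y_3+t_1y_2y_3-t_1y_2y_4$; $g_3=t_0y_2y_3-t_1y_2y_4-(t_0-t_1)y_3y_4+(t_0-t_1)y_3y_5$; $g_4=-t_1y_0y_2+t_1y_1y_2-t_1y_2y_3+t_1y_2y_4$; $g_5=y_2y_6$; $g_6=y_1y_5$; $g_7=y_0y_5+y_3y_5-y_4y_5+y_4y_6$; $g_8=y_1y_6$; $g_9=y_3y_5-y_4y_5+y_4y_6$ (for $t\ne0,1,\infty$). Spinors. Let $V=\mathbb{C}^{10}$ with basis $e_{-1},\dots,e_{-5},e_1,\dots,e_5$, where $e_{-i}$ corresponds to index $i-1$ and $e_i$ to index $i+4$ in $\{0,\dots,9\}$, with $Q=\sum_{i=1}^5z_{-i}z_i$. Let $U_\infty=\operatorname{Span}(e_1,\dots,e_5)$, $S^{+}=\bigwedge^{\mathrm{even}}U_\infty$ with basis $e_I=e_{i_1}\wedge\cdots\wedge e_{i_k}$ ($I=\{i_1<\cdots<i_k\}$, $k$ even; $1=e_\emptyset$) and coordinates $x_I$ on $\mathbb{P}(S^{+})=\mathbb{P}^{15}$ ($x_0=x_\emptyset$). Each $v\in V$ acts on $\bigwedge U_\infty$ by $\varphi_v$, linear in $v$: $\varphi_{e_i}$ is left wedging by $e_i$, $\varphi_{e_{-i}}$ is contraction against $e_i$. The half spinor of a Lagrangian $U\subset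 V$ with $\dim(U\cap U_\infty)$ even is the unique (up to scalar) nonzero $s_U\in S^{+}$ with $\varphi_u(s_U)=0$ for all $u\in U$. For a smooth point $p\in C_t$, $W_p^\perp$ is the Lagrangian spanned by the rows $(\frac{\partial g_0}{\partial y_i}(p),\dots,\frac{\partial g_9}{\partial y_i}(p))$, $i=0,\dots,6$, and $\rho(p)=[s_{W_p^\perp}]$. For $t\ne0,1,\infty$, $X_t^v=\rho(C_t^v)$ denotes the closure of the image under $\rho$ of the general points of $C_t^v$, and $X_t=\bigcup_vX_t^v$. For $v\neq34$, $X_t^v$ is a line. For $t\neq 0,1,\infty$ the components $X_t^u,X_t^v$ meet in a node, called node $u$-$v$, for $u$-$v$ among 0-1, 0-8, 0-9, 1-2, 1-10, 2-34, 2-11, 34-9, 34-5, 34-10, 5-6, 5-11, 6-7, 6-9, 7-8, 7-10, 8-11. $X_1$, $X_\infty$ are the flat limits of $X_t$ in $\mathbb{P}^{15}$ as $t\to1,\infty$. Labels in the limits. For $v\ne34$, ''line $v$'' of $X_1$ or $X_\infty$ is the limit of $X_t^v$, and node $u$-$v$ is the limit of node $u$-$v$ of $X_t$. As $t\to\infty$, component 34 is the limit of $X_t^{34}$. As $t\to1$, the limit of $X_t^{34}$ is a union of two lines: line 3, containing the limits of nodes 34-9 and 34-10 (called 3-9 and 3-10), and line 4, containing the limits of nodes 2-34 and 34-5 (called 2-4 and 4-5); node 3-4 is the intersection of lines 3 and 4. The scroll associated with an isomorphism $\phi:\ell\to\ell'$ of lines is the union of the lines $\overline{p\,\phi(p)}$,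 $p\in\ell$. $P_{\mathrm{nod},t}\subset\mathbb{P}^{15}$ is the 6-dimensional linear subspace spanned by $e_{12}+e_{13}$, $e_{24}$, $e_{34}$, $(t_0t_1-t_1^2)\cdot1+(t_0-t_1)e_{15}+t_1e_{23}+t_1e_{25}+t_0e_{35}$, $e_{23}+e_{25}+e_{45}$, $e_{1235}$, $e_{1345}$. $\operatorname{OG}(5,10)\subset\mathbb{P}(S^{+})$ is defined by $x_0x_{2345}-x_{23}x_{45}+x_{24}x_{35}-x_{25}x_{34}$, $x_{12}x_{1345}-x_{13}x_{1245}+x_{14}x_{1235}-x_{15}x_{1234}$, $x_0x_{1345}-x_{13}x_{45}+x_{14}x_{35}-x_{15}x_{34}$, $x_{12}x_{2345}-x_{23}x_{1245}+x_{24}x_{1235}-x_{25}x_{1234}$, $x_0x_{1245}-x_{12}x_{45}+x_{14}x_{25}-x_{15}x_{24}$, $x_{13}x_{2345}-x_{23}x_{1345}+x_{34}x_{1235}-x_{35}x_{1234}$, $x_0x_{1235}-x_{12}x_{35}+x_{13}x_{25}-x_{15}x_{23}$, $x_{14}x_{2345}-x_{24}x_{1345}+x_{34}x_{1245}-x_{45}x_{1234}$, $x_0x_{1234}-x_{12}x_{34}+x_{13}x_{24}-x_{14}x_{23}$, $x_{15}x_{2345}-x_{25}x_{1345}+x_{35}x_{1245}-x_{45}x_{1235}$. *)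

(* Defs.v *)
From HB Require Import structures.
From mathcomp Require Import all_boot all_order all_algebra.
From mathcomp Require Import classical_sets reals.
From mathcomp Require Export complex.
From mathcomp Require Import mpoly.

Set Implicit Arguments.
Unset Strict Implicit.
Unset Printing Implicit Defensive.

Import Order.TTheory GRing.Theory.

Local Open Scope classical_set_scope.
Local Open Scope ring_scope.

(* A subset of P^(n-1) is represented by the set of all its homogeneous
   coordinate vectors: a set of nonzero vectors of 'rV[K]_n, stable under
   nonzero scaling. Equality, inclusion, union and intersection of subsets of
   P^(n-1) are those of the representing sets. *)

Section ProjectiveGeometry.
Variable K : fieldType.

Definition zclosure n (S : set 'rV[K]_n) : set 'rV[K]_n :=
  [set x : 'rV[K]_n | x != 0 /\
     forall d (f : {mpoly K[n]}), f \is d.-homog ->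
       (forall z, S z -> f.@[z 0] = 0) -> f.@[x 0] = 0].

Definition zclosed n (Z : set 'rV[K]_n) : Prop := Z = zclosure Z.

Definition irreducible_closed n (Z : set 'rV[K]_n) : Prop :=
  [/\ zclosed Z, Z !=set0 &
      forall A B, zclosed A -> zclosed B -> Z `<=` A `|` B ->
        Z `<=` A \/ Z `<=` B].

Definition irreducible_component n (Y Z : set 'rV[K]_n) : Prop :=
  [/\ irreducible_closed Z, Z `<=` Y &
      forall Z', irreducible_closed Z' -> Z `<=` Z' -> Z' `<=` Y -> Z' = Z].

Definition has_components n (Y : set 'rV[K]_n) (Zs : seq (set 'rV[K]_n)) :=
  [/\ uniq Zs, Y = \bigcup_(Z in [set` Zs]) Z &
      [set Z | irreducible_component Y Z] = [set` Zs]].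

Definition has_chain n (Z : set 'rV[K]_n) (d : nat) : Prop :=
  exists c : nat -> set 'rV[K]_n,
    [/\ forall i, (i <= d)%N -> irreducible_closed (c i) /\ c i `<=` Z &
        forall i, (i < d)%N -> c i `<` c i.+1].

Definition has_dim n (Z : set 'rV[K]_n) (d : nat) : Prop :=
  has_chain Z d /\ ~ has_chain Z d.+1.

Definition plinear m n (U : 'M[K]_(m, n)) : set 'rV[K]_n :=
  [set x : 'rV[K]_n | x != 0 /\ (x <= U)%MS].

Definition is_plinear n (d : nat) (L : set 'rV[K]_n) : Prop :=
  exists2 U : 'M[K]_n, \rank U = d.+1 & L = plinear U.

Definition is_line n (L : set 'rV[K]_n) := is_plinear 1 L.
Definition is_plane n (L : set 'rV[K]_n) := is_plinear 2 L.

Definition pspan n (S : set 'rV[K]_n) : set 'rV[K]_n :=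
  [set x : 'rV[K]_n | x != 0 /\
     forall U : 'M[K]_n, (forall z, S z -> (z <= U)%MS) -> (x <= U)%MS].

Definition irreducible_conic n (Z : set 'rV[K]_n) : Prop :=
  exists (U : 'M[K]_n) (q : {mpoly K[n]}),
    [/\ \rank U = 3%N, q \is 2.-homog,
        Z = [set x : 'rV[K]_n | plinear U x /\ q.@[x 0] = 0] &
        ~ exists l m : {mpoly K[n]},
            [/\ l \is 1.-homog, m \is 1.-homog &
                forall x : 'rV[K]_n, (x <= U)%MS ->
                  q.@[x 0] = l.@[x 0] * m.@[x 0]]].

(* Isomorphisms of projective lines are the maps p |-> p *m M induced by
   linear isomorphisms of the underlying planes. Since L' contains nonzero
   vectors only, the last condition makes M injective on the plane of L. *)
Definition line_iso n (L L' : set 'rV[K]_n) (M : 'M[K]_n) : Prop :=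
  [/\ is_line L, is_line L' & [set p *m M | p in L] = L'].

Definition maps_point n (M : 'M[K]_n) (N N' : set 'rV[K]_n) : Prop :=
  exists p : 'rV[K]_n, [/\ p != 0, N = plinear p & N' = plinear (p *m M)].

Definition scroll n (L : set 'rV[K]_n) (M : 'M[K]_n) : set 'rV[K]_n :=
  \bigcup_(p in L) plinear (col_mx p (p *m M)).

(* Z is the scroll of the isomorphism L -> L' mapping N to N' for every
   (N, N') in NN. The matrix M representing it is not unique, which is why
   existence is stated separately. *)
Definition is_scroll_of n (L L' : set 'rV[K]_n)
    (NN : seq (set 'rV[K]_n * set 'rV[K]_n)) (Z : set 'rV[K]_n) : Prop :=
  let good M :=
    line_iso L L' M /\ forall N, N \in NN -> maps_point M N.1 N.2 in
  (exists M, good M) /\ (forall M, good M -> Z = scroll L M).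

End ProjectiveGeometry.

Inductive label : Type :=
  c0 | c1 | c2 | c34 | c5 | c6 | c7 | c8 | c9 | c10 | c11.

Section Curves.
Variable K : fieldType.
(* The pair t = (t_0, t_1) is a representative of [t_0 : t_1]. *)
Implicit Types t : K * K.

Definition generic_t t : bool := [&& t.1 != 0, t.2 != 0 & t.1 != t.2].

Definition y (i : nat) : {mpoly K[7]} := 'X_(inord i).

Definition curve_ideal t (v : label) : seq {mpoly K[7]} :=
  let t0 := t.1%:MP_[7] in let t1 := t.2%:MP_[7] in
  match v with
  | c0 => [:: y 5; y 4; y 3; y 2; y 1]
  | c1 => [:: y 6; y 5; y 4; y 3; y 2]
  | c2 => [:: y 6; y 5; y 4; y 3; y 0 - y 1]
  | c34 => [:: t0 * y 2 * y 3 - t1 * y 2 * y 4 + (- t0 + t1) * y 3 * y 4;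
               y 6; y 5; y 1 - y 2 + y 4; y 0 - y 2 + y 3]
  | c5 => [:: y 6; y 3 - y 4; y 2 - y 4 + y 5; y 1; y 0]
  | c6 => [:: y 4 - y 5; y 3 - y 5 + y 6; y 2; y 1; y 0]
  | c7 => [:: y 5 - y 6; y 3; y 2; y 1; y 0]
  | c8 => [:: y 4; y 3; y 2; y 1; y 0]
  | c9 => [:: y 5; y 4; y 2; y 1; y 0 + y 3 + y 6]
  | c10 => [:: y 6; y 5; y 3; y 2; y 0]
  | c11 => [:: y 6; y 4; y 3; y 1; y 0]
  end.

Definition curve_comp t (v : label) : set 'rV[K]_7 :=
  [set p : 'rV[K]_7 | p != 0 /\
     forall f, f \in curve_ideal t v -> f.@[p 0] = 0].

Definition curve t : set 'rV[K]_7 := \bigcup_v curve_comp t v.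

Definition quadrics t : 10.-tuple {mpoly K[7]} :=
  let t0 := t.1%:MP_[7] in let t1 := t.2%:MP_[7] in
  [tuple
    - t0 * y 1 * y 3 + t1 * y 0 * y 4;
    - (t0 - t1) * y 0 * y 3 - t1 * y 2 * y 3 - (t0 - t1) * y 3 * y 3
      + t1 * y 2 * y 4 + (t0 - t1) * y 3 * y 4 - (t0 - t1) * y 3 * y 6;
    (t0 - t1) * y 1 * y 3 + t1 * y 2 * y 3 - t1 * y 2 * y 4;
    t0 * y 2 * y 3 - t1 * y 2 * y 4 - (t0 - t1) * y 3 * y 4
      + (t0 - t1) * y 3 * y 5;
    - t1 * y 0 * y 2 + t1 * y 1 * y 2 - t1 * y 2 * y 3 + t1 * y 2 * y 4;
    y 2 * y 6;
    y 1 * y 5;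
    y 0 * y 5 + y 3 * y 5 - y 4 * y 5 + y 4 * y 6;
    y 1 * y 6;
    y 3 * y 5 - y 4 * y 5 + y 4 * y 6].

(* p is a smooth point of the curve C_t: the Zariski tangent space of the
   affine cone over C_t at p, cut out by the differentials of all homogeneous
   polynomials vanishing on C_t, has dimension 2. *)
Definition smooth_point t (p : 'rV[K]_7) : Prop :=
  curve t p /\
  exists2 T : 'M[K]_7, \rank T = 2%N &
    forall w : 'rV[K]_7, (w <= T)%MS <->
      forall d (f : {mpoly K[7]}), f \is d.-homog ->
        (forall q, curve t q -> f.@[q 0] = 0) ->
        \sum_(i < 7) (f^`M(i)).@[p 0] * w 0 i = 0.

(* V = K^10, with e_{-i} and e_i (1 <= i <= 5) at the positions i - 1 and i + 4
   of 'I_(5 + 5), i.e. lshift 5 (i - 1) and rshift 5 (i - 1). *)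
Definition Q (z : 'rV[K]_(5 + 5)) : K :=
  \sum_(i < 5) z 0 (lshift 5 i) * z 0 (rshift 5 i).

Definition lagrangian m (U : 'M[K]_(m, 5 + 5)) : Prop :=
  \rank U = 5%N /\ forall z : 'rV[K]_(5 + 5), (z <= U)%MS -> Q z = 0.

Definition Uinf : 'M[K]_(5, 5 + 5) := row_mx 0 1%:M.

Definition Wperp t (p : 'rV[K]_7) : 'M[K]_(7, 5 + 5) :=
  \matrix_(a < 7, i < 5 + 5) ((tnth (quadrics t) i)^`M(a)).@[p 0].

(* Elements of the exterior algebra of Uinf are given by their coordinates on
   the e_I, the index i in {1, ..., 5} being encoded as i - 1 in 'I_5. *)
Definition before (i : 'I_5) (J : {set 'I_5}) : nat :=
  #|[pred j in J | (j < i)%N]|.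

Definition wedge (i : 'I_5) (s : {set 'I_5} -> K) : {set 'I_5} -> K :=
  fun J => if i \in J then (-1) ^+ before i J * s (J :\ i) else 0.

Definition contract (i : 'I_5) (s : {set 'I_5} -> K) : {set 'I_5} -> K :=
  fun J => if i \in J then 0 else (-1) ^+ before i J * s (i |: J).

Definition phi (z : 'rV[K]_(5 + 5)) (s : {set 'I_5} -> K) : {set 'I_5} -> K :=
  fun J => \sum_(i < 5) (z 0 (lshift 5 i) * contract i s J
                         + z 0 (rshift 5 i) * wedge i s J).

(* The coordinates of P^15 = P(S^+), in this order; the subsets of {1, ..., 5}
   are written as increasing sequences. *)
Definition even_sets : seq (seq nat) :=
  [:: [::]; [:: 1; 2]; [:: 1; 3]; [:: 1; 4]; [:: 1; 5]; [:: 2; 3]; [:: 2; 4];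
      [:: 2; 5]; [:: 3; 4]; [:: 3; 5]; [:: 4; 5]; [:: 1; 2; 3; 4];
      [:: 1; 2; 3; 5]; [:: 1; 2; 4; 5]; [:: 1; 3; 4; 5]; [:: 2; 3; 4; 5]]%N.

Definition even_index (I : seq nat) : 'I_16 := inord (index I even_sets).

Definition subset_of (I : seq nat) : {set 'I_5} :=
  finset (fun i : 'I_5 => i.+1 \in I).

Definition spinor (x : 'rV[K]_16) : {set 'I_5} -> K :=
  fun J => \sum_(k < 16 | subset_of (nth [::] even_sets k) == J) x 0 k.

Definition half_spinor m (U : 'M[K]_(m, 5 + 5)) (x : 'rV[K]_16) : Prop :=
  [/\ lagrangian U, ~~ odd (\rank (U :&: Uinf)%MS), x != 0 &
      forall u : 'rV[K]_(5 + 5), (u <= U)%MS ->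
        forall J, phi u (spinor x) J = 0].

(* Only meaningful for generic t, like everything derived from quadrics t. *)
Definition X (v : label) t : set 'rV[K]_16 :=
  zclosure [set x : 'rV[K]_16 | exists p : 'rV[K]_7,
    [/\ curve_comp t v p, smooth_point t p & half_spinor (Wperp t p) x]].

Definition node (u v : label) t : set 'rV[K]_16 := X u t `&` X v t.

Definition eval_family t (f : {mpoly {mpoly K[2]}[16]}) (x : 'rV[K]_16) : K :=
  (map_mpoly (meval (fun i : 'I_2 => if i == ord0 then t.1 else t.2)) f).@[x 0].

(* The (support of the) flat limit at tau of a family of subsets of P^15
   defined for generic t: the fibre over tau of the Zariski closure, in the
   product of the (t_0, t_1)-plane and P^15, of the total space of the family.
   The family is taken over the plane because it depends on the representative
   (t_0, t_1). *)
Definition limit (tau : K * K) (F : K * K -> set 'rV[K]_16) : set 'rV[K]_16 :=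
  [set x : 'rV[K]_16 | x != 0 /\
     forall d (f : {mpoly {mpoly K[2]}[16]}), f \is d.-homog ->
       (forall t z, generic_t t -> F t z -> eval_family t f z = 0) ->
       eval_family tau f x = 0].

Definition Xlim (tau : K * K) (v : label) := limit tau (X v).
Definition nodelim (tau : K * K) (u v : label) := limit tau (node u v).

(* The splitting into lines 3 and 4 of the limit of X_t^34 as t -> 1 *)
Definition lines34 (L3 L4 : set 'rV[K]_16) : Prop :=
  [/\ is_line L3, is_line L4, Xlim (1, 1) c34 = L3 `|` L4,
      nodelim (1, 1) c34 c9 `|` nodelim (1, 1) c34 c10 `<=` L3 &
      nodelim (1, 1) c2 c34 `|` nodelim (1, 1) c34 c5 `<=` L4].

Definition e0 : 'rV[K]_16 := delta_mx 0 (even_index [::]).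
Definition e2 (i j : nat) : 'rV[K]_16 := delta_mx 0 (even_index [:: i; j]).
Definition e4 (i j k l : nat) : 'rV[K]_16 :=
  delta_mx 0 (even_index [:: i; j; k; l]).

Definition x0 (x : 'rV[K]_16) : K := x 0 (even_index [::]).
Definition x2 (x : 'rV[K]_16) (i j : nat) : K := x 0 (even_index [:: i; j]).
Definition x4 (x : 'rV[K]_16) (i j k l : nat) : K :=
  x 0 (even_index [:: i; j; k; l]).

Definition Pnod_basis t : seq 'rV[K]_16 :=
  let t0 := t.1 in let t1 := t.2 in
  [:: e2 1 2 + e2 1 3;
      e2 2 4;
      e2 3 4;
      (t0 * t1 - t1 ^+ 2) *: e0 + (t0 - t1) *: e2 1 5
        + t1 *: e2 2 3 + t1 *: e2 2 5 + t0 *: e2 3 5;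
      e2 2 3 + e2 2 5 + e2 4 5;
      e4 1 2 3 5;
      e4 1 3 4 5].

Definition Pnod t : set 'rV[K]_16 :=
  plinear (\matrix_(k < 7) (Pnod_basis t)`_k).

Definition OG510 : set 'rV[K]_16 :=
  [set x : 'rV[K]_16 | x != 0 /\
    [/\ [/\ x0 x * x4 x 2 3 4 5 - x2 x 2 3 * x2 x 4 5 + x2 x 2 4 * x2 x 3 5
              - x2 x 2 5 * x2 x 3 4 = 0,
            x2 x 1 2 * x4 x 1 3 4 5 - x2 x 1 3 * x4 x 1 2 4 5
              + x2 x 1 4 * x4 x 1 2 3 5
              - x2 x 1 5 * x4 x 1 2 3 4 = 0,
            x0 x * x4 x 1 3 4 5 - x2 x 1 3 * x2 x 4 5 + x2 x 1 4 * x2 x 3 5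
              - x2 x 1 5 * x2 x 3 4 = 0,
            x2 x 1 2 * x4 x 2 3 4 5 - x2 x 2 3 * x4 x 1 2 4 5
              + x2 x 2 4 * x4 x 1 2 3 5
              - x2 x 2 5 * x4 x 1 2 3 4 = 0 &
            x0 x * x4 x 1 2 4 5 - x2 x 1 2 * x2 x 4 5 + x2 x 1 4 * x2 x 2 5
              - x2 x 1 5 * x2 x 2 4 = 0] &
        [/\ x2 x 1 3 * x4 x 2 3 4 5 - x2 x 2 3 * x4 x 1 3 4 5
              + x2 x 3 4 * x4 x 1 2 3 5
              - x2 x 3 5 * x4 x 1 2 3 4 = 0,
            x0 x * x4 x 1 2 3 5 - x2 x 1 2 * x2 x 3 5 + x2 x 1 3 * x2 x 2 5
              - x2 x 1 5 * x2 x 2 3 = 0,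
            x2 x 1 4 * x4 x 2 3 4 5 - x2 x 2 4 * x4 x 1 3 4 5
              + x2 x 3 4 * x4 x 1 2 4 5
              - x2 x 4 5 * x4 x 1 2 3 4 = 0,
            x0 x * x4 x 1 2 3 4 - x2 x 1 2 * x2 x 3 4 + x2 x 1 3 * x2 x 2 4
              - x2 x 1 4 * x2 x 2 3 = 0 &
            x2 x 1 5 * x4 x 2 3 4 5 - x2 x 2 5 * x4 x 1 3 4 5
              + x2 x 3 5 * x4 x 1 2 4 5
              - x2 x 4 5 * x4 x 1 2 3 5 = 0]]].

Definition Y t : set 'rV[K]_16 := Pnod t `&` OG510.

End Curves.

(* Main.v *)
(* Along a polynomial path u |-> w(u) a form is a polynomial in u, so it vanishes
   at w(0) as soon as it vanishes at w(u) for all u but finitely many. Hence a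
   closed set is irreducible once any two of its points are joined by such a
   path inside it, and a flat limit is reached along a curve (p(u), q(u)) in the
   plane of the parameters (t_0, t_1).
   A surface with a polynomial chart has no chain of four irreducible closed
   sets: forms separating the members of such a chain would have some c M^3
   independent monomials of weighted degree M, while the restrictions to the
   chart of the forms of degree M span a space of dimension O(M^2).
   At the general points of C_t^v the smoothness and the annihilation of the
   spinor by W_p^perp are certified by explicit linear combinations of the
   equations; the spinors found lie in P_nod and depend linearly, for v = 34
   quadratically, on the point. This gives X_t^v and its nodes as explicit
   families over the (t_0, t_1)-plane, hence their limits.
   In the coordinates z_1, ..., z_7 of P_nod the equations of OG(5, 10) are a few
   quadrics, which at t = 1 and t = infinity split after a case distinction on
   the vanishing of the z_i. *)

Require Import Defs.
From mathcomp Require Import all_boot all_order all_algebra.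
From mathcomp Require Import boolp classical_sets reals complex.
From mathcomp Require Import mpoly ring zify.

Set Implicit Arguments.
Unset Strict Implicit.
Unset Printing Implicit Defensive.

Import GRing.Theory.

Local Open Scope classical_set_scope.
Local Open Scope ring_scope.

(** * Polynomial paths *)

Section PolynomialFunctions.
Variable K : fieldType.
Implicit Types (f g : K -> K) (e : nat).

(** Everything is tested by evaluating forms, so each claim becomes an identity of polynomials in
    one variable over a field of characteristic zero. The zero vector is the recurring nuisance: a
    path of coordinate vectors may pass through it, and a factor given by one coordinate discards
    those parameters. The spinor equations at any point of a component, nodes included, already
    confine the spinor to the expected line or conic; the converse inclusion produces spinors at
    points off the nodes and closes up. Limits are computed in the coordinates z_i of P_nod, where
    z_4 is read off x_35 = t_0 z_4; both limit points have t_0 = 1, so these coordinates survive.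
    Component 34 is the delicate one. Its parametrized points are divisible by t_1, which must be
    divided out before t_1 tends to 0. *)

Definition dpoly e f := exists2 p : {poly K}, (size p <= e.+1)%N & f =1 horner p.

(** Only the dimension count needs the degree bound of [dpoly]; density and limit arguments forget
    it. Functions are used instead of [{poly K}] so that the coordinates of explicit paths are
    recognized by closure rules. *)
Definition ispoly f := exists e, dpoly e f.

Lemma dpoly_ext e f g : f =1 g -> dpoly e g -> dpoly e f.
Proof. by move=> fg [p sp gp]; exists p => // u; rewrite fg. Qed.

Lemma dpolyW e e' f : (e <= e')%N -> dpoly e f -> dpoly e' f.
Proof. by move=> ee' [p sp fp]; exists p => //; apply: leq_trans sp _. Qed.

Lemma dpolyC e c : dpoly e (fun=> c).
Proof.
exists c%:P => [|u]; last by rewrite hornerC.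
by apply: leq_trans (size_polyC_leq1 c) _.
Qed.

Lemma dpolyX : dpoly 1 id.
Proof. by exists 'X => [|u]; rewrite ?size_polyX ?hornerX. Qed.

Lemma dpolyD e f g : dpoly e f -> dpoly e g -> dpoly e (fun u => f u + g u).
Proof.
move=> [p sp fp] [q sq gq]; exists (p + q) => [|u].
  by apply: leq_trans (size_polyD _ _) _; rewrite geq_max sp sq.
by rewrite hornerD fp gq.
Qed.

Lemma dpolyM e e' f g :
  dpoly e f -> dpoly e' g -> dpoly (e + e') (fun u => f u * g u).
Proof.
move=> [p sp fp] [q sq gq]; exists (p * q) => [|u]; last first.
  by rewrite hornerM fp gq.
by apply: leq_trans (size_polyMleq _ _) _; lia.
Qed.

Lemma dpoly_exp e f k : dpoly e f -> dpoly (e * k) (fun u => f u ^+ k).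
Proof.
move=> fe; elim: k => [|k IHk]; first exact: dpolyC.
apply: (@dpoly_ext _ _ (fun u => f u * f u ^+ k)) => [u|].
  by rewrite exprS.
by rewrite mulnS; apply: dpolyM.
Qed.

Lemma dpoly_sum (I : Type) (r : seq I) (P : pred I) e (F : I -> K -> K) :
  (forall i, P i -> dpoly e (F i)) ->
  dpoly e (fun u => \sum_(i <- r | P i) F i u).
Proof.
move=> FE; elim: r => [|i r IHr].
  by apply: (dpoly_ext _ (dpolyC e 0)) => u; rewrite big_nil.
have [Pi|nPi] := boolP (P i).
  apply: (dpoly_ext _ (dpolyD (FE i Pi) IHr)) => u.
  by rewrite big_cons Pi.
by apply: (dpoly_ext _ IHr) => u; rewrite big_cons (negbTE nPi).
Qed.

Lemma dpoly_prod (I : Type) (r : seq I) (d : I -> nat) (F : I -> K -> K) :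
  (forall i, dpoly (d i) (F i)) ->
  dpoly (\sum_(i <- r) d i) (fun u => \prod_(i <- r) F i u).
Proof.
move=> FE; elim: r => [|i r IHr].
  by apply: (dpoly_ext _ (dpolyC _ 1)) => u; rewrite big_nil.
rewrite big_cons; apply: (dpoly_ext _ (dpolyM (FE i) IHr)) => u.
by rewrite big_cons.
Qed.

Lemma ispoly_ext f g : f =1 g -> ispoly g -> ispoly f.
Proof. by move=> fg [e ge]; exists e; apply: dpoly_ext ge. Qed.

Lemma ispolyC c : ispoly (fun=> c).
Proof. by exists 0; exact: dpolyC. Qed.

Lemma ispolyX : ispoly id.
Proof. by exists 1; exact: dpolyX. Qed.

Lemma ispolyD f g : ispoly f -> ispoly g -> ispoly (fun u => f u + g u).
Proof.
move=> [e fe] [e' ge]; exists (maxn e e').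
by apply: dpolyD; [apply: dpolyW fe | apply: dpolyW ge];
  rewrite ?leq_maxl ?leq_maxr.
Qed.

Lemma ispolyM f g : ispoly f -> ispoly g -> ispoly (fun u => f u * g u).
Proof. by move=> [e fe] [e' ge]; exists (e + e')%N; apply: dpolyM. Qed.

Lemma ispolyN f : ispoly f -> ispoly (fun u => - f u).
Proof.
move=> pf; apply: (ispoly_ext _ (ispolyM (ispolyC (-1)) pf)) => u.
by rewrite mulN1r.
Qed.

Lemma ispolyB f g : ispoly f -> ispoly g -> ispoly (fun u => f u - g u).
Proof. by move=> pf pg; apply: ispolyD => //; apply: ispolyN. Qed.

Lemma ispoly_exp f k : ispoly f -> ispoly (fun u => f u ^+ k).
Proof. by move=> [e fe]; exists (e * k)%N; apply: dpoly_exp. Qed.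

Lemma ispoly_sum (I : Type) (r : seq I) (F : I -> K -> K) :
  (forall i, ispoly (F i)) -> ispoly (fun u => \sum_(i <- r) F i u).
Proof.
move=> FE; elim: r => [|i r IHr].
  by apply: (ispoly_ext _ (ispolyC 0)) => u; rewrite big_nil.
by apply: (ispoly_ext _ (ispolyD (FE i) IHr)) => u; rewrite big_cons.
Qed.

Lemma ispoly_prod (I : Type) (r : seq I) (F : I -> K -> K) :
  (forall i, ispoly (F i)) -> ispoly (fun u => \prod_(i <- r) F i u).
Proof.
move=> FE; elim: r => [|i r IHr].
  by apply: (ispoly_ext _ (ispolyC 1)) => u; rewrite big_nil.
by apply: (ispoly_ext _ (ispolyM (FE i) IHr)) => u; rewrite big_cons.
Qed.

(** Characteristic zero, in the form that is used: the points 0, 1, 2, ... of the field are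
    distinct, so there are enough of them to test polynomials of any degree. *)
Hypothesis natK : injective (fun k : nat => k%:R : K).

Lemma dpoly_eq0 e f : dpoly e f -> (forall i, (i <= e)%N -> f i%:R = 0) ->
  f =1 fun=> 0.
Proof.
move=> [p sp fp] f0; suff p0 : p = 0 by move=> u; rewrite fp p0 horner0.
apply/eqP; apply: contraT => p0.
have := @max_poly_roots K p [seq i%:R | i <- iota 0 e.+1] p0.
rewrite map_inj_uniq ?iota_uniq // size_map size_iota.
rewrite [(_ < _)%N]leqNgt ltnS sp => H; apply: H => //.
rewrite all_map; apply/allP => i; rewrite mem_iota => /andP[_ ie].
by rewrite /= /root -fp f0.
Qed.

Lemma ispoly_mul_eq0 f g : ispoly f -> ispoly g ->
  (forall u, f u * g u = 0) -> f =1 (fun=> 0) \/ g =1 (fun=> 0).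
Proof.
move=> [e [p sp fp]] [e' [q sq gq]] fg0.
suff /eqP : p * q = 0.
  by rewrite mulf_eq0 => /orP[] /eqP z0; [left|right] => u;
    rewrite ?fp ?gq z0 horner0.
apply/eqP; apply: contraT => pq0.
have := @max_poly_roots K (p * q) [seq i%:R | i <- iota 0 (size (p * q))] pq0.
rewrite map_inj_uniq ?iota_uniq // size_map size_iota ltnn => H; apply: H => //.
by apply/allP => x _; rewrite /root hornerM -fp -gq fg0.
Qed.

(** Density of a nonempty open subset of the affine line: g collects the finitely many excluded
    parameters, and [u0] witnesses that g is not identically zero. *)
Lemma ispoly_vanish f g u0 : ispoly f -> ispoly g -> g u0 != 0 ->
  (forall u, g u != 0 -> f u = 0) -> forall u, f u = 0.
Proof.
move=> pf pg g0 fg.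
have [//|g00] : f =1 (fun=> 0) \/ g =1 (fun=> 0).
  apply: ispoly_mul_eq0 => // u.
  by have [->|/fg ->] := eqVneq (g u) 0; rewrite ?mulr0 ?mul0r.
by rewrite g00 eqxx in g0.
Qed.

End PolynomialFunctions.

Section Paths.
Variables (K : fieldType) (n : nat).
Implicit Types (f : {mpoly K[n]}) (w : K -> 'rV[K]_n).

Definition dpath e w := forall i, dpoly e (fun u => w u 0 i).

Definition ispath w := forall i, ispoly (fun u => w u 0 i).

Lemma ispathC x : ispath (fun=> x).
Proof. by move=> i; apply: ispolyC. Qed.

Lemma ispathD w w' : ispath w -> ispath w' -> ispath (fun u => w u + w' u).
Proof.
by move=> pw pw' i; apply: ispoly_ext (ispolyD (pw i) (pw' i)) => u;
  rewrite mxE.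
Qed.

Lemma ispathZ (a : K -> K) w : ispoly a -> ispath w ->
  ispath (fun u => a u *: w u).
Proof.
by move=> pa pw i; apply: ispoly_ext (ispolyM pa (pw i)) => u; rewrite mxE.
Qed.

Lemma dpoly_meval e d f w : f \is d.-homog -> dpath e w ->
  dpoly (e * d) (fun u => f.@[w u 0]).
Proof.
move=> fd we; apply: (dpoly_ext (g := fun u => \sum_(m <- msupp f | m \in msupp f)
    f@_m * \prod_i w u 0 i ^+ m i)) => [u|].
  by rewrite mevalE [LHS]big_seq.
apply: dpoly_sum => m mf; rewrite -[(e * d)%N]add0n.
apply: dpolyM; first exact: dpolyC.
have <- : (\sum_(i < n) e * m i = e * d)%N.
  by rewrite -big_distrr /= -mdegE (dhomog_mf fd mf).
by apply: dpoly_prod => i; apply: dpoly_exp.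
Qed.

Lemma ispoly_meval f w : ispath w -> ispoly (fun u => f.@[w u 0]).
Proof.
move=> pw; apply: (ispoly_ext (fun u => mevalE _ f)).
apply: ispoly_sum => m; apply: ispolyM; first exact: ispolyC.
by apply: ispoly_prod => i; apply: ispoly_exp.
Qed.

End Paths.

Arguments ispathC {K n}.

Lemma mevalZ_homog (K : fieldType) n d (f : {mpoly K[n]}) (c : K) (x : 'rV[K]_n) :
  f \is d.-homog -> f.@[(c *: x) 0] = c ^+ d * f.@[x 0].
Proof.
move=> fd; rewrite !mevalE mulr_sumr big_seq [RHS]big_seq.
apply: eq_bigr => m mf; rewrite mulrCA; congr (_ * _).
have dm : mdeg m = d by exact: (dhomog_mf fd).
rewrite -dm mdegE.
under eq_bigr do rewrite mxE exprMn.
by rewrite big_split /= prodrXr.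
Qed.

(** * Forms as functions on coordinate vectors, and closed sets *)

Section Forms.
Variables (K : fieldType) (n : nat).
Implicit Types (F G : 'rV[K]_n -> K) (A B Z : set 'rV[K]_n).

(** Equations can thus be written as plain formulas in the coordinates, with homogeneity certified
    separately by closure rules. *)
Definition form d F :=
  exists2 f : {mpoly K[n]}, f \is d.-homog & forall x : 'rV[K]_n, F x = f.@[x 0].

Lemma form_ext d F G : F =1 G -> form d G -> form d F.
Proof. by move=> FG [g gd Gg]; exists g => // x; rewrite FG. Qed.

Lemma form0 d : form d (fun=> 0).
Proof. by exists 0 => [|x]; rewrite ?dhomog0 ?meval0. Qed.

Lemma form1 : form 0 (fun=> 1).
Proof. by exists 1 => [|x]; rewrite ?dhomog1 ?meval1. Qed.

Lemma form_coord i : form 1 (fun x => x 0 i).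
Proof. exists 'X_i => [|x]; last by rewrite mevalXU.
by rewrite dhomogX /= mdeg1. Qed.

Lemma formD d F G : form d F -> form d G -> form d (fun x => F x + G x).
Proof.
move=> [f fd Ff] [g gd Gg]; exists (f + g); first exact: dhomogD.
by move=> x; rewrite mevalD Ff Gg.
Qed.

Lemma formZ d c F : form d F -> form d (fun x => c * F x).
Proof.
move=> [f fd Ff]; exists (c *: f); first exact: dhomogZ.
by move=> x; rewrite mevalZ Ff.
Qed.

Lemma formN d F : form d F -> form d (fun x => - F x).
Proof.
by move=> dF; apply: form_ext (formZ (-1) dF) => x; rewrite mulN1r.
Qed.

Lemma formB d F G : form d F -> form d G -> form d (fun x => F x - G x).
Proof. by move=> dF dG; apply: formD => //; apply: formN. Qed.

Lemma formM d e F G : form d F -> form e G -> form (d + e) (fun x => F x * G x).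
Proof.
move=> [f fd Ff] [g gd Gg]; exists (f * g); first exact: dhomogM.
by move=> x; rewrite mevalM Ff Gg.
Qed.

Lemma form_exp d F k : form d F -> form (d * k) (fun x => F x ^+ k).
Proof.
move=> dF; elim: k => [|k IHk]; first by rewrite muln0; exact: form1.
rewrite mulnS; apply: form_ext (formM dF IHk) => x; by rewrite exprS.
Qed.

Lemma form_sum (I : Type) (r : seq I) (P : pred I) d (F : I -> 'rV[K]_n -> K) :
  (forall i, P i -> form d (F i)) -> form d (fun x => \sum_(i <- r | P i) F i x).
Proof.
move=> Fd; elim: r => [|i r IHr].
  by apply: form_ext (form0 d) => x; rewrite big_nil.
have [Pi|nPi] := boolP (P i).
  by apply: form_ext (formD (Fd i Pi) IHr) => x; rewrite big_cons Pi.
by apply: form_ext IHr => x; rewrite big_cons (negbTE nPi).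
Qed.

Lemma form_mulmx m (M : 'M[K]_(n, m)) j : form 1 (fun x => (x *m M) 0 j).
Proof.
apply: (form_ext (G := fun x => \sum_(i < n) M i j * x 0 i)) => [x|].
  by rewrite mxE; apply: eq_bigr => i _; rewrite mulrC.
by apply: form_sum => i _; apply/formZ/form_coord.
Qed.

Lemma zclosedP Z : (forall x, Z x -> x != 0) -> zclosure Z `<=` Z -> zclosed Z.
Proof.
move=> Z0 clZ; apply/seteqP; split=> // x Zx; split; first exact: Z0.
by move=> d f _; apply.
Qed.

Lemma zclosed_neq0 Z x : zclosed Z -> Z x -> x != 0.
Proof. by move=> -> []. Qed.

Lemma zclosed_forms (I : Type) (d : I -> nat) (F : I -> 'rV[K]_n -> K) :
  (forall i, form (d i) (F i)) ->
  zclosed [set x | x != 0 /\ forall i, F i x = 0].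
Proof.
move=> Fd; apply: zclosedP => [x []//|x [x0 clx]]; split=> // i.
have [f fd Ff] := Fd i.
by rewrite Ff; apply: clx fd _ => z [_ Fz]; rewrite -Ff Fz.
Qed.

Lemma zclosed_form d F : form d F -> zclosed [set x | x != 0 /\ F x = 0].
Proof.
move=> dF; rewrite [X in zclosed X](_ : _ =
  [set x | x != 0 /\ forall i : unit, (fun=> F) i x = 0]).
  exact: (zclosed_forms (d := fun=> d)).
by apply/seteqP; split=> x [x0 Fx]; split => //; apply: Fx tt.
Qed.

Lemma zclosedI A B : zclosed A -> zclosed B -> zclosed (A `&` B).
Proof.
move=> cA cB; apply: zclosedP => [x [Ax _]|x [x0 clx]].
  exact: zclosed_neq0 cA Ax.
by split; [rewrite cA | rewrite cB]; split=> // d f fd f0;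
  apply: clx fd _ => z [Az Bz]; apply: f0.
Qed.

Lemma zclosed_plinear m (U : 'M[K]_(m, n)) : zclosed (plinear U).
Proof.
rewrite [X in zclosed X](_ : _ =
  [set x | x != 0 /\ forall i, (x *m cokermx U) 0 i = 0]).
  apply: (@zclosed_forms _ (fun=> 1%N) (fun i x => (x *m cokermx U) 0 i)) => i.
  exact: form_mulmx.
apply/seteqP; split=> x [x0].
  by rewrite submxE => /eqP xU; split=> // i; rewrite xU mxE.
move=> xU; split=> //; rewrite submxE; apply/eqP/rowP => i.
by rewrite xU mxE.
Qed.

Lemma zclosureP Z x : zclosed Z -> x != 0 -> ~ Z x ->
  exists d F, [/\ form d F, forall z, Z z -> F z = 0 & F x != 0].
Proof.
move=> cZ x0 nZx; apply: contrapT => nF; apply: nZx; rewrite cZ; split => //.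
move=> d f fd f0; have [//|fx] := eqVneq f.@[x 0] 0.
by case: nF; exists d, (fun x => f.@[x 0]); split => //; exists f.
Qed.

(** The zero loci of F and G are closed and cover Z; this is the primality of the homogeneous ideal
    of Z. *)
Lemma irreducible_mul Z d e F G : irreducible_closed Z -> form d F -> form e G ->
  (forall x, Z x -> F x * G x = 0) ->
  (forall x, Z x -> F x = 0) \/ (forall x, Z x -> G x = 0).
Proof.
move=> [cZ _ iZ] dF eG FG0.
have := iZ _ _ (zclosed_form dF) (zclosed_form eG).
case=> [x Zx|ZF|ZG]; last 2 first.
- by left=> x /ZF [].
- by right=> x /ZG [].
have x0 := zclosed_neq0 cZ Zx.
by move/eqP: (FG0 x Zx); rewrite mulf_eq0 => /orP[] /eqP; [left|right].
Qed.

(** Cancellation in the homogeneous coordinate ring of Z, which is a domain: a power of a form that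
    is nonzero at one point of Z can be divided out. *)
Lemma irreducible_exp Z d F x : irreducible_closed Z -> form d F -> Z x ->
  F x != 0 -> forall e G k, form e G ->
  (forall y, Z y -> F y ^+ k * G y = 0) -> forall y, Z y -> G y = 0.
Proof.
move=> iZ dF Zx Fx e G k eG FG0.
have [F0|//] := irreducible_mul iZ (form_exp k dF) eG FG0.
by move/eqP: (F0 x Zx); rewrite expf_eq0 (negbTE Fx) andbF.
Qed.

End Forms.

(** * Irreducibility through polynomial paths *)

Section Irreducible.
Variables (K : fieldType) (n : nat).
Hypothesis natK : injective (fun k : nat => k%:R : K).
Implicit Types (A B Z : set 'rV[K]_n).

Lemma zclosure_path Z (w : K -> 'rV[K]_n) (g : K -> K) x u0 :
  ispath w -> ispoly g -> g u0 != 0 -> x != 0 -> w 0 = x ->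
  (forall u, g u != 0 -> Z (w u)) -> zclosure Z x.
Proof.
move=> pw pg gu0 x0 wx Zw; split=> // d f fd f0; rewrite -wx.
apply: (ispoly_vanish natK (f := fun u => f.@[w u 0]) _ pg gu0).
  exact: ispoly_meval.
by move=> u gu; apply: f0; apply: Zw.
Qed.

Lemma irreducible_paths Z : zclosed Z -> Z !=set0 ->
  (forall x y, Z x -> Z y -> exists w : K -> 'rV[K]_n,
     [/\ ispath w, w 0 = x, w 1 = y & forall u, w u != 0 -> Z (w u)]) ->
  irreducible_closed Z.
Proof.
move=> cZ Z0 pZ; split=> // A B cA cB ZAB; apply: contrapT => /not_orP[nA nB].
have [x [Zx nAx]] : exists x, Z x /\ ~ A x.
  by apply: contrapT => H; apply: nA => x Zx; apply: contrapT => Ax; apply: H; exists x.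
have [y [Zy nBy]] : exists x, Z x /\ ~ B x.
  by apply: contrapT => H; apply: nB => y Zy; apply: contrapT => By; apply: H; exists y.
have [x0 y0] := (zclosed_neq0 cZ Zx, zclosed_neq0 cZ Zy).
have [d [F [[f fd Ff] FA Fx]]] := zclosureP cA x0 nAx.
have [e [G [[g ge Gg] GB Gy]]] := zclosureP cB y0 nBy.
have [w [pw w0 w1 wZ]] := pZ x y Zx Zy.
have [i xi] : exists i, x 0 i != 0 by apply/rV0Pn.
(* The path may pass through the zero vector, which is no point of projective space. The extra
   factor, a coordinate that is nonzero at w 0 = x, makes the product vanish there too and is not
   identically zero. *)
have FG0 u : F (w u) * (G (w u) * w u 0 i) = 0.
  have [->|wu0] := eqVneq (w u) 0; first by rewrite !mxE !mulr0.
  by case: (ZAB _ (wZ _ wu0)) => [/FA ->|/GB ->]; rewrite ?mul0r ?mulr0.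
have pF : ispoly (fun u => F (w u)).
  by apply: ispoly_ext (ispoly_meval f pw) => u; rewrite Ff.
have pG : ispoly (fun u => G (w u)).
  by apply: ispoly_ext (ispoly_meval g pw) => u; rewrite Gg.
have [F0|] := ispoly_mul_eq0 natK pF (ispolyM pG (pw i)) FG0.
  by move: (F0 0); rewrite w0 => F00; rewrite F00 eqxx in Fx.
move=> /(ispoly_mul_eq0 natK pG (pw i)) [G0|wi0].
  by move: (G0 1); rewrite w1 => G10; rewrite G10 eqxx in Gy.
by move: (wi0 0); rewrite w0 => xi0; rewrite xi0 eqxx in xi.
Qed.

Lemma irreducible_plinear m (U : 'M[K]_(m, n)) : U != 0 ->
  irreducible_closed (plinear U).
Proof.
move=> /rowV0Pn[v vU v0]; apply: irreducible_paths; first exact: zclosed_plinear.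
  by exists v.
move=> x y [x0 xU] [y0 yU]; exists (fun u => x + u *: (y - x)); split.
- apply: ispathD; first exact: ispathC.
  by apply: ispathZ; [exact: ispolyX | exact: ispathC].
- by rewrite scale0r addr0.
- by rewrite scale1r addrC subrK.
- move=> u wu0; split=> //; apply: addmx_sub => //; apply: scalemx_sub.
  by rewrite addmx_sub ?eqmx_opp.
Qed.

End Irreducible.

(** * Bounding the length of chains in a surface with a chart *)

Section Dimension.
Variables (K : fieldType) (n : nat).
Hypothesis natK : injective (fun k : nat => k%:R : K).
Implicit Types (A B Z : set 'rV[K]_n).

Lemma dep_family (I J : finType) (A : I -> J -> K) : (#|J| < #|I|)%N ->
  exists2 v : I -> K, (exists i, v i != 0) & forall j, \sum_i v i * A i j = 0.
Proof.
move=> JI; pose M := \matrix_(i < #|I|, j < #|J|) A (enum_val i) (enum_val j).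
have : kermx M != 0.
  by rewrite kermx_eq0 -row_leq_rank -ltnNge (leq_ltn_trans (rank_leq_col _)).
move=> /rowV0Pn[w /sub_kermxP wM w0].
exists (fun i => w 0 (enum_rank i)).
  by have /rV0Pn[k wk] := w0; exists (enum_val k); rewrite enum_valK.
move=> j; have /rowP/(_ (enum_rank j)) := wM; rewrite !mxE => wj0; rewrite -[RHS]wj0.
rewrite (reindex (fun k : 'I_#|I| => enum_val k)) /=; last first.
  by exists enum_rank => k _; [apply: enum_valK | apply: enum_rankK].
by apply: eq_bigr => k _; rewrite enum_valK !mxE enum_rankK.
Qed.

(** Bounded degree in each variable separately: the values on the grid {0, ..., e} x {0, ..., e}
    decide, by applying the one-variable case twice. This replaces the dimension (e + 1)^2 of the
    space of such polynomials by a count of points. *)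
Lemma dpoly2_eq0 e (F : K -> K -> K) :
  (forall s, dpoly e (F s)) -> (forall r, dpoly e (fun s => F s r)) ->
  (forall i j, (i <= e)%N -> (j <= e)%N -> F i%:R j%:R = 0) ->
  forall s r, F s r = 0.
Proof.
move=> Fr Fs F0 s r.
apply: (dpoly_eq0 natK (Fs r)) => i ie.
by apply: (dpoly_eq0 natK (Fr _)) => j je; apply: F0.
Qed.

(* The image of [w] is a dense subset of the cone over the surface Z. *)
Definition charted e (Z : set 'rV[K]_n) (w : K -> K -> 'rV[K]_n) :=
  [/\ forall s, dpath e (w s), forall r, dpath e (w^~ r) &
      forall d (F : 'rV[K]_n -> K), form d F -> (forall s r, F (w s r) = 0) ->
        forall x, Z x -> F x = 0].

(** A combination of forms of degree M pulls back to the chart with degree at most e M in each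
    parameter, so it vanishes on Z once it vanishes at (e M + 1)^2 grid points; more forms than grid
    points admit such a combination. *)
Lemma charted_forms e Z w (I : finType) M (F : I -> 'rV[K]_n -> K) :
  charted e Z w -> (forall i, form M (F i)) -> ((e * M).+1 ^ 2 < #|I|)%N ->
  exists2 v : I -> K, (exists i, v i != 0) &
    forall x, Z x -> \sum_i v i * F i x = 0.
Proof.
move=> [ws wr dense] FM cI.
pose J : finType := ('I_(e * M).+1 * 'I_(e * M).+1)%type.
have [|v v0 vF] := @dep_family I J (fun i j => F i (w j.1%:R j.2%:R)).
  by rewrite card_prod card_ord.
exists v => //; apply: (dense M).
  by apply: form_sum => i _; apply: formZ.
move=> s r; move: s r; apply: (@dpoly2_eq0 (e * M)) => [s|r|i j ie je].
- apply: dpoly_sum => i _; rewrite -[(e * M)%N]add0n.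
  apply: dpolyM; first exact: dpolyC.
  have [f fM Ff] := FM i.
  by apply: dpoly_ext (dpoly_meval fM (ws s)) => u; rewrite Ff.
- apply: dpoly_sum => i _; rewrite -[(e * M)%N]add0n.
  apply: dpolyM; first exact: dpolyC.
  have [f fM Ff] := FM i.
  by apply: dpoly_ext (dpoly_meval fM (wr r)) => u; rewrite Ff.
- exact: (vF (@Ordinal (e * M).+1 i ie, @Ordinal (e * M).+1 j je)).
Qed.

(* A relation between the powers of F on Z, where F vanishes on W but not on
   Z, restricts to its constant term on W and can then be divided by F. *)
Lemma irreducible_powers Z (W : set 'rV[K]_n) d (F : 'rV[K]_n -> K) M N
    (G : nat -> 'rV[K]_n -> K) (P : nat -> Prop) x0 :
  irreducible_closed Z -> W `<=` Z -> form d F -> Z x0 -> F x0 != 0 ->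
  (forall x, W x -> F x = 0) -> (d * N <= M)%N ->
  (forall e, (e <= N)%N -> form (M - d * e) (G e)) ->
  (forall e, (e <= N)%N -> (forall x, W x -> G e x = 0) -> P e) ->
  (forall e, (e <= N)%N -> P e -> forall x, G e x = 0) ->
  (forall x, Z x -> \sum_(e < N.+1) G e x * F x ^+ e = 0) ->
  forall e, (e <= N)%N -> P e.
Proof.
move=> iZ WZ dF Zx0 Fx0 FW dNM Gd GP PG G0.
elim/ltn_ind => k IHk kN; apply: GP => // x Wx.
(* What is left of the relation once the terms below k are known to vanish, divided by F^k. *)
pose H x := \sum_(e < N.+1 | (k <= e)%N) G e x * F x ^+ (e - k).
have HM : form (M - d * k) H.
  apply: form_sum => e ke; have eN : (e <= N)%N by rewrite -ltnS.
  have <- : (M - d * e + d * (e - k) = M - d * k)%N.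
    have : (d * e <= d * N)%N by rewrite leq_mul2l eN orbT.
    have : (d * k <= d * e)%N by rewrite leq_mul2l ke orbT.
    by rewrite mulnBr; lia.
  by apply: formM; [apply: Gd | apply: form_exp].
have H0 : forall y, Z y -> H y = 0.
  apply: (irreducible_exp iZ dF Zx0 Fx0 (k := k) HM) => y Zy.
  rewrite -[RHS](G0 y Zy) mulr_sumr [RHS](bigID (fun e : 'I_N.+1 => (k <= e)%N)) /=.
  rewrite [X in _ = _ + X]big1 ?addr0 => [|e]; last first.
    rewrite -ltnNge => ek; have eN : (e <= N)%N by rewrite -ltnS.
    by rewrite PG ?mul0r //; apply: IHk.
  by apply: eq_bigr => e ke; rewrite mulrCA -exprD subnKC.
(* On W the form F vanishes, so of H only the term e = k survives. *)
rewrite -[RHS](H0 x (WZ x Wx)) /H.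
rewrite (bigD1 (Ordinal (kN : (k < N.+1)%N))) //= subnn expr0 mulr1.
rewrite big1 ?addr0 // => e /andP[ke ek].
rewrite (FW x Wx) expr0n [(e - k)%N == 0%N](_ : _ = false) ?mulr0 //.
apply/negbTE; move: ek; apply: contraNneq => ek0; apply/eqP/val_inj => /=.
by apply/eqP; rewrite eqn_leq ke -subn_eq0 ek0.
Qed.

Lemma charted_dim e Z w : charted e Z w -> ~ has_chain Z 3.
Proof.
move=> Zw [c [ci cS]].
have [[i0 _] [i1 _] [i2 _] [i3 c3Z]] :
  [/\ irreducible_closed (c 0%N) /\ c 0%N `<=` Z,
      irreducible_closed (c 1%N) /\ c 1%N `<=` Z,
      irreducible_closed (c 2%N) /\ c 2%N `<=` Z &
      irreducible_closed (c 3%N) /\ c 3%N `<=` Z] by split; apply: ci.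
have step k : (k < 3)%N -> exists d F x, [/\ form d F,
    forall x, c k x -> F x = 0, c k.+1 x & F x != 0].
  move=> k3; have [_ nck] := cS k k3.
  have [x [cx ncx]] : exists x, c k.+1 x /\ ~ c k x.
    apply: contrapT => H; apply: nck => x cx; apply: contrapT => ncx.
    by apply: H; exists x.
  have [cc _ _] := (ci k (ltnW k3)).1; have [cc' _ _] := (ci k.+1 k3).1.
  have [d [F [dF Fc Fx]]] := zclosureP cc (zclosed_neq0 cc' cx) ncx.
  by exists d, F, x.
have sub k : (k < 3)%N -> c k `<=` c k.+1 by move=> /cS [].
have [d1 [F1 [x1 [f1 F1c c1x F1x]]]] := step 0%N isT.
have [d2 [F2 [x2 [f2 F2c c2x F2x]]]] := step 1%N isT.
have [d3 [F3 [x3 [f3 F3c c3x F3x]]]] := step 2%N isT.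
have [x c0x] : c 0%N !=set0 by case: i0.
have [i xi] : exists i, x 0 i != 0.
  by apply/rV0Pn; case: i0 => cc _ _; apply: zclosed_neq0 cc c0x.
(* The monomials in F1, F2, F3 with exponents at most N number (N + 1)^3, and M = N S leaves a
   nonnegative exponent for the coordinate that fills up the degree. The choice of N gives (e M +
   1)^2 <= N^2 (e S + 1)^2 = N^3. *)
pose S := (d1 + d2 + d3)%N; pose N := ((e * S).+1 ^ 2)%N; pose M := (N * S)%N.
pose I : finType := ('I_N.+1 * ('I_N.+1 * 'I_N.+1))%type.
have le3 (a b g : nat) : (a <= N -> b <= N -> g <= N ->
    d3 * a <= M /\ d2 * b <= M - d3 * a /\ d1 * g <= M - d3 * a - d2 * b)%N.
  move=> aN bN gN.
  have := leq_mul (leqnn d3) aN; have := leq_mul (leqnn d2) bN.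
  by have := leq_mul (leqnn d1) gN; rewrite /M /S; lia.
pose mono (a b g : nat) (y : 'rV[K]_n) :=
  y 0 i ^+ (M - d3 * a - d2 * b - d1 * g) * F1 y ^+ g * F2 y ^+ b * F3 y ^+ a.
have monoM (a b g : 'I_N.+1) : form M (mono a b g).
  have [|||h1 [h2 h3]] := le3 a b g; try by rewrite -ltnS.
  rewrite [X in form X](_ : _ = 1 * (M - d3 * a - d2 * b - d1 * g) + d1 * g
    + d2 * b + d3 * a)%N; last by lia.
  by do !apply: formM; apply: form_exp => //; apply: form_coord.
have [|v [ijk vijk] v0] :=
    charted_forms (I := I) (F := fun j => mono j.1 j.2.1 j.2.2) Zw
      (fun j => monoM j.1 j.2.1 j.2.2).
  rewrite !card_prod !card_ord /M.
  have N0 : (0 < N)%N by rewrite expn_gt0.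
  have le : ((e * (N * S)).+1 <= N * (e * S).+1)%N.
    by rewrite mulnS mulnCA; lia.
  apply: (@leq_ltn_trans (N * N * N)).
    rewrite -{3}[N]/((e * S).+1 ^ 2)%N; move: le; rewrite -leq_sqr => /leq_trans ->//.
    by rewrite expnMn -mulnn.
  by rewrite mulnA !ltn_mul.
have vS (y : 'rV[K]_n) : Z y -> \sum_(a < N.+1) \sum_(b < N.+1) \sum_(g < N.+1)
    v (a, (b, g)) * mono a b g y = 0.
  move=> Zy; rewrite -[RHS](v0 y Zy); under eq_bigr do rewrite pair_bigA.
  by rewrite pair_bigA; apply: eq_bigr => -[a [b g]].
pose o (k : nat) : 'I_N.+1 := inord k.
have inN k : (k <= N)%N -> o k = k :> nat by move=> kN; rewrite inordK.
(* The relation is read as a polynomial in F3 with coefficients [G3], these as polynomials in F2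
   with coefficients [G2], and these in F1 with coefficients [G1]. *)
pose G1 (a b g : nat) (y : 'rV[K]_n) := v (o a, (o b, o g)) * y 0 i ^+ (M - d3 * a - d2 * b - d1 * g).
pose G2 (a b : nat) (y : 'rV[K]_n) := \sum_(g < N.+1) G1 a b g y * F1 y ^+ g.
pose G3 (a : nat) (y : 'rV[K]_n) := \sum_(b < N.+1) G2 a b y * F2 y ^+ b.
have G1d a b g : form (M - d3 * a - d2 * b - d1 * g) (G1 a b g).
  by apply: formZ; rewrite -[X in form X]mul1n; apply/form_exp/form_coord.
have G2d a b : (a <= N)%N -> (b <= N)%N -> form (M - d3 * a - d2 * b) (G2 a b).
  move=> aN bN; apply: form_sum => g _.
  have [//|//||h1 [h2 h3]] := le3 a b g; first by rewrite -ltnS.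
  rewrite [X in form X](_ : _ = (M - d3 * a - d2 * b - d1 * g) + d1 * g)%N.
    by apply: formM => //; apply: form_exp.
  by lia.
have G3d a : (a <= N)%N -> form (M - d3 * a) (G3 a).
  move=> aN; apply: form_sum => b _; have bN : (b <= N)%N by rewrite -ltnS.
  have [//|//||h1 [h2 h3]] := le3 a b 0%N; first by [].
  rewrite [X in form X](_ : _ = (M - d3 * a - d2 * b) + d2 * b)%N; last by lia.
  by apply: formM; [apply: G2d | apply: form_exp].
suff v00 (a : nat) : (a <= N)%N -> forall b, (b <= N)%N -> forall g, (g <= N)%N ->
    v (o a, (o b, o g)) = 0.
  case: ijk vijk => a [b g]; have := v00 a _ b _ g _; rewrite /o !inord_val.
  by move=> -> //; rewrite ?eqxx // -ltnS.
(* Descent along the chain: on c 3 the powers of F3 isolate the index a, on c 2 those of F2 isolate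
   b, on c 1 those of F1 isolate g. At the point x of c 0 the remaining coefficient multiplies a
   power of x_i, which is nonzero. *)
apply: (irreducible_powers i3 (sub 2%N isT) f3 c3x F3x F3c (N := N) (M := M)
    (G := G3) (P := fun a => forall b, (b <= N)%N -> forall g, (g <= N)%N ->
      v (o a, (o b, o g)) = 0)) => //.
- by have [//|//|//|h1 _] := le3 N 0%N 0%N.
- move=> {}a aN G30.
  apply: (irreducible_powers i2 (sub 1%N isT) f2 c2x F2x F2c (N := N)
    (M := M - d3 * a) (G := G2 a) (P := fun b => forall g, (g <= N)%N ->
      v (o a, (o b, o g)) = 0)) => //.
  + by have [//|//|//|_ [h1 _]] := le3 a N 0%N.
  + by move=> b bN; apply: G2d.
  + move=> b bN G20.
    apply: (irreducible_powers i1 (sub 0%N isT) f1 c1x F1x F1c (N := N)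
      (M := M - d3 * a - d2 * b) (G := G1 a b)
      (P := fun g => v (o a, (o b, o g)) = 0)) => //.
    * by have [//|//|//|_ [_ h1]] := le3 a b N.
    * by move=> g gN /(_ x c0x)/eqP; rewrite /G1 mulf_eq0 expf_eq0 (negbTE xi)
        andbF orbF => /eqP.
    * by move=> g gN vg y; rewrite /G1 vg mul0r.
  + by move=> b bN vb y; rewrite /G2 big1 // => g _; rewrite /G1 vb ?mul0r // -ltnS.
- move=> {}a aN va y; rewrite /G3 big1 // => b _.
  rewrite /G2 big1 ?mul0r // => g _.
  by rewrite /G1 va ?mul0r // -ltnS.
- move=> y /c3Z/vS y0; rewrite -[RHS]y0; apply: eq_bigr => a1 _; rewrite /G3 mulr_suml.
  apply: eq_bigr => b1 _; rewrite /G2 !mulr_suml; apply: eq_bigr => g1 _.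
  by rewrite /G1 /o !inord_val /mono !mulrA.
Qed.

Lemma has_dim2 Z e w m1 m2 (U1 : 'M[K]_(m1, n)) (U2 : 'M[K]_(m2, n)) :
  charted e Z w -> irreducible_closed Z -> U1 != 0 ->
  plinear U1 `<` plinear U2 -> plinear U2 `<` Z -> has_dim Z 2.
Proof.
move=> Zw iZ U10 U12 U2Z; split; last exact: charted_dim Zw.
have U20 : U2 != 0.
  apply/rowV0Pn; have /rowV0Pn[v vU v0] := U10.
  by have [_ vU2] := U12.1 v (conj v0 vU); exists v.
exists (fun k => match k with 0 => plinear U1 | 1 => plinear U2 | _ => Z end)%N.
split=> [[|[|[|//]]]|[|[|//]]] //= _.
- split; first exact: irreducible_plinear.
  by apply: subset_trans U12.1 U2Z.1.
- by split; [exact: irreducible_plinear | exact: U2Z.1].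
- by split.
Qed.

End Dimension.

(** * Flat limits *)

Section LinearSpans.
Variables (K : fieldType) (n : nat).
Implicit Types (a b c x : 'rV[K]_n).

Lemma plinear1P a x : plinear a x <-> x != 0 /\ exists s, x = s *: a.
Proof.
split=> -[x0]; first by move/sub_rVP => [s xs]; split=> //; exists s.
by move=> [s xs]; split=> //; rewrite xs scalemx_sub.
Qed.

Lemma submx_col2 a b x :
  (x <= col_mx a b)%MS <-> exists s r, x = s *: a + r *: b.
Proof.
rewrite -addsmxE; split=> [xab|[s [r ->]]]; last first.
  by rewrite addmx_sub_adds ?scalemx_sub.
have [[u v] /= ->] := sub_addsmxP xab.
by exists (u 0 0), (v 0 0); rewrite [u]mx11_scalar [v]mx11_scalar !mul_scalar_mx !mxE /=
  !mulr1n.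
Qed.

Lemma plinear2P a b x :
  plinear (col_mx a b) x <-> x != 0 /\ exists s r, x = s *: a + r *: b.
Proof. by split=> -[x0 /submx_col2]. Qed.

Lemma plinear3P a b c x : plinear (col_mx a (col_mx b c)) x <->
  x != 0 /\ exists s r q, x = s *: a + (r *: b + q *: c).
Proof.
rewrite /plinear /= -addsmxE; split=> -[x0]; last first.
  move=> [s [r [q xE]]]; split; rewrite // xE.
  apply: addmx_sub_adds; first exact: scalemx_sub.
  by apply/submx_col2; exists r, q.
move=> xab; split=> //; have [[u v] /= ->] := sub_addsmxP xab.
have /submx_col2[r [q ->]] := submxMl v (col_mx b c).
by exists (u 0 0), r, q; rewrite {1}[u]mx11_scalar mul_scalar_mx.
Qed.

End LinearSpans.

Section FlatLimits.
Variable K : fieldType.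
Hypothesis natK : injective (fun k : nat => k%:R : K).
Implicit Types (c : K * K -> K) (F G : K * K -> 'rV[K]_16 -> K).

Definition param (t : K * K) (i : 'I_2) : K := if i == ord0 then t.1 else t.2.

Definition tcoef c := exists q : {mpoly K[2]}, forall t, c t = q.@[param t].

(** The equations against which [limit] tests: an equation of this class that holds on the family
    for generic t passes to the limit. *)
Definition tform d F := exists2 f : {mpoly {mpoly K[2]}[16]}, f \is d.-homog &
  forall t x, F t x = eval_family t f x.

Lemma tcoefC k : tcoef (fun=> k).
Proof. by exists k%:MP => t; rewrite mevalC. Qed.

Lemma tcoef_fst : tcoef (fun t => t.1).
Proof. by exists 'X_ord0 => t; rewrite mevalXU. Qed.

Lemma tcoef_snd : tcoef (fun t => t.2).
Proof. by exists 'X_(lift ord0 ord0) => t; rewrite mevalXU. Qed.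

Lemma tcoefD c c' : tcoef c -> tcoef c' -> tcoef (fun t => c t + c' t).
Proof. by move=> [p pc] [q qc]; exists (p + q) => t; rewrite mevalD pc qc. Qed.

Lemma tcoefN c : tcoef c -> tcoef (fun t => - c t).
Proof. by move=> [p pc]; exists (- p) => t; rewrite mevalN pc. Qed.

Lemma tcoefM c c' : tcoef c -> tcoef c' -> tcoef (fun t => c t * c' t).
Proof. by move=> [p pc] [q qc]; exists (p * q) => t; rewrite mevalM pc qc. Qed.

Lemma ispoly_tcoef c (p q : K -> K) : tcoef c -> ispoly p -> ispoly q ->
  ispoly (fun u => c (p u, q u)).
Proof.
move=> [f cf] pp pq.
pose w u : 'rV[K]_2 := \row_i param (p u, q u) i.
have pw : ispath w.
  move=> i; apply: (ispoly_ext (g := if i == ord0 then p else q)) => [u|].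
    by rewrite mxE /param; case: (i == ord0).
  by case: (i == ord0).
apply: ispoly_ext (ispoly_meval f pw) => u; rewrite cf.
by apply: meval_eq => i; rewrite mxE.
Qed.

Lemma tformX i : tform 1 (fun _ x => x 0 i).
Proof.
exists 'X_i => [|t x]; first by rewrite dhomogX /= mdeg1.
by rewrite /eval_family map_mpolyX mevalXU.
Qed.

Lemma tformD d F G : tform d F -> tform d G -> tform d (fun t x => F t x + G t x).
Proof.
move=> [f fd Ff] [g gd Gg]; exists (f + g); first exact: dhomogD.
by move=> t x; rewrite Ff Gg /eval_family raddfD mevalD.
Qed.

Lemma tformM d e F G :
  tform d F -> tform e G -> tform (d + e) (fun t x => F t x * G t x).
Proof.
move=> [f fd Ff] [g gd Gg]; exists (f * g); first exact: dhomogM.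
by move=> t x; rewrite Ff Gg /eval_family rmorphM mevalM.
Qed.

Lemma tformZ d c F : tcoef c -> tform d F -> tform d (fun t x => c t * F t x).
Proof.
move=> [q cq] [f fd Ff]; exists (q *: f); first exact: dhomogZ.
by move=> t x; rewrite Ff cq /eval_family map_mpolyZ mevalZ.
Qed.

Lemma tformN d F : tform d F -> tform d (fun t x => - F t x).
Proof.
move=> [f fd Ff]; exists (- f); first by rewrite dhomogN.
by move=> t x; rewrite Ff /eval_family raddfN mevalN.
Qed.

Lemma limit_vanish tau Fam d F x : tform d F ->
  (forall t z, generic_t t -> Fam t z -> F t z = 0) -> limit tau Fam x ->
  F tau x = 0.
Proof.
move=> [f fd Ff] F0 [_ /(_ d f fd) fx]; rewrite Ff; apply: fx => t z gt Fz.
by rewrite -Ff F0.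
Qed.

(** Two open conditions on the affine line, each satisfied somewhere, are satisfied
    simultaneously. *)
Lemma ispoly_nz2 (f g : K -> K) u1 u2 : ispoly f -> ispoly g ->
  f u1 != 0 -> g u2 != 0 -> exists u, f u * g u != 0.
Proof.
move=> pf pg f0 g0; apply: contrapT => H.
have [u|f00|g00] := ispoly_mul_eq0 natK pf pg.
- by apply/eqP; apply: contraT => fg; case: H; exists u.
- by rewrite f00 eqxx in f0.
- by rewrite g00 eqxx in g0.
Qed.

Lemma ispoly_eval_family (f : {mpoly {mpoly K[2]}[16]}) (p q : K -> K)
    (w : K -> 'rV[K]_16) : ispoly p -> ispoly q -> ispath w ->
  ispoly (fun u => eval_family (p u, q u) f (w u)).
Proof.
move=> pp pq pw.
apply: (ispoly_ext (g := fun u => \sum_(m <- msupp f)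
    (f@_m).@[param (p u, q u)] * \prod_i w u 0 i ^+ m i)) => [u|].
  rewrite /eval_family -/(param (p u, q u)).
  have -> : map_mpoly (meval (param (p u, q u))) f =
      \sum_(m <- msupp f) map_mpoly (meval (param (p u, q u))) (f@_m *: 'X_[m]).
    by rewrite -raddf_sum -mpolyE.
  rewrite raddf_sum; apply: eq_bigr => m _.
  by rewrite map_mpolyZ map_mpolyX /= mevalZ mevalX.
apply: ispoly_sum => m; apply: ispolyM.
  by apply: (ispoly_tcoef (c := fun t => (f@_m).@[param t])) => //; exists f@_m.
by apply: ispoly_prod => i; apply: ispoly_exp.
Qed.

Lemma limit_path (tau : K * K) Fam (p q : K -> K) (w : K -> 'rV[K]_16)
    (g : K -> K) x u0 u1 :
  ispoly p -> ispoly q -> ispath w -> ispoly g ->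
  g u0 != 0 -> generic_t (p u1, q u1) -> x != 0 ->
  p 0 = tau.1 -> q 0 = tau.2 -> w 0 = x ->
  (forall u, g u != 0 -> generic_t (p u, q u) -> w u != 0 ->
    Fam (p u, q u) (w u)) -> limit tau Fam x.
Proof.
move=> pp pq pw pg gu0 gt x0 p0 q0 w0 Famw; split=> // d f fd f0.
have [i xi] : exists i, x 0 i != 0 by apply/rV0Pn.
(* [h] is nonzero exactly at the parameters u for which (p u, q u) is generic. *)
pose h u := p u * (q u * (p u - q u)).
have ph : ispoly h.
  by apply: ispolyM => //; apply: ispolyM => //; apply: ispolyB.
have hu1 : h u1 != 0.
  by case/and3P: gt => /= ? ? ?; rewrite /h !mulf_neq0 // subr_eq0.
have [u2 gh] := ispoly_nz2 pg ph gu0 hu1.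
have wi0 : w 0 0 i != 0 by rewrite w0.
have [u3 ghw] := ispoly_nz2 (ispolyM pg ph) (pw i) gh wi0.
have := ispoly_vanish natK (ispoly_eval_family f pp pq pw)
  (ispolyM (ispolyM pg ph) (pw i)) ghw.
move=> /(_ _ 0); rewrite p0 q0 w0 -surjective_pairing; apply=> u.
rewrite !mulf_eq0 !negb_or subr_eq0 => /andP[/andP[gu /and3P[pu qu pqu]] wu].
apply: (f0); first by apply/and3P.
apply: Famw => //; first by apply/and3P.
by apply: contraNneq wu => ->; rewrite mxE.
Qed.

Definition tvec (w : K * K -> 'rV[K]_16) := forall i, tcoef (fun t => w t 0 i).

Lemma ispath_tvec w (p q : K -> K) : tvec w -> ispoly p -> ispoly q ->
  ispath (fun u => w (p u, q u)).
Proof. by move=> tw pp pq i; apply: ispoly_tcoef (tw i) _ _. Qed.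

(* A pencil in the parameter plane through tau and the generic point (2, 1). *)
Lemma limit_tvec tau Fam w : tvec w -> w tau != 0 ->
  (forall t, generic_t t -> w t != 0 -> Fam t (w t)) -> limit tau Fam (w tau).
Proof.
move=> tw w0 Famw; have two k l : k != l -> (k%:R : K) != l%:R.
  by apply: contraNneq => /natK ->.
have pl (a b : K) : ispoly (fun u => a + u * (b - a)).
  apply: ispolyD; first exact: ispolyC.
  by apply: ispolyM; [exact: ispolyX | exact: ispolyC].
pose p u := tau.1 + u * (2%:R - tau.1); pose q u := tau.2 + u * (1 - tau.2).
have [pp pq] : ispoly p /\ ispoly q by split; apply: pl.
apply: (@limit_path tau Fam p q (fun u => w (p u, q u)) (fun=> 1) (w tau) 0 1) => //.
- exact: ispath_tvec.
- exact: ispolyC.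
- exact: oner_neq0.
- rewrite /generic_t /p /q /= !mul1r ![_ + (_ - _)]addrC !subrK.
  by rewrite (two 2 0)%N // oner_neq0 (two 2 1)%N.
- by rewrite /p mul0r addr0.
- by rewrite /q mul0r addr0.
- by rewrite /p /q !mul0r !addr0 -surjective_pairing.
- by move=> u _ gt w1; apply: Famw.
Qed.

(** The 2 x 2 minors of w t and x vanish on the family and persist at tau, where w does not vanish;
    conversely every multiple of w tau is the value of a multiple of w. *)
Lemma limit_point tau Fam w : tvec w -> w tau != 0 ->
  (forall t, generic_t t -> Fam t = plinear (w t)) ->
  limit tau Fam = plinear (w tau).
Proof.
move=> tw w0 Famw; apply/seteqP; split=> x; last first.
  move=> /plinear1P[x0 [s xs]].
  pose w' t := s *: w t; have <- : w' tau = x by [].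
  apply: limit_tvec; last 2 first.
  - by rewrite /w' -xs.
  - by move=> t gt wt; rewrite Famw //; apply/plinear1P; split=> //; exists s.
  move=> i; have [q qs] := tcoefM (tcoefC s) (tw i); exists q => t.
  by rewrite mxE qs.
move=> limx; have x0 : x != 0 by case: limx.
apply/plinear1P; split=> //.
have /rV0Pn[i wi] := w0; exists (x 0 i / w tau 0 i); apply/rowP => j.
rewrite mxE; apply: (mulfI wi); rewrite mulrA mulrCA divff // mulr1.
apply/eqP; rewrite -subr_eq0; apply/eqP.
apply: (limit_vanish (F := fun t x => w t 0 i * x 0 j - x 0 i * w t 0 j)
   _ _ limx).
  apply: (tformD (d := 1)); first by apply: tformZ (tw i) (tformX _).
  apply: tformN; have [f fd Ff] := tformZ (tw j) (tformX i).
  by exists f => // t z; rewrite -Ff mulrC.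
move=> t z gt; rewrite Famw // => /plinear1P[_ [s ->]].
by rewrite !mxE; ring.
Qed.

(** The coordinates i and j serve as pivots: a point of the line satisfies g x_k = x_i a_k + x_j b_k
    for all k. These are equations of the family, and since g tau is nonzero they still determine x
    at tau. *)
Lemma limit_line tau Fam a b (g : K * K -> K) i j : tvec a -> tvec b ->
  g tau != 0 -> (forall t, generic_t t -> g t != 0) ->
  (forall t, [/\ a t 0 i = g t, a t 0 j = 0, b t 0 i = 0 & b t 0 j = g t]) ->
  (forall t, generic_t t -> Fam t = plinear (col_mx (a t) (b t))) ->
  limit tau Fam = plinear (col_mx (a tau) (b tau)).
Proof.
move=> ta tb g0 gt0 abg Famab; apply/seteqP; split=> x; last first.
  move=> /plinear2P[x0 [s [r xs]]].
  pose w t := s *: a t + r *: b t; have <- : w tau = x by [].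
  apply: limit_tvec; last 2 first.
  - by rewrite /w -xs.
  - by move=> t gt wt; rewrite Famab //; apply/plinear2P; split=> //; exists s, r.
  move=> k; have [q qs] := tcoefD (tcoefM (tcoefC s) (ta k))
    (tcoefM (tcoefC r) (tb k)).
  by exists q => t; rewrite !mxE qs.
move=> limx; have x0 : x != 0 by case: limx.
apply/plinear2P; split=> //; exists (x 0 i / g tau), (x 0 j / g tau).
apply/rowP => k; apply: (mulfI g0).
rewrite !mxE [LHS]mulrC.
transitivity (x 0 i * a tau 0 k + x 0 j * b tau 0 k); last by field.
apply/eqP; rewrite -subr_eq0; apply/eqP.
have tg : tcoef g by have [q qs] := ta i; exists q => t; case: (abg t) => <-.
apply: (limit_vanish (d := 1) (F := fun t x =>
  x 0 k * g t - (x 0 i * a t 0 k + x 0 j * b t 0 k)) _ _ limx).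
  have tX c l : tcoef c -> tform 1 (fun t x => x 0 l * c t).
    move=> tc; have [f fd Ff] := tformZ tc (tformX l).
    by exists f => // t z; rewrite -Ff mulrC.
  by apply: tformD; [|apply: tformN; apply: tformD]; apply: tX.
move=> t z gt; rewrite Famab // => /plinear2P[_ [s [r ->]]].
by rewrite !mxE; case: (abg t) => -> -> -> ->; ring.
Qed.

End FlatLimits.

(** * Smooth points of C_t and their half spinors *)

Section SpinorEquations.
Variable K : fieldType.
Implicit Types (t : K * K) (p w : 'rV[K]_7) (z : 'rV[K]_(5 + 5)) (x : 'rV[K]_16).

(** Subsets of 'I_5 through characteristic bit sequences, on which signs, insertion and deletion
    compute. *)
Definition bset (b : bitseq) : {set 'I_5} := finset (fun i : 'I_5 => nth false b i).

Definition bits_of (I : seq nat) : bitseq := [seq i \in I | i <- iota 1 5].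

Lemma bset_exists (J : {set 'I_5}) : exists b0 b1 b2 b3 b4,
  J = bset [:: b0; b1; b2; b3; b4].
Proof.
exists (inord 0 \in J), (inord 1 \in J), (inord 2 \in J), (inord 3 \in J),
  (inord 4 \in J).
apply/setP => i; rewrite inE -[i in LHS]inord_val.
by case: i => [[|[|[|[|[|//]]]]] ?].
Qed.

Lemma subset_of_bset I : subset_of I = bset (bits_of I).
Proof.
apply/setP => i; rewrite !inE (nth_map 0%N) ?size_iota //.
by rewrite nth_iota // add1n.
Qed.

Lemma eq_bset b c : size b = 5 -> size c = 5 -> (bset b == bset c) = (b == c).
Proof.
move=> b5 c5; apply/eqP/eqP => [bc|-> //].
apply: (@eq_from_nth _ false) => [|i]; first by rewrite b5.
rewrite b5 => i5; have /setP/(_ (Ordinal i5)) := bc.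
by rewrite !inE.
Qed.

Lemma spinor_bset x b : size b = 5 -> spinor x (bset b) =
  \sum_(k <- iota 0 16 | bits_of (nth [::] even_sets k) == b) x 0 (inord k).
Proof.
move=> b5; rewrite /spinor -[iota 0 16]/(index_iota 0 16) big_mkord.
apply: eq_big => k; last by rewrite inord_val.
by rewrite subset_of_bset eq_bset.
Qed.

Lemma before_bset b (i : 'I_5) : size b = 5 ->
  before i (bset b) = count id (take i b).
Proof.
case: b => [|b0 [|b1 [|b2 [|b3 [|b4 [|? ?]]]]]] // _.
rewrite /before -sum1_card big_mkcond /= !big_ord_recl big_ord0 /= !inE /=.
by case: i => [[|[|[|[|[|//]]]]] ?]; case: b0; case: b1; case: b2; case: b3; case: b4.
Qed.

Lemma bsetU1 b (i : 'I_5) : i |: bset b = bset (set_nth false b i true).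
Proof. by apply/setP => j; rewrite !inE nth_set_nth /= -val_eqE; case: eqP. Qed.

Lemma bsetD1 b (i : 'I_5) : bset b :\ i = bset (set_nth false b i false).
Proof. by apply/setP => j; rewrite !inE nth_set_nth /= -val_eqE; case: eqP. Qed.

(** The sixteen components of phi z s on the odd subsets, in the order of the list [L] of [phi_eq0].
    Here g lists the coordinates of z, and x those of the even spinor s in the order of
    [even_sets]. *)
Definition spin_eq (g x : nat -> K) (i : nat) : K :=
  match i with
  | 0%N => g 5%N * x 0%N - g 1%N * x 1%N - g 2%N * x 2%N - g 3%N * x 3%N - g 4%N * x 4%N
  | 1%N => g 0%N * x 1%N + g 6%N * x 0%N - g 2%N * x 5%N - g 3%N * x 6%N - g 4%N * x 7%N
  | 2%N => g 0%N * x 2%N + g 1%N * x 5%N + g 7%N * x 0%N - g 3%N * x 8%N - g 4%N * x 9%N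
  | 3%N => g 0%N * x 3%N + g 1%N * x 6%N + g 2%N * x 8%N + g 8%N * x 0%N - g 4%N * x 10%N
  | 4%N => g 0%N * x 4%N + g 1%N * x 7%N + g 2%N * x 9%N + g 3%N * x 10%N + g 9%N * x 0%N
  | 5%N => g 5%N * x 5%N - g 6%N * x 2%N + g 7%N * x 1%N - g 3%N * x 11%N - g 4%N * x 12%N
  | 6%N => g 5%N * x 6%N - g 6%N * x 3%N + g 2%N * x 11%N + g 8%N * x 1%N - g 4%N * x 13%N
  | 7%N => g 5%N * x 7%N - g 6%N * x 4%N + g 2%N * x 12%N + g 3%N * x 13%N + g 9%N * x 1%N
  | 8%N => g 5%N * x 8%N - g 1%N * x 11%N - g 7%N * x 3%N + g 8%N * x 2%N - g 4%N * x 14%N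
  | 9%N => g 5%N * x 9%N - g 1%N * x 12%N - g 7%N * x 4%N + g 3%N * x 14%N + g 9%N * x 2%N
  | 10%N => g 5%N * x 10%N - g 1%N * x 13%N - g 2%N * x 14%N - g 8%N * x 4%N + g 9%N * x 3%N
  | 11%N => g 0%N * x 11%N + g 6%N * x 8%N - g 7%N * x 6%N + g 8%N * x 5%N - g 4%N * x 15%N
  | 12%N => g 0%N * x 12%N + g 6%N * x 9%N - g 7%N * x 7%N + g 3%N * x 15%N + g 9%N * x 5%N
  | 13%N => g 0%N * x 13%N + g 6%N * x 10%N - g 2%N * x 15%N - g 8%N * x 7%N + g 9%N * x 6%N
  | 14%N => g 0%N * x 14%N + g 1%N * x 15%N + g 7%N * x 10%N - g 8%N * x 9%N + g 9%N * x 8%N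
  | 15%N => g 5%N * x 15%N - g 6%N * x 14%N + g 7%N * x 13%N - g 8%N * x 12%N + g 9%N * x 11%N
  | _ => 0
  end.

(** Coordinates are indexed by nat here and in [co], so that explicit indices reduce by
    computation. *)
Definition zc z (k : nat) : K := z 0 (inord k).

Definition co n (v : 'rV[K]_n.+1) (k : nat) : K := v 0 (inord k).

Lemma phi_bset z x b : size b = 5 -> phi z (spinor x) (bset b) =
  \sum_(i <- iota 0 5)
   (zc z i * (if nth false b i then 0 else (-1) ^+ count id (take i b)
      * spinor x (bset (set_nth false b i true)))
    + zc z (i + 5) * (if nth false b i then (-1) ^+ count id (take i b)
      * spinor x (bset (set_nth false b i false)) else 0)).
Proof.
move=> b5; rewrite /phi -[iota 0 5]/(index_iota 0 5) big_mkord.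
apply: eq_bigr => i _; rewrite /contract /wedge inE before_bset // bsetU1 bsetD1.
have -> : lshift 5 i = inord i.
  by apply/val_inj; rewrite /= inordK // (leq_trans (ltn_ord i)).
have -> : rshift 5 i = inord (i + 5).
  by apply/val_inj; rewrite /= inordK ?(addnC i) // ltn_add2l.
by [].
Qed.

Lemma phi_eq0 z x : (forall J, phi z (spinor x) J = 0) <->
  (forall i, spin_eq (zc z) (co x) i = 0).
Proof.
pose L := map bits_of [:: [:: 1]; [:: 2]; [:: 3]; [:: 4]; [:: 5]; [:: 1; 2; 3];
  [:: 1; 2; 4]; [:: 1; 2; 5]; [:: 1; 3; 4]; [:: 1; 3; 5]; [:: 1; 4; 5];
  [:: 2; 3; 4]; [:: 2; 3; 5]; [:: 2; 4; 5]; [:: 3; 4; 5]; [:: 1; 2; 3; 4; 5]]%N.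
have E b0 b1 b2 b3 b4 : phi z (spinor x) (bset [:: b0; b1; b2; b3; b4]) =
    (if odd (count id [:: b0; b1; b2; b3; b4]) then
      spin_eq (zc z) (co x) (index [:: b0; b1; b2; b3; b4] L)
     else 0).
  rewrite phi_bset // unlock /=.
  by case: b0; case: b1; case: b2; case: b3; case: b4;
    rewrite /= ?spinor_bset // unlock /co /=; ring.
split=> [H i|H J]; last first.
  by have [b0 [b1 [b2 [b3 [b4 ->]]]]] := bset_exists J; rewrite E; case: ifP.
have [i16|i16] := leqP 16 i; first by do 16 (case: i i16 => // i i16).
have := index_uniq [::] (i16 : (i < size L)%N) isT.
have /(all_nthP [::])/(_ i i16) : all [pred b | (size b == 5) && odd (count id b)] L by [].
case: (nth _ L i) => [|b0 [|b1 [|b2 [|b3 [|b4 [|? ?]]]]]] // /andP [_ ob] Li.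
by rewrite -[RHS](H (bset [:: b0; b1; b2; b3; b4])) E Li [odd _]ob.
Qed.

(* The derivative at y, in the direction v, of the k-th quadric. *)
Definition dquad t (y v : nat -> K) (k : nat) : K :=
  let t0 := t.1 in let t1 := t.2 in
  match k with
  | 0%N => - t0 * (v 1%N * y 3%N + y 1%N * v 3%N) + t1 * (v 0%N * y 4%N + y 0%N * v 4%N)
  | 1%N => - (t0 - t1) * (v 0%N * y 3%N + y 0%N * v 3%N) - t1 * (v 2%N * y 3%N + y 2%N * v 3%N)
        - (t0 - t1) * (v 3%N * y 3%N + y 3%N * v 3%N) + t1 * (v 2%N * y 4%N + y 2%N * v 4%N)
        + (t0 - t1) * (v 3%N * y 4%N + y 3%N * v 4%N) - (t0 - t1) * (v 3%N * y 6%N + y 3%N * v 6%N)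
  | 2%N => (t0 - t1) * (v 1%N * y 3%N + y 1%N * v 3%N) + t1 * (v 2%N * y 3%N + y 2%N * v 3%N)
        - t1 * (v 2%N * y 4%N + y 2%N * v 4%N)
  | 3%N => t0 * (v 2%N * y 3%N + y 2%N * v 3%N) - t1 * (v 2%N * y 4%N + y 2%N * v 4%N)
        - (t0 - t1) * (v 3%N * y 4%N + y 3%N * v 4%N) + (t0 - t1) * (v 3%N * y 5%N + y 3%N * v 5%N)
  | 4%N => - t1 * (v 0%N * y 2%N + y 0%N * v 2%N) + t1 * (v 1%N * y 2%N + y 1%N * v 2%N)
        - t1 * (v 2%N * y 3%N + y 2%N * v 3%N) + t1 * (v 2%N * y 4%N + y 2%N * v 4%N)
  | 5%N => v 2%N * y 6%N + y 2%N * v 6%N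
  | 6%N => v 1%N * y 5%N + y 1%N * v 5%N
  | 7%N => v 0%N * y 5%N + y 0%N * v 5%N + (v 3%N * y 5%N + y 3%N * v 5%N) - (v 4%N * y 5%N + y 4%N * v 5%N)
        + (v 4%N * y 6%N + y 4%N * v 6%N)
  | 8%N => v 1%N * y 6%N + y 1%N * v 6%N
  | 9%N => v 3%N * y 5%N + y 3%N * v 5%N - (v 4%N * y 5%N + y 4%N * v 5%N) + (v 4%N * y 6%N + y 4%N * v 6%N)
  | _ => 0
  end.

Definition dir (f : {mpoly K[7]}) p w : K :=
  \sum_(i < 7) (f^`M(i)).@[p 0] * w 0 i.

Lemma dirD f g p w : dir (f + g) p w = dir f p w + dir g p w.
Proof.
by rewrite -big_split; apply: eq_bigr => i _; rewrite mderivD mevalD mulrDl.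
Qed.

Lemma dirN f p w : dir (- f) p w = - dir f p w.
Proof.
by rewrite -sumrN; apply: eq_bigr => i _; rewrite mderivN mevalN mulNr.
Qed.

Lemma dirM f g p w :
  dir (f * g) p w = dir f p w * g.@[p 0] + f.@[p 0] * dir g p w.
Proof.
rewrite mulr_suml mulr_sumr -big_split; apply: eq_bigr => i _ /=.
by rewrite mderivM mevalD !mevalM; ring.
Qed.

Lemma dirC c p w : dir c%:MP p w = 0.
Proof. by apply: big1 => i _; rewrite mderivC meval0 mul0r. Qed.

Lemma dir_var i p w : dir (y K i) p w = w 0 (inord i).
Proof.
rewrite /dir /y (bigD1 (inord i)) //= big1 => [|j ji].
  by rewrite mderivX mnm1E eqxx scale1r -{1}[U_(_)%MM]add0m addmK mpolyX0 meval1 mul1r addr0.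
by rewrite mderivX mnm1E eq_sym (negbTE ji) scale0r meval0 mul0r.
Qed.

Lemma dir_quadrics t p w k : (k < 10)%N ->
  dir (quadrics t)`_k p w = dquad t (co p) (co w) k.
Proof.
do 10 (case: k => [_|k]; first
  by rewrite /= !(dirD, dirN, dirM, dirC, dir_var) ?(mevalD, mevalN, mevalM, mevalC)
      /y !mevalXU /dquad /co /=; ring).
by [].
Qed.

(** W_p^perp is the image of the differential at p of the ten quadrics, so its vectors are
    parametrized by directions w. *)
Lemma zc_Wperp t p w k : (k < 10)%N -> zc (w *m Wperp t p) k = dquad t (co p) (co w) k.
Proof.
move=> k10; rewrite -dir_quadrics // /zc mxE; apply: eq_bigr => i _.
by rewrite mxE mulrC (tnth_nth 0) inordK.
Qed.

Lemma half_spinor_eqs t p x : half_spinor (Wperp t p) x ->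
  forall w i, spin_eq (dquad t (co p) (co w)) (co x) i = 0.
Proof.
move=> [_ _ _ H] w i; have := H _ (submxMl w _).
move=> /phi_eq0/(_ i); do 16 (case: i => [|i]; first by rewrite /= !zc_Wperp).
by [].
Qed.

Lemma half_spinorP t p x : lagrangian (Wperp t p) ->
  ~~ odd (\rank (Wperp t p :&: Uinf K)%MS) -> x != 0 ->
  (forall w i, spin_eq (dquad t (co p) (co w)) (co x) i = 0) ->
  half_spinor (Wperp t p) x.
Proof.
move=> lag par x0 H; split=> // u /submxP[w ->].
apply/phi_eq0 => i; have := H w i.
do 16 (case: i => [|i]; first by rewrite /= !zc_Wperp).
by [].
Qed.

End SpinorEquations.

(** * Coordinates on the ambient space and on P_nod *)

Section Coordinates.
Variable K : fieldType.
Implicit Types (t : K * K) (s : seq K) (x : 'rV[K]_16).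

Definition row7 s : 'rV[K]_7 := \row_i nth 0 s i.

Lemma co_row7 s k : (k < 7)%N -> co (row7 s) k = nth 0 s k.
Proof. by move=> k7; rewrite /co mxE inordK. Qed.

Lemma row7_co (p : 'rV[K]_7) :
  p = row7 [:: co p 0; co p 1; co p 2; co p 3; co p 4; co p 5; co p 6].
Proof.
apply/rowP => i; rewrite mxE -[in LHS](inord_val i).
by case: i => [[|[|[|[|[|[|[|//]]]]]]] ?].
Qed.

(** The order is that of [even_sets]; the four constant zeros are x_14, x_1234, x_1245 and x_2345,
    which vanish on P_nod. *)
Definition ptseq t (z1 z2 z3 z4 z5 z6 z7 : K) : seq K :=
  [:: (t.1 * t.2 - t.2 ^+ 2) * z4; z1; z1; 0; (t.1 - t.2) * z4;
    t.2 * z4 + z5; z2; t.2 * z4 + z5; z3; t.1 * z4; z5; 0; z6; 0; z7; 0].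

(* The point of P_nod with coordinates z1, ..., z7 in the given basis. *)
Definition pt t (z1 z2 z3 z4 z5 z6 z7 : K) : 'rV[K]_16 :=
  \row_i nth 0 (ptseq t z1 z2 z3 z4 z5 z6 z7) i.

Lemma co_pt t z1 z2 z3 z4 z5 z6 z7 k : (k < 16)%N ->
  co (pt t z1 z2 z3 z4 z5 z6 z7) k = nth 0 (ptseq t z1 z2 z3 z4 z5 z6 z7) k.
Proof. by move=> k16; rewrite /co mxE inordK. Qed.

Lemma co_inj x x' : (forall k, (k < 16)%N -> co x k = co x' k) -> x = x'.
Proof. by move=> H; apply/rowP => i; have := H i (ltn_ord i); rewrite /co inord_val. Qed.

Lemma eq16 (P : nat -> Prop) : P 0%N -> P 1%N -> P 2%N -> P 3%N -> P 4%N -> P 5%N ->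
  P 6%N -> P 7%N -> P 8%N -> P 9%N -> P 10%N -> P 11%N -> P 12%N -> P 13%N ->
  P 14%N -> P 15%N -> forall k, (k < 16)%N -> P k.
Proof. by do 16 (move=> ?); do 16 (case=> [//|]). Qed.

Lemma pt_comb t (s r : K) z1 z2 z3 z4 z5 z6 z7 w1 w2 w3 w4 w5 w6 w7 :
  s *: pt t z1 z2 z3 z4 z5 z6 z7 + r *: pt t w1 w2 w3 w4 w5 w6 w7 =
  pt t (s * z1 + r * w1) (s * z2 + r * w2) (s * z3 + r * w3) (s * z4 + r * w4)
    (s * z5 + r * w5) (s * z6 + r * w6) (s * z7 + r * w7).
Proof.
by apply/rowP => -[[|[|[|[|[|[|[|[|[|[|[|[|[|[|[|[|//]]]]]]]]]]]]]]]] ?];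
  rewrite !mxE /=; ring.
Qed.

Lemma pt_scale t (s : K) z1 z2 z3 z4 z5 z6 z7 : s *: pt t z1 z2 z3 z4 z5 z6 z7 =
  pt t (s * z1) (s * z2) (s * z3) (s * z4) (s * z5) (s * z6) (s * z7).
Proof.
by apply/rowP => -[[|[|[|[|[|[|[|[|[|[|[|[|[|[|[|[|//]]]]]]]]]]]]]]]] ?];
  rewrite !mxE /=; ring.
Qed.

(** The coordinate z_4 is read off x_35 = t_0 z_4, hence the condition on t_0. *)
Lemma pt_inj t z1 z2 z3 z4 z5 z6 z7 w1 w2 w3 w4 w5 w6 w7 : t.1 != 0 ->
  pt t z1 z2 z3 z4 z5 z6 z7 = pt t w1 w2 w3 w4 w5 w6 w7 ->
  [/\ z1 = w1, z2 = w2, z3 = w3, z4 = w4 & [/\ z5 = w5, z6 = w6 & z7 = w7]].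
Proof.
move=> t0 zw; have E k := congr1 (fun x => co x k) zw.
have := (E 1%N, E 6%N, E 8%N, E 9%N, E 10%N, E 12%N, E 14%N).
by rewrite !co_pt //= => -[[[[[[-> ->] ->] /(mulfI t0) ->] ->] ->] ->].
Qed.

Lemma pt_eq0 t z1 z2 z3 z4 z5 z6 z7 : t.1 != 0 ->
  (pt t z1 z2 z3 z4 z5 z6 z7 == 0) = all (pred1 0) [:: z1; z2; z3; z4; z5; z6; z7].
Proof.
move=> t0; have pt0 : pt t 0 0 0 0 0 0 0 = 0.
  by have := pt_scale t 0 0 0 0 0 0 0 0; rewrite scale0r !mul0r.
apply/eqP/idP => [|/and5P[/eqP-> /eqP-> /eqP-> /eqP-> /and4P[/eqP-> /eqP-> /eqP-> _]]//].
by rewrite -{1}pt0 => /(pt_inj t0) [-> -> -> -> [-> -> ->]] /=; rewrite eqxx.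
Qed.

End Coordinates.

(** The sequence stops after the 1; the default 0 of [nth] supplies the remaining entries. *)
Definition unit7 {K : fieldType} (i : nat) : seq K := nseq i 0 ++ [:: 1].

(* The points of C_t^34 and their spinors, in terms of y_2, y_3, y_4. *)
Definition conic_pt {K : fieldType} (y2 y3 y4 : K) : seq K :=
  [:: y2 - y3; y2 - y4; y2; y3; y4; 0; 0].

Definition conic_spin {K : fieldType} t (y2 y3 y4 : K) : seq K :=
  ptseq t (- t.2 * y2) (t.2 * (y2 - y4)) (t.2 * (y2 - y4)) y3 (- t.2 * (y3 - y4)) 0 0.

Lemma linear_certificate (K : fieldType) (E : nat -> nat -> K) (L R U : K)
    (cs : seq (K * (nat * nat))) : (forall i j, E i j = 0) -> U != 0 ->
  U * (L - R) = foldr (fun q s => q.1 * E q.2.1 q.2.2 + s) 0 cs -> L = R.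
Proof.
move=> E0 U0 eqU; apply/eqP; rewrite -subr_eq0; apply/eqP/(mulfI U0).
by rewrite mulr0 eqU; elim: cs {eqU} => //= q cs ->; rewrite E0 mulr0 addr0.
Qed.

(* [certify H U cs] proves the linear equation L = R from the equations
   E i j = 0 of H, by the identity U * (L - R) = \sum_((c, (i, j)) <- cs) c * E i j. *)
Tactic Notation "certify" constr(H) uconstr(U) uconstr(cs) :=
  refine (@linear_certificate _ _ _ _ U cs H _ _);
  [by rewrite ?(mulf_neq0, expf_neq0, oner_neq0)
  |lazy beta iota zeta delta [spin_eq dquad conic_pt conic_spin ptseq unit7
     nth nseq ncons iter cat foldr fst snd]; ring].

(** * The spinor equations along each component of the curve *)

Section LineEquations.
Variable K : fieldType.
Implicit Types (X : nat -> K).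

(** Writing t = (t1 + d, t1) turns t_0 != t_1 into the nonvanishing of a variable. The equations for
    the seven unit directions determine every coordinate of the spinor from two pivots, here x_34
    and x_1345. The multipliers U act as denominators; the case distinction on a and b covers the
    points of the line where those of the general case vanish. *)
Lemma line_of_spin_c0 (t1 d a b : K) X : t1 != 0 -> d != 0 -> (a != 0) || (b != 0) ->
  (forall i j, spin_eq (dquad (t1 + d, t1)
     (nth 0 [:: a; 0; 0; 0; 0; 0; b]) (nth 0 (unit7 i))) X j = 0) ->
  forall k, (k < 16)%N -> 1 * X k =
    X 8%N * nth 0 (ptseq (t1 + d, t1) 0 0 1 0 0 0 0) k
    + X 14%N * nth 0 (ptseq (t1 + d, t1) 0 0 0 0 0 0 1) k.
Proof.
move=> t1_0 d0 ab0 H.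
have [a0|a0] := eqVneq a 0; last have [b0|b0] := eqVneq b 0.
- subst a; rewrite eqxx /= in ab0.
  apply: eq16.
  + by certify H b [:: (1, (1, 3)%N)].
  + by certify H b [:: (1, (1, 6)%N)].
  + by certify H b [:: (1, (1, 8)%N)].
  + by certify H b [:: (- 1, (4, 8)%N)].
  + by certify H b [:: (- 1, (1, 10)%N)].
  + by certify H b [:: (1, (1, 11)%N)].
  + by certify H b [:: (1, (2, 6)%N)].
  + by certify H b [:: (- 1, (1, 13)%N)].
  + by rewrite /=; ring.
  + by certify H b [:: (- 1, (1, 14)%N)].
  + by certify H b [:: (1, (2, 10)%N)].
  + by certify H (b * d) [:: (1, (3, 8)%N)].
  + by certify H b [:: (- 1, (1, 15)%N)].
  + by certify H (b * d) [:: (1, (3, 10)%N)].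
  + by rewrite /=; ring.
  + by certify H b [:: (1, (2, 15)%N)].
- subst b; clear ab0.
  apply: eq16.
  + by certify H a [:: (1, (5, 2)%N)].
  + by certify H a [:: (1, (5, 5)%N)].
  + by certify H (a * t1) [:: (1, (4, 2)%N)].
  + by certify H a [:: (- 1, (5, 8)%N)].
  + by certify H a [:: (- 1, (5, 9)%N)].
  + by certify H (a * d) [:: (- 1, (3, 2)%N)].
  + by certify H a [:: (- 1, (5, 11)%N)].
  + by certify H a [:: (- 1, (5, 12)%N)].
  + by rewrite /=; ring.
  + by certify H (a * t1) [:: (1, (2, 2)%N)].
  + by certify H a [:: (1, (5, 14)%N)].
  + by certify H (a * d) [:: (1, (3, 8)%N)].
  + by certify H (a * t1) [:: (1, (2, 5)%N)].
  + by certify H a [:: (1, (5, 15)%N)].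
  + by rewrite /=; ring.
  + by certify H (a * t1) [:: (1, (2, 11)%N)].
- clear ab0.
  apply: eq16.
  + by certify H b [:: (1, (1, 3)%N)].
  + by certify H b [:: (1, (1, 6)%N)].
  + by certify H b [:: (1, (1, 8)%N)].
  + by certify H b [:: (- 1, (4, 8)%N)].
  + by certify H b [:: (- 1, (1, 10)%N)].
  + by certify H b [:: (1, (1, 11)%N)].
  + by certify H a [:: (- 1, (5, 11)%N)].
  + by certify H b [:: (- 1, (1, 13)%N)].
  + by rewrite /=; ring.
  + by certify H b [:: (- 1, (1, 14)%N)].
  + by certify H b [:: (1, (2, 10)%N)].
  + by certify H (a * b) [:: (a, (4, 15)%N); (- b, (5, 15)%N)].
  + by certify H b [:: (- 1, (1, 15)%N)].
  + by certify H a [:: (1, (5, 15)%N)].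
  + by rewrite /=; ring.
  + by certify H b [:: (1, (2, 15)%N)].
Qed.

Lemma line_of_spin_c1 (t1 d a b : K) X : t1 != 0 -> d != 0 -> (a != 0) || (b != 0) ->
  (forall i j, spin_eq (dquad (t1 + d, t1)
     (nth 0 [:: a; b; 0; 0; 0; 0; 0]) (nth 0 (unit7 i))) X j = 0) ->
  forall k, (k < 16)%N -> 1 * X k =
    X 6%N * nth 0 (ptseq (t1 + d, t1) 0 1 0 0 0 0 0) k
    + X 8%N * nth 0 (ptseq (t1 + d, t1) 0 0 1 0 0 0 0) k.
Proof.
move=> t1_0 d0 ab0 H.
have [a0|a0] := eqVneq a 0; last have [b0|b0] := eqVneq b 0.
- subst a; rewrite eqxx /= in ab0.
  apply: eq16.
  + by certify H b [:: (1, (5, 1)%N)].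
  + by certify H b [:: (1, (6, 6)%N)].
  + by certify H b [:: (- 1, (5, 5)%N)].
  + by certify H b [:: (- 1, (5, 6)%N)].
  + by certify H b [:: (- 1, (5, 7)%N)].
  + by certify H b [:: (1, (6, 11)%N)].
  + by rewrite /=; ring.
  + by certify H b [:: (- 1, (6, 13)%N)].
  + by rewrite /=; ring.
  + by certify H b [:: (1, (5, 12)%N)].
  + by certify H b [:: (1, (5, 13)%N)].
  + by certify H (b * d) [:: (1, (3, 6)%N)].
  + by certify H b [:: (- 1, (6, 15)%N)].
  + by certify H (b * t1) [:: (- 1, (2, 6)%N)].
  + by certify H b [:: (- 1, (5, 15)%N)].
  + by certify H (b * t1) [:: (- 1, (2, 11)%N)].
- subst b; clear ab0.
  apply: eq16.
  + by certify H a [:: (1, (5, 2)%N)].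
  + by certify H a [:: (1, (5, 5)%N)].
  + by certify H (a * t1) [:: (1, (4, 2)%N)].
  + by certify H a [:: (- 1, (5, 8)%N)].
  + by certify H a [:: (- 1, (5, 9)%N)].
  + by certify H (a * d) [:: (- 1, (3, 2)%N)].
  + by rewrite /=; ring.
  + by certify H a [:: (- 1, (5, 12)%N)].
  + by rewrite /=; ring.
  + by certify H (a * t1) [:: (1, (2, 2)%N)].
  + by certify H a [:: (1, (5, 14)%N)].
  + by certify H (a * d) [:: (1, (3, 8)%N)].
  + by certify H (a * t1) [:: (1, (2, 5)%N)].
  + by certify H a [:: (1, (5, 15)%N)].
  + by certify H (a * t1) [:: (1, (2, 8)%N)].
  + by certify H (a * t1) [:: (1, (2, 11)%N)].
- clear ab0.
  apply: eq16.
  + by certify H b [:: (1, (5, 1)%N)].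
  + by certify H b [:: (1, (6, 6)%N)].
  + by certify H b [:: (1, (6, 8)%N)].
  + by certify H b [:: (- 1, (5, 6)%N)].
  + by certify H b [:: (- 1, (5, 7)%N)].
  + by certify H b [:: (1, (6, 11)%N)].
  + by rewrite /=; ring.
  + by certify H b [:: (- 1, (6, 13)%N)].
  + by rewrite /=; ring.
  + by certify H b [:: (- 1, (6, 14)%N)].
  + by certify H b [:: (1, (5, 13)%N)].
  + by certify H (b * d) [:: (1, (3, 6)%N)].
  + by certify H b [:: (- 1, (6, 15)%N)].
  + by certify H (a * t1) [:: (1, (4, 13)%N)].
  + by certify H (a * t1) [:: (1, (4, 14)%N)].
  + by certify H (a * b * t1 * d) [:: (- a * t1, (3, 13)%N); (- b * t1 - b * d, (4, 13)%N)].
Qed.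

Lemma line_of_spin_c2 (t1 d a b : K) X : t1 != 0 -> d != 0 -> (a != 0) || (b != 0) ->
  (forall i j, spin_eq (dquad (t1 + d, t1)
     (nth 0 [:: a; a; b; 0; 0; 0; 0]) (nth 0 (unit7 i))) X j = 0) ->
  forall k, (k < 16)%N -> 1 * X k =
    X 1%N * nth 0 (ptseq (t1 + d, t1) 1 0 0 0 0 0 0) k
    + X 6%N * nth 0 (ptseq (t1 + d, t1) 0 1 1 0 0 0 0) k.
Proof.
move=> t1_0 d0 ab0 H.
have [a0|a0] := eqVneq a 0; last have [b0|b0] := eqVneq b 0.
- subst a; rewrite eqxx /= in ab0.
  apply: eq16.
  + by certify H b [:: (1, (6, 0)%N)].
  + by rewrite /=; ring.
  + by certify H (b * t1 * d) [:: (t1, (3, 0)%N); (d, (0, 0)%N); (t1 + d, (4, 0)%N)].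
  + by certify H (b * d) [:: (- 1, (4, 0)%N); (- 1, (3, 0)%N)].
  + by certify H (b * t1) [:: (1, (0, 0)%N)].
  + by certify H b [:: (1, (6, 5)%N)].
  + by rewrite /=; ring.
  + by certify H b [:: (1, (6, 7)%N)].
  + by certify H b [:: (1, (6, 8)%N); (- 1, (6, 6)%N)].
  + by certify H b [:: (1, (6, 9)%N)].
  + by certify H b [:: (1, (6, 10)%N)].
  + by certify H (b * t1) [:: (1, (3, 6)%N); (- 1, (0, 6)%N)].
  + by certify H (b * t1) [:: (1, (0, 5)%N)].
  + by certify H (b * t1) [:: (1, (0, 6)%N)].
  + by certify H (b * t1) [:: (1, (0, 8)%N)].
  + by certify H b [:: (1, (6, 15)%N)].
- subst b; clear ab0.
  apply: eq16.
  + by certify H a [:: (1, (5, 1)%N)].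
  + by rewrite /=; ring.
  + by certify H a [:: (1, (6, 8)%N); (- 1, (6, 6)%N)].
  + by certify H a [:: (- 1, (5, 6)%N)].
  + by certify H a [:: (- 1, (5, 7)%N)].
  + by certify H a [:: (1, (6, 11)%N)].
  + by rewrite /=; ring.
  + by certify H a [:: (- 1, (6, 13)%N)].
  + by certify H a [:: (1, (5, 11)%N)].
  + by certify H a [:: (- 1, (6, 14)%N)].
  + by certify H a [:: (1, (5, 13)%N)].
  + by certify H (a * d) [:: (1, (3, 6)%N)].
  + by certify H a [:: (- 1, (6, 15)%N)].
  + by certify H (a * t1) [:: (1, (4, 13)%N)].
  + by certify H (a * t1) [:: (1, (4, 14)%N)].
  + by certify H (a * t1 * d) [:: (- t1, (3, 13)%N); (- t1 - d, (4, 13)%N)].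
- clear ab0.
  apply: eq16.
  + by certify H a [:: (1, (5, 1)%N)].
  + by rewrite /=; ring.
  + by certify H a [:: (- 1, (5, 5)%N)].
  + by certify H a [:: (- 1, (5, 6)%N)].
  + by certify H a [:: (- 1, (5, 7)%N)].
  + by certify H b [:: (1, (6, 5)%N)].
  + by rewrite /=; ring.
  + by certify H b [:: (1, (6, 7)%N)].
  + by certify H a [:: (1, (5, 11)%N)].
  + by certify H b [:: (1, (6, 9)%N)].
  + by certify H a [:: (1, (5, 13)%N)].
  + by certify H (b * t1) [:: (1, (4, 5)%N); (1, (0, 5)%N)].
  + by certify H (b * t1) [:: (1, (0, 5)%N)].
  + by certify H (b * t1) [:: (1, (0, 6)%N)].
  + by certify H (b * t1) [:: (1, (0, 8)%N)].
  + by certify H (b * t1) [:: (1, (0, 11)%N)].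
Qed.

(** The factor t1 + d = t_0 on the left avoids a division: the pivot x_35 equals t_0 z_4. *)
Lemma line_of_spin_c5 (t1 d a b : K) X : t1 != 0 -> d != 0 -> (a != 0) || (b != 0) ->
  (forall i j, spin_eq (dquad (t1 + d, t1)
     (nth 0 [:: 0; 0; a - b; a; a; b; 0]) (nth 0 (unit7 i))) X j = 0) ->
  forall k, (k < 16)%N -> (t1 + d) * X k =
    X 9%N * nth 0 (ptseq (t1 + d, t1) (- t1) 0 0 1 0 0 0) k
    + X 12%N * nth 0 (ptseq (t1 + d, t1) (t1 ^+ 2 + t1 * d) 0 0 0 0 (t1 + d) 0) k.
Proof.
move=> t1_0 d0 ab0 H.
have [a0|a0] := eqVneq a 0; last have [b0|b0] := eqVneq b 0.
- subst a; rewrite eqxx /= in ab0.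
  apply: eq16.
  + by certify H b [:: (- t1 - d, (6, 0)%N); (- t1 * d, (1, 12)%N)].
  + by certify H b [:: (t1 + d, (0, 5)%N); (t1, (1, 12)%N)].
  + by certify H b [:: (- t1 - d, (1, 5)%N); (t1, (1, 12)%N)].
  + by certify H b [:: (- t1 - d, (0, 8)%N); (t1 ^+ 2 + t1 * d, (1, 15)%N)].
  + by certify H b [:: (- t1 - d, (0, 9)%N); (- d, (1, 12)%N)].
  + by certify H b [:: (- t1 - d, (6, 5)%N); (- t1, (1, 12)%N)].
  + by certify H b [:: (- t1 - d, (6, 6)%N)].
  + by certify H b [:: (- t1 - d, (0, 12)%N); (- t1, (1, 12)%N)].
  + by certify H b [:: (- t1 - d, (6, 8)%N)].
  + by rewrite /=; ring.
  + by certify H b [:: (t1 + d, (0, 14)%N)].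
  + by certify H b [:: (t1 + d, (3, 15)%N); (- t1 - d, (0, 15)%N)].
  + by rewrite /=; ring.
  + by certify H b [:: (t1 + d, (0, 15)%N)].
  + by certify H b [:: (- t1 - d, (1, 15)%N)].
  + by certify H b [:: (- t1 - d, (6, 15)%N)].
- subst b; clear ab0.
  apply: eq16.
  + by certify H a [:: (t1 + d, (6, 0)%N); (- t1 * d - d ^+ 2, (6, 5)%N); (t1 * d + d ^+ 2, (6, 12)%N); (d, (1, 2)%N); (- t1 - d, (1, 0)%N); (- t1 - d, (0, 4)%N)].
  + by certify H (a * d) [:: (t1 * d + d ^+ 2, (6, 5)%N); (- t1 * d - d ^+ 2, (6, 12)%N); (- d, (1, 2)%N); (t1 + d, (1, 0)%N); (t1 + d, (0, 4)%N); (- t1 * d - d ^+ 2, (0, 5)%N)].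
  + by certify H a [:: (- 1, (1, 2)%N); (- t1 - d, (0, 5)%N)].
  + by certify H (a * d) [:: (- t1 - d, (2, 0)%N)].
  + by certify H (a * t1) [:: (d, (1, 2)%N); (- t1 - d, (1, 0)%N)].
  + by certify H (a * d) [:: (t1 * d + d ^+ 2, (6, 12)%N); (d, (1, 2)%N); (- t1 - d, (1, 0)%N); (- t1 - d, (0, 4)%N)].
  + by certify H a [:: (t1 + d, (6, 6)%N)].
  + by certify H (a * d) [:: (d, (1, 2)%N); (- t1 - d, (1, 0)%N); (- t1 - d, (0, 4)%N)].
  + by certify H (a * d) [:: (- t1 - d, (2, 2)%N)].
  + by rewrite /=; ring.
  + by certify H (a * d) [:: (t1 + d, (2, 4)%N)].
  + by certify H (a * d) [:: (- t1 - d, (2, 5)%N)].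
  + by rewrite /=; ring.
  + by certify H (a * t1) [:: (t1 + d, (0, 6)%N)].
  + by certify H (a * t1) [:: (- t1 - d, (1, 8)%N)].
  + by certify H (a * d) [:: (t1 + d, (2, 12)%N)].
- clear ab0.
  apply: eq16.
  + by certify H (a * b) [:: (b * t1 + b * d, (6, 2)%N); (b * t1 * d + b * d ^+ 2, (6, 12)%N); (- a * t1 * d - a * d ^+ 2, (0, 12)%N); (- a * t1 * d, (1, 12)%N)].
  + by certify H b [:: (t1 + d, (0, 5)%N); (t1, (1, 12)%N)].
  + by certify H b [:: (- t1 - d, (1, 5)%N); (t1, (1, 12)%N)].
  + by certify H (a * d) [:: (- t1 - d, (2, 0)%N)].
  + by certify H b [:: (- t1 - d, (0, 9)%N); (- d, (1, 12)%N)].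
  + by certify H (a * b) [:: (b * t1 + b * d, (6, 12)%N); (- a * t1 - a * d, (0, 12)%N); (- a * t1, (1, 12)%N)].
  + by certify H a [:: (- t1 - d, (6, 11)%N)].
  + by certify H b [:: (- t1 - d, (0, 12)%N); (- t1, (1, 12)%N)].
  + by certify H (a * d) [:: (- t1 - d, (2, 2)%N)].
  + by rewrite /=; ring.
  + by certify H (a * d) [:: (t1 + d, (2, 4)%N)].
  + by certify H (a * d) [:: (- t1 - d, (2, 5)%N)].
  + by rewrite /=; ring.
  + by certify H b [:: (t1 + d, (0, 15)%N)].
  + by certify H b [:: (- t1 - d, (1, 15)%N)].
  + by certify H (a * d) [:: (t1 + d, (2, 12)%N)].
Qed.

Lemma line_of_spin_c6 (t1 d a b : K) X : t1 != 0 -> d != 0 -> (a != 0) || (b != 0) ->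
  (forall i j, spin_eq (dquad (t1 + d, t1)
     (nth 0 [:: 0; 0; 0; a - b; a; a; b]) (nth 0 (unit7 i))) X j = 0) ->
  forall k, (k < 16)%N -> 1 * X k =
    X 12%N * nth 0 (ptseq (t1 + d, t1) 0 0 0 1 0 1 0) k
    + X 14%N * nth 0 (ptseq (t1 + d, t1) 0 0 t1 1 (- t1) 0 1) k.
Proof.
move=> t1_0 d0 ab0 H.
have [a0|a0] := eqVneq a 0; last have [b0|b0] := eqVneq b 0.
- subst a; rewrite eqxx /= in ab0.
  apply: eq16.
  + by certify H b [:: (- 1, (5, 2)%N); (- d, (5, 14)%N); (- d, (2, 10)%N); (t1, (0, 10)%N); (t1 * d, (1, 15)%N)].
  + by certify H (b * d) [:: (- 1, (0, 0)%N)].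
  + by certify H b [:: (1, (1, 8)%N)].
  + by certify H b [:: (1, (5, 8)%N)].
  + by certify H b [:: (- 1, (1, 10)%N); (d, (1, 15)%N)].
  + by certify H (b * d) [:: (1, (0, 2)%N); (t1 * d, (1, 15)%N)].
  + by certify H b [:: (- 1, (4, 11)%N)].
  + by certify H (b * d) [:: (1, (0, 4)%N); (t1 * d, (1, 15)%N)].
  + by certify H (b * d) [:: (- d, (5, 14)%N); (- d, (2, 10)%N); (t1, (0, 10)%N)].
  + by certify H b [:: (- 1, (1, 14)%N); (t1 + d, (1, 15)%N)].
  + by certify H (b * d) [:: (d, (2, 10)%N); (- t1, (0, 10)%N)].
  + by certify H (b * d) [:: (- 1, (0, 8)%N)].
  + by rewrite /=; ring.
  + by certify H (b * d) [:: (- 1, (0, 10)%N)].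
  + by rewrite /=; ring.
  + by certify H b [:: (1, (2, 15)%N)].
- subst b; clear ab0.
  apply: eq16.
  + by certify H a [:: (1, (3, 2)%N); (d, (3, 12)%N); (- d, (0, 12)%N); (t1 * d, (1, 15)%N)].
  + by certify H a [:: (1, (0, 5)%N)].
  + by certify H a [:: (- 1, (1, 5)%N)].
  + by certify H (a * d) [:: (- 1, (2, 0)%N)].
  + by certify H a [:: (- 1, (0, 9)%N); (d, (1, 15)%N)].
  + by certify H a [:: (1, (3, 12)%N); (- 1, (0, 12)%N)].
  + by certify H a [:: (- 1, (3, 11)%N)].
  + by certify H a [:: (- 1, (0, 12)%N)].
  + by certify H (a * d) [:: (- 1, (2, 2)%N); (t1 * d, (1, 15)%N)].
  + by certify H a [:: (1, (1, 12)%N); (t1 + d, (1, 15)%N)].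
  + by certify H (a * d) [:: (1, (2, 4)%N); (- t1 * d, (1, 15)%N)].
  + by certify H (a * d) [:: (- 1, (2, 5)%N)].
  + by rewrite /=; ring.
  + by certify H a [:: (1, (0, 15)%N)].
  + by rewrite /=; ring.
  + by certify H (a * d) [:: (1, (2, 12)%N)].
- clear ab0.
  apply: eq16.
  + by certify H (a ^+ 2) [:: (a, (3, 2)%N); (a * d - b * d, (3, 12)%N); (- a * d + b * d, (0, 12)%N); (a * t1 * d, (1, 15)%N)].
  + by certify H a [:: (1, (0, 5)%N)].
  + by certify H a [:: (- 1, (1, 5)%N)].
  + by certify H b [:: (1, (5, 8)%N)].
  + by certify H a [:: (- 1, (0, 9)%N); (d, (1, 15)%N)].
  + by certify H a [:: (1, (3, 12)%N); (- 1, (0, 12)%N)].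
  + by certify H a [:: (- 1, (3, 11)%N)].
  + by certify H a [:: (- 1, (0, 12)%N)].
  + by certify H (a * b) [:: (- a, (5, 14)%N); (- b, (0, 14)%N); (- a * d + b * d, (2, 15)%N)].
  + by certify H a [:: (1, (1, 12)%N); (t1 + d, (1, 15)%N)].
  + by certify H (a * b) [:: (b, (0, 14)%N); (a * d - b * d, (2, 15)%N)].
  + by certify H a [:: (1, (3, 15)%N); (- 1, (0, 15)%N)].
  + by rewrite /=; ring.
  + by certify H a [:: (1, (0, 15)%N)].
  + by rewrite /=; ring.
  + by certify H b [:: (1, (2, 15)%N)].
Qed.

Lemma line_of_spin_c7 (t1 d a b : K) X : t1 != 0 -> d != 0 -> (a != 0) || (b != 0) ->
  (forall i j, spin_eq (dquad (t1 + d, t1)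
     (nth 0 [:: 0; 0; 0; 0; a; b; b]) (nth 0 (unit7 i))) X j = 0) ->
  forall k, (k < 16)%N -> 1 * X k =
    X 10%N * nth 0 (ptseq (t1 + d, t1) 0 0 (- 1) 0 1 0 0) k
    + X 14%N * nth 0 (ptseq (t1 + d, t1) 0 0 0 0 0 (- 1) 1) k.
Proof.
move=> t1_0 d0 ab0 H.
have [a0|a0] := eqVneq a 0; last have [b0|b0] := eqVneq b 0.
- subst a; rewrite eqxx /= in ab0.
  apply: eq16.
  + by certify H b [:: (1, (0, 2)%N)].
  + by certify H b [:: (1, (0, 5)%N)].
  + by certify H b [:: (- 1, (1, 5)%N)].
  + by certify H b [:: (- 1, (0, 8)%N)].
  + by certify H b [:: (- 1, (0, 9)%N)].
  + by certify H b [:: (1, (2, 5)%N); (- 1, (0, 14)%N)].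
  + by certify H b [:: (- 1, (0, 11)%N)].
  + by certify H b [:: (- 1, (0, 12)%N); (- 1, (0, 14)%N)].
  + by certify H b [:: (1, (2, 8)%N); (1, (0, 14)%N)].
  + by certify H b [:: (1, (1, 12)%N)].
  + by rewrite /=; ring.
  + by certify H b [:: (1, (3, 15)%N); (- 1, (0, 15)%N)].
  + by certify H b [:: (- 1, (1, 15)%N)].
  + by certify H b [:: (1, (0, 15)%N)].
  + by rewrite /=; ring.
  + by certify H b [:: (1, (2, 15)%N)].
- subst b; clear ab0.
  apply: eq16.
  + by certify H a [:: (- 1, (5, 2)%N)].
  + by certify H a [:: (- 1, (5, 5)%N)].
  + by certify H (a * t1) [:: (1, (0, 2)%N)].
  + by certify H a [:: (1, (5, 8)%N)].
  + by certify H (a * t1) [:: (1, (0, 4)%N)].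
  + by certify H (a * d) [:: (- d, (5, 12)%N); (1, (3, 4)%N)].
  + by certify H a [:: (1, (5, 11)%N)].
  + by certify H (a * d) [:: (1, (3, 4)%N)].
  + by certify H a [:: (- 1, (5, 14)%N)].
  + by certify H (a * t1 * d) [:: (- d, (2, 4)%N); (t1, (3, 4)%N)].
  + by rewrite /=; ring.
  + by certify H (a * t1) [:: (1, (0, 11)%N)].
  + by certify H (a * t1) [:: (1, (0, 12)%N); (1, (0, 14)%N)].
  + by certify H (a * t1) [:: (1, (0, 13)%N)].
  + by rewrite /=; ring.
  + by certify H (a * t1) [:: (- 1, (2, 11)%N)].
- clear ab0.
  apply: eq16.
  + by certify H b [:: (1, (1, 1)%N)].
  + by certify H b [:: (1, (0, 5)%N)].
  + by certify H b [:: (- 1, (1, 5)%N)].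
  + by certify H b [:: (- 1, (0, 8)%N)].
  + by certify H b [:: (- 1, (0, 9)%N)].
  + by certify H (a * b) [:: (a, (1, 11)%N); (b, (5, 14)%N)].
  + by certify H b [:: (- 1, (3, 11)%N)].
  + by certify H (b ^+ 2) [:: (- b, (0, 12)%N); (- a * t1, (1, 15)%N); (- b, (0, 14)%N)].
  + by certify H a [:: (- 1, (5, 14)%N)].
  + by certify H b [:: (1, (1, 12)%N)].
  + by rewrite /=; ring.
  + by certify H b [:: (1, (3, 15)%N); (- 1, (0, 15)%N)].
  + by certify H b [:: (- 1, (1, 15)%N)].
  + by certify H b [:: (1, (0, 15)%N)].
  + by rewrite /=; ring.
  + by certify H b [:: (1, (2, 15)%N)].
Qed.

Lemma line_of_spin_c8 (t1 d a b : K) X : t1 != 0 -> d != 0 -> (a != 0) || (b != 0) ->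
  (forall i j, spin_eq (dquad (t1 + d, t1)
     (nth 0 [:: 0; 0; 0; 0; 0; a; b]) (nth 0 (unit7 i))) X j = 0) ->
  forall k, (k < 16)%N -> 1 * X k =
    X 12%N * nth 0 (ptseq (t1 + d, t1) 0 0 0 0 0 1 0) k
    + X 14%N * nth 0 (ptseq (t1 + d, t1) 0 0 0 0 0 0 1) k.
Proof.
move=> t1_0 d0 ab0 H.
have [a0|a0] := eqVneq a 0; last have [b0|b0] := eqVneq b 0.
- subst a; rewrite eqxx /= in ab0.
  apply: eq16.
  + by certify H b [:: (1, (1, 3)%N)].
  + by certify H b [:: (1, (1, 6)%N)].
  + by certify H b [:: (1, (1, 8)%N)].
  + by certify H b [:: (- 1, (4, 8)%N)].
  + by certify H b [:: (- 1, (1, 10)%N)].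
  + by certify H b [:: (1, (1, 11)%N)].
  + by certify H b [:: (1, (2, 6)%N)].
  + by certify H b [:: (- 1, (1, 13)%N)].
  + by certify H b [:: (1, (2, 8)%N)].
  + by certify H b [:: (- 1, (1, 14)%N)].
  + by certify H b [:: (1, (2, 10)%N)].
  + by certify H (b * d) [:: (1, (3, 8)%N)].
  + by rewrite /=; ring.
  + by certify H (b * d) [:: (1, (3, 10)%N)].
  + by rewrite /=; ring.
  + by certify H b [:: (1, (2, 15)%N)].
- subst b; clear ab0.
  apply: eq16.
  + by certify H a [:: (1, (0, 2)%N)].
  + by certify H a [:: (1, (0, 5)%N)].
  + by certify H a [:: (- 1, (1, 5)%N)].
  + by certify H a [:: (- 1, (0, 8)%N)].
  + by certify H a [:: (- 1, (0, 9)%N)].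
  + by certify H a [:: (- 1, (4, 12)%N); (- 1, (0, 12)%N)].
  + by certify H a [:: (- 1, (0, 11)%N)].
  + by certify H a [:: (- 1, (0, 12)%N)].
  + by certify H a [:: (1, (1, 11)%N)].
  + by certify H a [:: (1, (1, 12)%N)].
  + by certify H a [:: (1, (0, 14)%N)].
  + by certify H a [:: (1, (3, 15)%N); (- 1, (0, 15)%N)].
  + by rewrite /=; ring.
  + by certify H a [:: (1, (0, 15)%N)].
  + by rewrite /=; ring.
  + by certify H (a * d) [:: (1, (3, 12)%N); (1, (4, 12)%N)].
- clear ab0.
  apply: eq16.
  + by certify H a [:: (1, (0, 2)%N)].
  + by certify H a [:: (1, (0, 5)%N)].
  + by certify H a [:: (- 1, (1, 5)%N)].
  + by certify H a [:: (- 1, (0, 8)%N)].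
  + by certify H a [:: (- 1, (0, 9)%N)].
  + by certify H b [:: (1, (2, 5)%N)].
  + by certify H a [:: (- 1, (0, 11)%N)].
  + by certify H a [:: (- 1, (0, 12)%N)].
  + by certify H b [:: (1, (2, 8)%N)].
  + by certify H a [:: (1, (1, 12)%N)].
  + by certify H a [:: (1, (0, 14)%N)].
  + by certify H a [:: (1, (3, 15)%N); (- 1, (0, 15)%N)].
  + by rewrite /=; ring.
  + by certify H a [:: (1, (0, 15)%N)].
  + by rewrite /=; ring.
  + by certify H b [:: (1, (2, 15)%N)].
Qed.

Lemma line_of_spin_c9 (t1 d a b : K) X : t1 != 0 -> d != 0 -> (a != 0) || (b != 0) ->
  (forall i j, spin_eq (dquad (t1 + d, t1)
     (nth 0 [:: - a - b; 0; 0; a; 0; 0; b]) (nth 0 (unit7 i))) X j = 0) ->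
  forall k, (k < 16)%N -> (t1 + d) * X k =
    X 9%N * nth 0 (ptseq (t1 + d, t1) 0 0 0 1 (- t1) 0 0) k
    + X 14%N * nth 0 (ptseq (t1 + d, t1) 0 0 (t1 ^+ 2 + t1 * d) 0 0 0 (t1 + d)) k.
Proof.
move=> t1_0 d0 ab0 H.
have [a0|a0] := eqVneq a 0; last have [b0|b0] := eqVneq b 0.
- subst a; rewrite eqxx /= in ab0.
  apply: eq16.
  + by certify H b [:: (t1 + d, (1, 3)%N); (t1 * d, (1, 14)%N)].
  + by certify H b [:: (t1 + d, (1, 6)%N)].
  + by certify H b [:: (t1 + d, (1, 8)%N)].
  + by certify H b [:: (- t1 - d, (4, 8)%N)].
  + by certify H b [:: (- t1 - d, (1, 10)%N); (d, (1, 14)%N)].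
  + by certify H b [:: (t1 + d, (1, 11)%N)].
  + by certify H b [:: (t1 + d, (5, 11)%N)].
  + by certify H b [:: (- t1 - d, (1, 13)%N)].
  + by certify H b [:: (t1 + d, (2, 8)%N)].
  + by rewrite /=; ring.
  + by certify H b [:: (t1 + d, (2, 10)%N); (- t1, (1, 14)%N)].
  + by certify H b [:: (t1 + d, (4, 15)%N); (t1 + d, (5, 15)%N)].
  + by certify H b [:: (- t1 - d, (1, 15)%N)].
  + by certify H b [:: (- t1 - d, (5, 15)%N)].
  + by rewrite /=; ring.
  + by certify H b [:: (t1 + d, (2, 15)%N)].
- subst b; clear ab0.
  apply: eq16.
  + by certify H a [:: (t1 + d, (5, 4)%N); (- t1, (1, 4)%N); (t1 + d, (4, 4)%N); (t1 + d, (0, 4)%N)].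
  + by certify H (a * d) [:: (t1 + d, (0, 0)%N)].
  + by certify H (a * d) [:: (- t1 - d, (1, 0)%N)].
  + by certify H a [:: (t1 + d, (5, 10)%N)].
  + by certify H a [:: (- 1, (1, 4)%N)].
  + by certify H (a * d) [:: (- t1 - d, (0, 2)%N)].
  + by certify H a [:: (t1 + d, (5, 13)%N)].
  + by certify H (a * d) [:: (- t1 - d, (0, 4)%N)].
  + by certify H (a * d) [:: (t1 * d + d ^+ 2, (5, 14)%N); (t1 ^+ 2 + t1 * d, (1, 10)%N)].
  + by rewrite /=; ring.
  + by certify H (a * d) [:: (t1, (1, 4)%N); (- t1 - d, (4, 4)%N); (- t1 - d, (0, 4)%N)].
  + by certify H a [:: (t1 + d, (5, 15)%N)].
  + by certify H (a * d) [:: (t1 + d, (0, 9)%N)].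
  + by certify H (a * d) [:: (t1 + d, (0, 10)%N)].
  + by rewrite /=; ring.
  + by certify H (a * d) [:: (- t1 - d, (0, 14)%N)].
- clear ab0.
  apply: eq16.
  + by certify H b [:: (- t1 - d, (5, 2)%N); (- t1 * d - d ^+ 2, (5, 14)%N); (- t1 * d - d ^+ 2, (2, 10)%N); (t1 ^+ 2 + t1 * d, (0, 10)%N); (t1 * d, (1, 14)%N)].
  + by certify H (a * d) [:: (t1 + d, (0, 0)%N)].
  + by certify H b [:: (t1 + d, (1, 8)%N)].
  + by certify H b [:: (t1 + d, (5, 8)%N)].
  + by certify H b [:: (- t1 - d, (1, 10)%N); (d, (1, 14)%N)].
  + by certify H (a * d) [:: (- t1 - d, (0, 2)%N)].
  + by certify H b [:: (t1 + d, (5, 11)%N)].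
  + by certify H (a * d) [:: (- t1 - d, (0, 4)%N)].
  + by certify H (a * d) [:: (t1 * d + d ^+ 2, (5, 14)%N); (t1 * d + d ^+ 2, (2, 10)%N); (- t1 ^+ 2 - t1 * d, (0, 10)%N)].
  + by rewrite /=; ring.
  + by certify H (b * d) [:: (t1 * d + d ^+ 2, (2, 10)%N); (- t1 ^+ 2 - t1 * d, (0, 10)%N); (- t1 * d, (1, 14)%N)].
  + by certify H (a * d) [:: (t1 + d, (0, 8)%N)].
  + by certify H b [:: (- t1 - d, (1, 15)%N)].
  + by certify H (a * d) [:: (t1 + d, (0, 10)%N)].
  + by rewrite /=; ring.
  + by certify H b [:: (t1 + d, (2, 15)%N)].
Qed.

Lemma line_of_spin_c10 (t1 d a b : K) X : t1 != 0 -> d != 0 -> (a != 0) || (b != 0) ->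
  (forall i j, spin_eq (dquad (t1 + d, t1)
     (nth 0 [:: 0; a; 0; 0; b; 0; 0]) (nth 0 (unit7 i))) X j = 0) ->
  forall k, (k < 16)%N -> 1 * X k =
    X 6%N * nth 0 (ptseq (t1 + d, t1) 0 1 0 0 0 0 0) k
    + X 10%N * nth 0 (ptseq (t1 + d, t1) 0 0 (- 1) 0 1 0 0) k.
Proof.
move=> t1_0 d0 ab0 H.
have [a0|a0] := eqVneq a 0; last have [b0|b0] := eqVneq b 0.
- subst a; rewrite eqxx /= in ab0.
  apply: eq16.
  + by certify H b [:: (- 1, (5, 2)%N)].
  + by certify H b [:: (- 1, (5, 5)%N)].
  + by certify H (b * t1) [:: (1, (0, 2)%N)].
  + by certify H b [:: (1, (5, 8)%N)].
  + by certify H (b * t1) [:: (1, (0, 4)%N)].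
  + by certify H (b * d) [:: (- d, (5, 12)%N); (1, (3, 4)%N)].
  + by rewrite /=; ring.
  + by certify H (b * d) [:: (1, (3, 4)%N)].
  + by certify H b [:: (- 1, (5, 14)%N)].
  + by certify H (b * t1 * d) [:: (- d, (2, 4)%N); (t1, (3, 4)%N)].
  + by rewrite /=; ring.
  + by certify H (b * t1) [:: (1, (0, 11)%N)].
  + by certify H (b * t1) [:: (1, (0, 12)%N)].
  + by certify H (b * t1) [:: (1, (0, 13)%N)].
  + by certify H (b * t1) [:: (1, (0, 14)%N)].
  + by certify H (b * t1) [:: (- 1, (2, 11)%N)].
- subst b; clear ab0.
  apply: eq16.
  + by certify H a [:: (1, (5, 1)%N)].
  + by certify H a [:: (1, (6, 6)%N)].
  + by certify H a [:: (- 1, (5, 5)%N)].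
  + by certify H a [:: (- 1, (5, 6)%N)].
  + by certify H a [:: (- 1, (5, 7)%N)].
  + by certify H a [:: (1, (6, 11)%N); (- 1, (5, 13)%N)].
  + by rewrite /=; ring.
  + by certify H a [:: (- 1, (6, 13)%N); (- 1, (5, 13)%N)].
  + by certify H a [:: (1, (5, 11)%N); (1, (5, 13)%N)].
  + by certify H a [:: (1, (5, 12)%N)].
  + by rewrite /=; ring.
  + by certify H (a * d) [:: (1, (3, 6)%N)].
  + by certify H a [:: (- 1, (6, 15)%N)].
  + by certify H (a * t1) [:: (- 1, (2, 6)%N)].
  + by certify H a [:: (- 1, (5, 15)%N)].
  + by certify H (a * t1) [:: (- 1, (2, 11)%N)].
- clear ab0.
  apply: eq16.
  + by certify H a [:: (1, (5, 1)%N)].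
  + by certify H b [:: (1, (6, 5)%N)].
  + by certify H (b * t1) [:: (1, (0, 2)%N)].
  + by certify H a [:: (- 1, (5, 6)%N)].
  + by certify H (b * t1) [:: (1, (0, 4)%N)].
  + by certify H (a * b) [:: (a, (6, 12)%N); (- b, (6, 13)%N); (b, (5, 11)%N); (a, (5, 14)%N)].
  + by rewrite /=; ring.
  + by certify H (a * b) [:: (- b, (6, 13)%N); (b, (5, 11)%N); (a, (5, 14)%N)].
  + by certify H b [:: (- 1, (5, 14)%N)].
  + by certify H a [:: (- 1, (6, 14)%N); (- 1, (5, 14)%N)].
  + by rewrite /=; ring.
  + by certify H (b * t1) [:: (1, (0, 11)%N)].
  + by certify H (b * t1) [:: (1, (0, 12)%N)].
  + by certify H (b * t1) [:: (1, (0, 13)%N)].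
  + by certify H (b * t1) [:: (1, (0, 14)%N)].
  + by certify H (b * t1) [:: (- 1, (2, 12)%N)].
Qed.

Lemma line_of_spin_c11 (t1 d a b : K) X : t1 != 0 -> d != 0 -> (a != 0) || (b != 0) ->
  (forall i j, spin_eq (dquad (t1 + d, t1)
     (nth 0 [:: 0; 0; a; 0; 0; b; 0]) (nth 0 (unit7 i))) X j = 0) ->
  forall k, (k < 16)%N -> 1 * X k =
    X 1%N * nth 0 (ptseq (t1 + d, t1) 1 0 0 0 0 0 0) k
    + X 12%N * nth 0 (ptseq (t1 + d, t1) 0 0 0 0 0 1 0) k.
Proof.
move=> t1_0 d0 ab0 H.
have [a0|a0] := eqVneq a 0; last have [b0|b0] := eqVneq b 0.
- subst a; rewrite eqxx /= in ab0.
  apply: eq16.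
  + by certify H b [:: (1, (0, 2)%N)].
  + by rewrite /=; ring.
  + by certify H b [:: (- 1, (1, 5)%N); (- 1, (0, 5)%N)].
  + by certify H b [:: (- 1, (0, 8)%N)].
  + by certify H b [:: (- 1, (0, 9)%N)].
  + by certify H b [:: (- 1, (4, 12)%N); (- 1, (0, 12)%N)].
  + by certify H b [:: (- 1, (0, 11)%N)].
  + by certify H b [:: (- 1, (0, 12)%N)].
  + by certify H b [:: (1, (1, 11)%N)].
  + by certify H b [:: (1, (1, 12)%N)].
  + by certify H b [:: (1, (0, 14)%N)].
  + by certify H b [:: (1, (3, 15)%N); (- 1, (0, 15)%N)].
  + by rewrite /=; ring.
  + by certify H b [:: (1, (0, 15)%N)].
  + by certify H b [:: (- 1, (1, 15)%N)].
  + by certify H (b * d) [:: (1, (3, 12)%N); (1, (4, 12)%N)].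
- subst b; clear ab0.
  apply: eq16.
  + by certify H a [:: (1, (6, 0)%N)].
  + by rewrite /=; ring.
  + by certify H (a * t1 * d) [:: (t1, (3, 0)%N); (d, (0, 0)%N); (t1 + d, (4, 0)%N)].
  + by certify H (a * d) [:: (- 1, (4, 0)%N); (- 1, (3, 0)%N)].
  + by certify H (a * t1) [:: (1, (0, 0)%N)].
  + by certify H a [:: (1, (6, 5)%N)].
  + by certify H a [:: (1, (6, 6)%N)].
  + by certify H a [:: (1, (6, 7)%N)].
  + by certify H a [:: (1, (6, 8)%N)].
  + by certify H a [:: (1, (6, 9)%N)].
  + by certify H a [:: (1, (6, 10)%N)].
  + by certify H (a * t1) [:: (1, (3, 6)%N); (- 1, (0, 6)%N)].
  + by rewrite /=; ring.
  + by certify H (a * t1) [:: (1, (0, 6)%N)].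
  + by certify H (a * t1) [:: (1, (0, 8)%N)].
  + by certify H a [:: (1, (6, 15)%N)].
- clear ab0.
  apply: eq16.
  + by certify H a [:: (1, (6, 0)%N)].
  + by rewrite /=; ring.
  + by certify H b [:: (- 1, (1, 5)%N); (- 1, (0, 5)%N)].
  + by certify H (b ^+ 2) [:: (- b, (0, 8)%N); (- a * t1, (1, 15)%N)].
  + by certify H b [:: (- 1, (0, 9)%N)].
  + by certify H a [:: (1, (6, 5)%N)].
  + by certify H a [:: (1, (6, 6)%N)].
  + by certify H b [:: (- 1, (0, 12)%N)].
  + by certify H a [:: (1, (6, 8)%N)].
  + by certify H b [:: (1, (1, 12)%N)].
  + by certify H b [:: (1, (0, 14)%N)].
  + by certify H b [:: (1, (3, 15)%N); (- 1, (0, 15)%N)].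
  + by rewrite /=; ring.
  + by certify H b [:: (1, (0, 15)%N)].
  + by certify H b [:: (- 1, (1, 15)%N)].
  + by certify H a [:: (1, (6, 15)%N)].
Qed.

(** With t_0 = b + e, the points (y_2, y_3, y_4) = l ((t_0 - t_1) b, t_1 e, b e) satisfy the
    equation of the conic identically, so no side condition enters the certificates. The hypotheses
    leave out the three coordinate vertices, treated next. *)
Lemma conic_of_spin_generic (t1 l b e : K) X :
  t1 != 0 -> l != 0 -> b != 0 -> e != 0 -> b + e != 0 -> b + e - t1 != 0 ->
  (forall i j, spin_eq (dquad (b + e, t1) (nth 0 (conic_pt
     (l * (b + e - t1) * b) (l * t1 * e) (l * b * e))) (nth 0 (unit7 i))) X j = 0) ->
  forall k, (k < 16)%N -> (b + e) * (l * t1 * e) * X k =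
    X 9%N * nth 0 (conic_spin (b + e, t1)
      (l * (b + e - t1) * b) (l * t1 * e) (l * b * e)) k.
Proof.
move=> t1_0 l0 b0 e0 be0 bet0 H; apply: eq16.
- by certify H (b * b * (b + e - t1)) [:: (- b ^+ 3 * t1 + b ^+ 2 * t1 ^+ 2 - b ^+ 2 * t1 * e, (1, 4)%N); (b ^+ 3 * t1 ^+ 2 - 2 * b ^+ 2 * t1 ^+ 3 + 3 * b ^+ 2 * t1 ^+ 2 * e + b * t1 ^+ 4 - 4 * b * t1 ^+ 3 * e + 3 * b * t1 ^+ 2 * e ^+ 2 + t1 ^+ 4 * e - 2 * t1 ^+ 3 * e ^+ 2 + t1 ^+ 2 * e ^+ 3, (6, 12)%N); (- b ^+ 2 * t1 ^+ 2 * e + b * t1 ^+ 3 * e - 2 * b * t1 ^+ 2 * e ^+ 2 + t1 ^+ 3 * e ^+ 2 - t1 ^+ 2 * e ^+ 3, (6, 5)%N); (b ^+ 2 * t1 * e + b * t1 * e ^+ 2, (6, 0)%N); (- b ^+ 3 * t1 + b ^+ 2 * t1 ^+ 2 - 2 * b ^+ 2 * t1 * e + b * t1 ^+ 2 * e - b * t1 * e ^+ 2, (0, 4)%N)].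
- by certify H (b * e) [:: (b ^+ 2, (1, 4)%N); (b * t1 * e + t1 * e ^+ 2, (6, 5)%N); (- b ^+ 2 * t1 + b * t1 ^+ 2 - 2 * b * t1 * e + t1 ^+ 2 * e - t1 * e ^+ 2, (6, 12)%N); (b ^+ 2 + b * e, (0, 4)%N)].
- by certify H 1 [:: (- 1, (1, 2)%N)].
- by certify H ((b + e - t1)) [:: (- b - e, (5, 0)%N)].
- by certify H 1 [:: (- 1, (1, 4)%N)].
- by certify H (b * (b + e - t1)) [:: (- b ^+ 2, (1, 4)%N); (b ^+ 2 * t1 - b * t1 ^+ 2 + 2 * b * t1 * e - t1 ^+ 2 * e + t1 * e ^+ 2, (6, 12)%N); (- b ^+ 2 - b * e, (0, 4)%N)].
- by certify H (b * e * (b + e - t1)) [:: (- b ^+ 3 + b ^+ 2 * t1, (1, 4)%N); (b ^+ 3 * t1 - 2 * b ^+ 2 * t1 ^+ 2 + 2 * b ^+ 2 * t1 * e + b * t1 ^+ 3 - 3 * b * t1 ^+ 2 * e + b * t1 * e ^+ 2 + t1 ^+ 3 * e - t1 ^+ 2 * e ^+ 2, (6, 12)%N); (- b ^+ 2 * t1 * e + b * t1 ^+ 2 * e - 2 * b * t1 * e ^+ 2 + t1 ^+ 2 * e ^+ 2 - t1 * e ^+ 3, (6, 11)%N); (- b ^+ 3 + b ^+ 2 * t1 - b ^+ 2 * e + b * t1 * e, (0, 4)%N)].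
- by certify H ((b + e - t1)) [:: (- b, (1, 4)%N); (- b - e, (0, 4)%N)].
- by certify H (e * (b + e - t1) * (b + e - t1)) [:: (- 2 * b ^+ 3 + 3 * b ^+ 2 * t1 - 2 * b ^+ 2 * e - b * t1 ^+ 2 + b * t1 * e, (1, 4)%N); (- b ^+ 2 * e + b * t1 * e - b * e ^+ 2, (4, 4)%N); (b ^+ 2 * e - b * t1 * e + 2 * b * e ^+ 2 - t1 * e ^+ 2 + e ^+ 3, (1, 3)%N); (- b ^+ 2 * e - 2 * b * e ^+ 2 - e ^+ 3, (5, 0)%N); (- b ^+ 3 + b ^+ 2 * t1 - 2 * b ^+ 2 * e + b * t1 * e - b * e ^+ 2, (0, 4)%N)].
- by rewrite /conic_spin /=; ring.
- by certify H ((b + e - t1)) [:: (- 2 * b + t1, (1, 4)%N); (- e, (4, 4)%N); (- b - e, (0, 4)%N)].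
- by certify H e [:: (- b - e, (2, 5)%N)].
- by certify H (b * (b + e - t1)) [:: (b * e + e ^+ 2, (0, 5)%N)].
- by certify H (b * (b + e - t1)) [:: (b * e + e ^+ 2, (0, 6)%N)].
- by certify H (b * (b + e - t1)) [:: (- b * e - e ^+ 2, (1, 8)%N)].
- by certify H e [:: (b + e, (2, 12)%N)].
Qed.

Lemma conic_of_spin_node2 (t1 d a : K) X : t1 != 0 -> d != 0 -> a != 0 ->
  (forall i j, spin_eq (dquad (t1 + d, t1)
     (nth 0 (conic_pt a 0 0)) (nth 0 (unit7 i))) X j = 0) ->
  forall k, (k < 16)%N -> (a * t1) * X k =
    X 6%N * nth 0 (conic_spin (t1 + d, t1) a 0 0) k.
Proof.
move=> t1_0 d0 a0 H; apply: eq16.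
- by certify H 1 [:: (t1, (5, 1)%N)].
- by certify H 1 [:: (t1, (5, 5)%N); (t1, (6, 8)%N); (- t1, (5, 11)%N)].
- by certify H 1 [:: (t1, (6, 8)%N); (- t1, (5, 11)%N)].
- by certify H 1 [:: (- t1, (5, 6)%N)].
- by certify H 1 [:: (- t1, (5, 7)%N)].
- by certify H 1 [:: (t1, (6, 5)%N)].
- by rewrite /conic_spin /=; ring.
- by certify H 1 [:: (t1, (6, 7)%N)].
- by certify H 1 [:: (t1, (5, 11)%N)].
- by certify H 1 [:: (t1, (6, 9)%N)].
- by certify H 1 [:: (t1, (5, 13)%N)].
- by certify H 1 [:: (1, (4, 5)%N); (1, (0, 5)%N)].
- by certify H 1 [:: (1, (0, 5)%N)].
- by certify H 1 [:: (1, (0, 6)%N)].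
- by certify H 1 [:: (1, (0, 8)%N)].
- by certify H 1 [:: (1, (0, 11)%N)].
Qed.

Lemma conic_of_spin_node3 (t1 d a : K) X : t1 != 0 -> d != 0 -> a != 0 ->
  (forall i j, spin_eq (dquad (t1 + d, t1)
     (nth 0 (conic_pt 0 a 0)) (nth 0 (unit7 i))) X j = 0) ->
  forall k, (k < 16)%N -> (a * t1 + a * d) * X k =
    X 9%N * nth 0 (conic_spin (t1 + d, t1) 0 a 0) k.
Proof.
move=> t1_0 d0 a0 H; apply: eq16.
- by certify H 1 [:: (t1 + d, (5, 4)%N); (- t1, (1, 4)%N); (t1 + d, (4, 4)%N); (t1 + d, (0, 4)%N)].
- by certify H d [:: (t1 + d, (0, 0)%N)].
- by certify H d [:: (- t1 - d, (1, 0)%N)].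
- by certify H 1 [:: (t1 + d, (5, 10)%N)].
- by certify H 1 [:: (- 1, (1, 4)%N)].
- by certify H d [:: (- t1 - d, (0, 2)%N)].
- by certify H 1 [:: (t1 + d, (5, 13)%N)].
- by certify H d [:: (- t1 - d, (0, 4)%N)].
- by certify H 1 [:: (t1 + d, (5, 14)%N)].
- by rewrite /conic_spin /=; ring.
- by certify H d [:: (t1, (1, 4)%N); (- t1 - d, (4, 4)%N); (- t1 - d, (0, 4)%N)].
- by certify H 1 [:: (t1 + d, (5, 15)%N)].
- by certify H d [:: (t1 + d, (0, 9)%N)].
- by certify H d [:: (t1 + d, (0, 10)%N)].
- by certify H d [:: (- t1 - d, (1, 10)%N)].
- by certify H d [:: (- t1 - d, (0, 14)%N)].
Qed.

Lemma conic_of_spin_node4 (t1 d a : K) X : t1 != 0 -> d != 0 -> a != 0 ->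
  (forall i j, spin_eq (dquad (t1 + d, t1)
     (nth 0 (conic_pt 0 0 a)) (nth 0 (unit7 i))) X j = 0) ->
  forall k, (k < 16)%N -> (- a * t1) * X k =
    X 6%N * nth 0 (conic_spin (t1 + d, t1) 0 0 a) k.
Proof.
move=> t1_0 d0 a0 H; apply: eq16.
- by certify H 1 [:: (t1, (5, 1)%N)].
- by certify H 1 [:: (- t1, (6, 5)%N)].
- by certify H 1 [:: (- 1, (0, 2)%N)].
- by certify H 1 [:: (- t1, (5, 6)%N)].
- by certify H 1 [:: (- 1, (0, 4)%N)].
- by certify H 1 [:: (- t1, (6, 12)%N); (- t1, (6, 13)%N)].
- by rewrite /conic_spin /=; ring.
- by certify H 1 [:: (- t1, (6, 13)%N)].
- by certify H 1 [:: (t1, (5, 11)%N)].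
- by certify H 1 [:: (- t1, (6, 14)%N); (- t1, (5, 14)%N)].
- by certify H 1 [:: (- t1, (5, 11)%N); (t1, (5, 14)%N)].
- by certify H 1 [:: (- 1, (0, 11)%N)].
- by certify H 1 [:: (- 1, (0, 12)%N)].
- by certify H 1 [:: (- 1, (0, 13)%N)].
- by certify H 1 [:: (- 1, (0, 14)%N)].
- by certify H 1 [:: (1, (2, 12)%N)].
Qed.

End LineEquations.

Lemma kernel_certificate (K : fieldType) (E : nat -> K) J (L R U : K)
    (cs : seq (K * nat)) : (forall i, (i < J)%N -> E i = 0) -> U != 0 ->
  all (fun q => q.2 < J)%N cs ->
  U * (L - R) = foldr (fun q s => q.1 * E q.2 + s) 0 cs -> L = R.
Proof.
move=> E0 U0 csJ eqU; apply/eqP; rewrite -subr_eq0; apply/eqP/(mulfI U0).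
rewrite mulr0 eqU; elim: cs csJ {eqU} => //= q cs IHcs /andP[qJ csJ].
by rewrite IHcs // E0 // mulr0 addr0.
Qed.

Ltac compute_quadrics := lazy beta iota zeta delta
  [spin_eq dquad conic_pt conic_spin ptseq unit7 nth nseq ncons iter cat foldr fst snd
   iota size].

Tactic Notation "kcertify" constr(H) uconstr(U) uconstr(cs) :=
  refine (@kernel_certificate _ _ _ _ _ U cs H _ isT _);
  [by rewrite ?(mulf_neq0, expf_neq0, oner_neq0)
  |compute_quadrics; ring].

(** * Certificates at general points: tangent space, isotropy, spinor *)

Section GenericPoints.
Variable K : fieldType.
Implicit Types (t : K * K) (s : seq K) (S : seq (seq K)) (f : seq nat).

(* The vectors of S form a basis of the kernel of the differential at s of the
   first J quadrics; f lists the free coordinates. *)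
Definition kernel_basis (J : nat) t s (g : K) S f : Prop :=
  [/\ forall i j, (i < size S)%N -> (j < size S)%N ->
        nth 0 (nth [::] S i) (nth 0%N f j) = if i == j then g else 0,
      forall i k, (i < size S)%N -> (k < J)%N ->
        dquad t (nth 0 s) (nth 0 (nth [::] S i)) k = 0 &
      forall w : nat -> K, (forall k, (k < J)%N -> dquad t (nth 0 s) w k = 0) ->
        forall k, (k < 7)%N ->
        g * w k = foldr (fun i r => w (nth 0%N f i) * nth 0 (nth [::] S i) k + r) 0
          (iota 0 (size S))].

(** The quadratic form Q on W_p^perp: index k in 0, ..., 4 is the coordinate along e_{-(k+1)},
    paired with index k + 5. *)
Definition isotropic_at t s : Prop := forall w : nat -> K,
  \sum_(k < 5) dquad t (nth 0 s) w k * dquad t (nth 0 s) w (k + 5)%N = 0.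

Definition spinor_at t s (x : seq K) : Prop := forall (w : nat -> K) i,
  spin_eq (dquad t (nth 0 s) w) (nth 0 x) i = 0.

Lemma forall7 (P : nat -> Prop) : P 0%N -> P 1%N -> P 2%N -> P 3%N -> P 4%N -> P 5%N ->
  P 6%N -> forall k, (k < 7)%N -> P k.
Proof. by do 7 (move=> ?); do 7 (case=> [//|]). Qed.

Ltac kernel_id := by case=> [|[|[|[|[|[|?]]]]]] [|[|[|[|[|[|?]]]]]].
Ltac kernel_vec := case=> [|[|[|[|[|[|?]]]]]] [|[|[|[|[|[|[|[|[|[|?]]]]]]]]]] // _ _;
  compute_quadrics; ring.
Ltac isotropic := by move=> w; rewrite !big_ord_recl big_ord0 /=; compute_quadrics; ring.
Ltac spinor_vanish :=
  case=> [|[|[|[|[|[|[|[|[|[|[|[|[|[|[|[|?]]]]]]]]]]]]]]]]; compute_quadrics; ring.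

(** The first kernel, of dimension 2, is the tangent space of the cone and gives W_p^perp rank 5.
    The second, for g_0, ..., g_4, gives the rank of the projection along U_infty, hence the
    dimension of the intersection with U_infty. The conditions on a and b are the same for all lines
    and exclude every node. *)
Lemma generic_c0 (t1 d a b : K) (s := [:: a; 0; 0; 0; 0; 0; b]) :
  t1 != 0 -> d != 0 -> a != 0 -> b != 0 -> a - b != 0 -> a + b != 0 ->
  [/\ kernel_basis 10 (t1 + d, t1) s 1
        [:: [:: 1; 0; 0; 0; 0; 0; 0]; [:: 0; 0; 0; 0; 0; 0; 1]]
        [:: 0; 6]%N,
      kernel_basis 5 (t1 + d, t1) s 1
        [:: [:: 1; 0; 0; 0; 0; 0; 0]; [:: 0; 1; 0; 0; 0; 0; 0]; [:: 0; 0; 0; 0; 0; 1; 0]; [:: 0; 0; 0; 0; 0; 0; 1]]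
        [:: 0; 1; 5; 6]%N,
      isotropic_at (t1 + d, t1) s &
      spinor_at (t1 + d, t1) s (ptseq (t1 + d, t1) 0 0 (a * t1) 0 0 0 (- b))].
Proof.
move=> t1_0 d0 a0 b0 ab0 ab'0; rewrite {}/s; split.
- split=> [|| w H]; [kernel_id | kernel_vec | apply: forall7].
  + by rewrite /=; ring.
  + by kcertify H b [:: (1, 8%N)].
  + by kcertify H b [:: (1, 5%N)].
  + by kcertify H (d * (a + b)) [:: (- 1, 1%N)].
  + by kcertify H b [:: (1, 9%N)].
  + by kcertify H a [:: (- 1, 9%N); (1, 7%N)].
  + by rewrite /=; ring.
- split=> [|| w H]; [kernel_id | kernel_vec | apply: forall7].
  + by rewrite /=; ring.
  + by rewrite /=; ring.
  + by kcertify H (a * t1) [:: (- 1, 4%N)].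
  + by kcertify H (d * (a + b)) [:: (- 1, 1%N)].
  + by kcertify H (a * t1) [:: (1, 0%N)].
  + by rewrite /=; ring.
  + by rewrite /=; ring.
- isotropic.
- move=> w; spinor_vanish.
Qed.

Lemma generic_c1 (t1 d a b : K) (s := [:: a; b; 0; 0; 0; 0; 0]) :
  t1 != 0 -> d != 0 -> a != 0 -> b != 0 -> a - b != 0 -> a + b != 0 ->
  [/\ kernel_basis 10 (t1 + d, t1) s 1
        [:: [:: 1; 0; 0; 0; 0; 0; 0]; [:: 0; 1; 0; 0; 0; 0; 0]]
        [:: 0; 1]%N,
      kernel_basis 5 (t1 + d, t1) s 1
        [:: [:: 1; 0; 0; 0; 0; 0; 0]; [:: 0; 1; 0; 0; 0; 0; 0]; [:: 0; 0; 0; 0; 0; 1; 0]; [:: 0; 0; 0; 0; 0; 0; 1]]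
        [:: 0; 1; 5; 6]%N,
      isotropic_at (t1 + d, t1) s &
      spinor_at (t1 + d, t1) s (ptseq (t1 + d, t1) 0 b a 0 0 0 0)].
Proof.
move=> t1_0 d0 a0 b0 ab0 ab'0; rewrite {}/s; split.
- split=> [|| w H]; [kernel_id | kernel_vec | apply: forall7].
  + by rewrite /=; ring.
  + by rewrite /=; ring.
  + by kcertify H (t1 * (a - b)) [:: (- 1, 4%N)].
  + by kcertify H (a * d) [:: (- 1, 1%N)].
  + by kcertify H (a * a * t1 * d) [:: (a * d, 0%N); (- b * t1 - b * d, 1%N)].
  + by kcertify H b [:: (1, 6%N)].
  + by kcertify H b [:: (1, 8%N)].
- split=> [|| w H]; [kernel_id | kernel_vec | apply: forall7].
  + by rewrite /=; ring.
  + by rewrite /=; ring.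
  + by kcertify H (t1 * (a - b)) [:: (- 1, 4%N)].
  + by kcertify H (a * d) [:: (- 1, 1%N)].
  + by kcertify H (a * a * t1 * d) [:: (a * d, 0%N); (- b * t1 - b * d, 1%N)].
  + by rewrite /=; ring.
  + by rewrite /=; ring.
- isotropic.
- move=> w; spinor_vanish.
Qed.

Lemma generic_c2 (t1 d a b : K) (s := [:: a; a; b; 0; 0; 0; 0]) :
  t1 != 0 -> d != 0 -> a != 0 -> b != 0 -> a - b != 0 -> a + b != 0 ->
  [/\ kernel_basis 10 (t1 + d, t1) s 1
        [:: [:: 1; 1; 0; 0; 0; 0; 0]; [:: 0; 0; 1; 0; 0; 0; 0]]
        [:: 1; 2]%N,
      kernel_basis 5 (t1 + d, t1) s 1
        [:: [:: 1; 1; 0; 0; 0; 0; 0]; [:: 0; 0; 1; 0; 0; 0; 0]; [:: 0; 0; 0; 0; 0; 1; 0]; [:: 0; 0; 0; 0; 0; 0; 1]]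
        [:: 1; 2; 5; 6]%N,
      isotropic_at (t1 + d, t1) s &
      spinor_at (t1 + d, t1) s (ptseq (t1 + d, t1) (- b) a a 0 0 0 0)].
Proof.
move=> t1_0 d0 a0 b0 ab0 ab'0; rewrite {}/s; split.
- split=> [|| w H]; [kernel_id | kernel_vec | apply: forall7].
  + by kcertify H (b * t1 * (a - b)) [:: (b, 0%N); (- b, 1%N); (- a + b, 4%N)].
  + by rewrite /=; ring.
  + by rewrite /=; ring.
  + by kcertify H (a * d * (a - b)) [:: (b, 0%N); (- a, 1%N)].
  + by kcertify H (a * t1 * d * (a - b)) [:: (a * d + b * t1, 0%N); (- a * t1 - a * d, 1%N)].
  + by kcertify H a [:: (1, 6%N)].
  + by kcertify H b [:: (1, 5%N)].
- split=> [|| w H]; [kernel_id | kernel_vec | apply: forall7].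
  + by kcertify H (b * t1 * (a - b)) [:: (b, 0%N); (- b, 1%N); (- a + b, 4%N)].
  + by rewrite /=; ring.
  + by rewrite /=; ring.
  + by kcertify H (a * d * (a - b)) [:: (b, 0%N); (- a, 1%N)].
  + by kcertify H (a * t1 * d * (a - b)) [:: (a * d + b * t1, 0%N); (- a * t1 - a * d, 1%N)].
  + by rewrite /=; ring.
  + by rewrite /=; ring.
- isotropic.
- move=> w; spinor_vanish.
Qed.

Lemma generic_c5 (t1 d a b : K) (s := [:: 0; 0; a - b; a; a; b; 0]) :
  t1 != 0 -> d != 0 -> a != 0 -> b != 0 -> a - b != 0 -> a + b != 0 ->
  [/\ kernel_basis 10 (t1 + d, t1) s 1
        [:: [:: 0; 0; 1; 1; 1; 0; 0]; [:: 0; 0; - 1; 0; 0; 1; 0]]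
        [:: 4; 5]%N,
      kernel_basis 5 (t1 + d, t1) s 1
        [:: [:: 0; 0; 1; 1; 1; 0; 0]; [:: 0; 0; - 1; 0; 0; 1; 0]]
        [:: 4; 5]%N,
      isotropic_at (t1 + d, t1) s &
      spinor_at (t1 + d, t1) s (ptseq (t1 + d, t1) (- a * t1 + b * t1) 0 0 a 0 b 0)].
Proof.
move=> t1_0 d0 a0 b0 ab0 ab'0; rewrite {}/s; split.
- split=> [|| w H]; [kernel_id | kernel_vec | apply: forall7].
  + by kcertify H (a * b * t1) [:: (b, 0%N); (a * t1 + a * d, 6%N)].
  + by kcertify H b [:: (1, 6%N)].
  + by kcertify H (a * b * d) [:: (- a * t1 + b * t1, 9%N); (b, 3%N); (a * t1, 5%N)].
  + by kcertify H (b * (a - b)) [:: (a - b, 9%N); (- a, 5%N)].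
  + by rewrite /=; ring.
  + by rewrite /=; ring.
  + by kcertify H ((a - b)) [:: (1, 5%N)].
- split=> [|| w H]; [kernel_id | kernel_vec | apply: forall7].
  + by kcertify H (a * b * t1 * d) [:: (a * t1 + a * d - b * t1, 0%N); (a * t1 + a * d, 2%N); (a * t1 + a * d, 4%N)].
  + by kcertify H (a * b * d) [:: (a - b, 0%N); (a, 2%N); (a, 4%N)].
  + by kcertify H (a * b * d) [:: (a - b, 0%N); (a - b, 2%N); (b, 3%N); (a, 4%N)].
  + by kcertify H (b * t1 * (a - b)) [:: (- a + b, 0%N); (- a + b, 2%N); (- a, 4%N)].
  + by rewrite /=; ring.
  + by rewrite /=; ring.
  + by kcertify H (a * t1 * d * (a - b)) [:: (- a * t1 + b * t1, 1%N); (- a * t1 + b * t1, 2%N); (a * d, 4%N)].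
- isotropic.
- move=> w; spinor_vanish.
Qed.

Lemma generic_c6 (t1 d a b : K) (s := [:: 0; 0; 0; a - b; a; a; b]) :
  t1 != 0 -> d != 0 -> a != 0 -> b != 0 -> a - b != 0 -> a + b != 0 ->
  [/\ kernel_basis 10 (t1 + d, t1) s 1
        [:: [:: 0; 0; 0; 1; 1; 1; 0]; [:: 0; 0; 0; - 1; 0; 0; 1]]
        [:: 5; 6]%N,
      kernel_basis 5 (t1 + d, t1) s 1
        [:: [:: 0; 0; 0; 1; 1; 1; 0]; [:: 0; 0; 0; - 1; 0; 0; 1]]
        [:: 5; 6]%N,
      isotropic_at (t1 + d, t1) s &
      spinor_at (t1 + d, t1) s (ptseq (t1 + d, t1) 0 0 (- b * t1) (a - b) (b * t1) a (- b))].
Proof.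
move=> t1_0 d0 a0 b0 ab0 ab'0; rewrite {}/s; split.
- split=> [|| w H]; [kernel_id | kernel_vec | apply: forall7].
  + by kcertify H (a * a * t1) [:: (a, 0%N); (a * t1 + a * d - b * t1 - b * d, 6%N)].
  + by kcertify H a [:: (1, 6%N)].
  + by kcertify H b [:: (1, 5%N)].
  + by kcertify H (a * b * d) [:: (b * d, 9%N); (- b, 3%N); (a * d - b * t1 - b * d, 5%N)].
  + by kcertify H (b * d * (a - b)) [:: (- b, 3%N); (a * d - b * t1 - b * d, 5%N)].
  + by rewrite /=; ring.
  + by rewrite /=; ring.
- split=> [|| w H]; [kernel_id | kernel_vec | apply: forall7].
  + by kcertify H (a * t1 * d) [:: (d, 0%N); (t1 + d, 2%N); (t1 + d, 4%N)].
  + by kcertify H (d * (a - b)) [:: (1, 2%N); (1, 4%N)].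
  + by kcertify H (b * t1) [:: (1, 4%N)].
  + by kcertify H (a * b * t1 * d * (a - b)) [:: (- a * b * d + b ^+ 2 * d, 0%N); (- a * b * t1, 1%N); (- a * b * t1 - a * b * d + b ^+ 2 * t1 + b ^+ 2 * d, 2%N); (- a * b * t1, 3%N); (a ^+ 2 * d - a * b * t1 - 2 * a * b * d + b ^+ 2 * t1 + b ^+ 2 * d, 4%N)].
  + by kcertify H (b * t1 * d * (a - b)) [:: (- b * t1, 3%N); (a * d - b * t1 - b * d, 4%N)].
  + by rewrite /=; ring.
  + by rewrite /=; ring.
- isotropic.
- move=> w; spinor_vanish.
Qed.

Lemma generic_c7 (t1 d a b : K) (s := [:: 0; 0; 0; 0; a; b; b]) :
  t1 != 0 -> d != 0 -> a != 0 -> b != 0 -> a - b != 0 -> a + b != 0 ->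
  [/\ kernel_basis 10 (t1 + d, t1) s 1
        [:: [:: 0; 0; 0; 0; 1; 0; 0]; [:: 0; 0; 0; 0; 0; 1; 1]]
        [:: 4; 6]%N,
      kernel_basis 5 (t1 + d, t1) s 1
        [:: [:: 0; 1; 0; 0; 0; 0; 0]; [:: 0; 0; 0; 0; 1; 0; 0]; [:: 0; 0; 0; 0; 0; 1; 0]; [:: 0; 0; 0; 0; 0; 0; 1]]
        [:: 1; 4; 5; 6]%N,
      isotropic_at (t1 + d, t1) s &
      spinor_at (t1 + d, t1) s (ptseq (t1 + d, t1) 0 0 (- a * t1) 0 (a * t1) b (- b))].
Proof.
move=> t1_0 d0 a0 b0 ab0 ab'0; rewrite {}/s; split.
- split=> [|| w H]; [kernel_id | kernel_vec | apply: forall7].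
  + by kcertify H (a * t1) [:: (1, 0%N)].
  + by kcertify H b [:: (1, 6%N)].
  + by kcertify H b [:: (1, 5%N)].
  + by kcertify H (b * d * (a - b)) [:: (b, 1%N); (- a * t1, 5%N)].
  + by rewrite /=; ring.
  + by kcertify H (a * d * (a - b)) [:: (- a * d + b * d, 9%N); (- a * t1, 5%N); (b, 1%N)].
  + by rewrite /=; ring.
- split=> [|| w H]; [kernel_id | kernel_vec | apply: forall7].
  + by kcertify H (a * t1) [:: (1, 0%N)].
  + by rewrite /=; ring.
  + by kcertify H (a * t1) [:: (- 1, 2%N)].
  + by kcertify H (d * (a - b)) [:: (1, 1%N); (1, 2%N)].
  + by rewrite /=; ring.
  + by rewrite /=; ring.
  + by rewrite /=; ring.
- isotropic.
- move=> w; spinor_vanish.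
Qed.

Lemma generic_c8 (t1 d a b : K) (s := [:: 0; 0; 0; 0; 0; a; b]) :
  t1 != 0 -> d != 0 -> a != 0 -> b != 0 -> a - b != 0 -> a + b != 0 ->
  [/\ kernel_basis 10 (t1 + d, t1) s 1
        [:: [:: 0; 0; 0; 0; 0; 1; 0]; [:: 0; 0; 0; 0; 0; 0; 1]]
        [:: 5; 6]%N,
      kernel_basis 5 (t1 + d, t1) s 1
        [:: [:: 1; 0; 0; 0; 0; 0; 0]; [:: 0; 1; 0; 0; 0; 0; 0]; [:: 0; 0; 1; 0; 0; 0; 0]; [:: 0; 0; 0; 0; 1; 0; 0]; [:: 0; 0; 0; 0; 0; 1; 0]; [:: 0; 0; 0; 0; 0; 0; 1]]
        [:: 0; 1; 2; 4; 5; 6]%N,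
      isotropic_at (t1 + d, t1) s &
      spinor_at (t1 + d, t1) s (ptseq (t1 + d, t1) 0 0 0 0 0 a (- b))].
Proof.
move=> t1_0 d0 a0 b0 ab0 ab'0; rewrite {}/s; split.
- split=> [|| w H]; [kernel_id | kernel_vec | apply: forall7].
  + by kcertify H a [:: (- 1, 9%N); (1, 7%N)].
  + by kcertify H a [:: (1, 6%N)].
  + by kcertify H b [:: (1, 5%N)].
  + by kcertify H (b * d) [:: (- 1, 1%N)].
  + by kcertify H (b * d * (a - b)) [:: (- b * d, 9%N); (- a, 1%N)].
  + by rewrite /=; ring.
  + by rewrite /=; ring.
- split=> [|| w H]; [kernel_id | kernel_vec | apply: forall7].
  + by rewrite /=; ring.
  + by rewrite /=; ring.
  + by rewrite /=; ring.
  + by kcertify H (b * d) [:: (- 1, 1%N)].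
  + by rewrite /=; ring.
  + by rewrite /=; ring.
  + by rewrite /=; ring.
- isotropic.
- move=> w; spinor_vanish.
Qed.

Lemma generic_c9 (t1 d a b : K) (s := [:: - a - b; 0; 0; a; 0; 0; b]) :
  t1 != 0 -> d != 0 -> a != 0 -> b != 0 -> a - b != 0 -> a + b != 0 ->
  [/\ kernel_basis 10 (t1 + d, t1) s 1
        [:: [:: - 1; 0; 0; 1; 0; 0; 0]; [:: - 1; 0; 0; 0; 0; 0; 1]]
        [:: 3; 6]%N,
      kernel_basis 5 (t1 + d, t1) s 1
        [:: [:: - 1; 0; 0; 1; 0; 0; 0]; [:: - 1; 0; 0; 0; 0; 0; 1]]
        [:: 3; 6]%N,
      isotropic_at (t1 + d, t1) s &
      spinor_at (t1 + d, t1) s (ptseq (t1 + d, t1) 0 0 (b * t1) (- a) (a * t1) 0 b)].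
Proof.
move=> t1_0 d0 a0 b0 ab0 ab'0; rewrite {}/s; split.
- split=> [|| w H]; [kernel_id | kernel_vec | apply: forall7].
  + by kcertify H (a * b * t1 * d * (a + b)) [:: (- a * b * d, 0%N); (- a * b * t1 - b ^+ 2 * t1, 1%N); (- a ^+ 2 * t1 ^+ 2 - a * b * t1 ^+ 2, 5%N); (- a ^+ 2 * t1 * d - a ^+ 2 * d ^+ 2, 8%N)].
  + by kcertify H b [:: (1, 8%N)].
  + by kcertify H b [:: (1, 5%N)].
  + by rewrite /=; ring.
  + by kcertify H (b * t1 * (a + b)) [:: (- b, 0%N); (- a * t1 - a * d, 8%N)].
  + by kcertify H (b * t1 * (a + b)) [:: (- b, 0%N); (- a * t1 - a * d, 8%N); (- a * t1 - b * t1, 7%N)].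
  + by rewrite /=; ring.
- split=> [|| w H]; [kernel_id | kernel_vec | apply: forall7].
  + by kcertify H (a * b * t1 * d * (a + b)) [:: (- a * b * d, 0%N); (- a * b * t1 - b ^+ 2 * t1, 1%N); (- a * b * t1 - a * b * d, 2%N); (a ^+ 2 * d - a * b * t1, 4%N)].
  + by kcertify H (a * b * d) [:: (b, 2%N); (- a, 4%N)].
  + by kcertify H (b * t1) [:: (1, 4%N)].
  + by rewrite /=; ring.
  + by kcertify H (b * t1 * d * (a + b)) [:: (- b * d, 0%N); (- b * t1 - b * d, 2%N); (a * t1 + a * d, 4%N)].
  + by kcertify H (a * t1 * d * (a + b)) [:: (- a * d, 0%N); (- a * t1 - a * d, 2%N); (a * t1 + b * t1, 3%N); (- a * t1 - a * d, 4%N)].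
  + by rewrite /=; ring.
- isotropic.
- move=> w; spinor_vanish.
Qed.

Lemma generic_c10 (t1 d a b : K) (s := [:: 0; a; 0; 0; b; 0; 0]) :
  t1 != 0 -> d != 0 -> a != 0 -> b != 0 -> a - b != 0 -> a + b != 0 ->
  [/\ kernel_basis 10 (t1 + d, t1) s 1
        [:: [:: 0; 1; 0; 0; 0; 0; 0]; [:: 0; 0; 0; 0; 1; 0; 0]]
        [:: 1; 4]%N,
      kernel_basis 5 (t1 + d, t1) s 1
        [:: [:: 0; 1; 0; 0; 0; 0; 0]; [:: 0; 0; 0; 0; 1; 0; 0]; [:: 0; 0; 0; 0; 0; 1; 0]; [:: 0; 0; 0; 0; 0; 0; 1]]
        [:: 1; 4; 5; 6]%N,
      isotropic_at (t1 + d, t1) s &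
      spinor_at (t1 + d, t1) s (ptseq (t1 + d, t1) 0 a (- b) 0 b 0 0)].
Proof.
move=> t1_0 d0 a0 b0 ab0 ab'0; rewrite {}/s; split.
- split=> [|| w H]; [kernel_id | kernel_vec | apply: forall7].
  + by kcertify H (b * b * t1 * d * (a + b)) [:: (a * b * d + b ^+ 2 * d, 0%N); (a ^+ 2 * t1 + a ^+ 2 * d + a * b * t1 + a * b * d, 1%N); (- a * b * t1 - a * b * d, 4%N)].
  + by rewrite /=; ring.
  + by kcertify H (t1 * (a + b)) [:: (1, 4%N)].
  + by kcertify H (b * d * (a + b)) [:: (a + b, 1%N); (- b, 4%N)].
  + by rewrite /=; ring.
  + by kcertify H a [:: (1, 6%N)].
  + by kcertify H a [:: (1, 8%N)].
- split=> [|| w H]; [kernel_id | kernel_vec | apply: forall7].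
  + by kcertify H (b * b * t1 * d * (a + b)) [:: (a * b * d + b ^+ 2 * d, 0%N); (a ^+ 2 * t1 + a ^+ 2 * d + a * b * t1 + a * b * d, 1%N); (- a * b * t1 - a * b * d, 4%N)].
  + by rewrite /=; ring.
  + by kcertify H (t1 * (a + b)) [:: (1, 4%N)].
  + by kcertify H (b * d * (a + b)) [:: (a + b, 1%N); (- b, 4%N)].
  + by rewrite /=; ring.
  + by rewrite /=; ring.
  + by rewrite /=; ring.
- isotropic.
- move=> w; spinor_vanish.
Qed.

Lemma generic_c11 (t1 d a b : K) (s := [:: 0; 0; a; 0; 0; b; 0]) :
  t1 != 0 -> d != 0 -> a != 0 -> b != 0 -> a - b != 0 -> a + b != 0 ->
  [/\ kernel_basis 10 (t1 + d, t1) s 1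
        [:: [:: 0; 0; 1; 0; 0; 0; 0]; [:: 0; 0; 0; 0; 0; 1; 0]]
        [:: 2; 5]%N,
      kernel_basis 5 (t1 + d, t1) s 1
        [:: [:: 1; 1; 0; 0; 0; 0; 0]; [:: 0; 0; 1; 0; 0; 0; 0]; [:: 0; 0; 0; 0; 0; 1; 0]; [:: 0; 0; 0; 0; 0; 0; 1]]
        [:: 1; 2; 5; 6]%N,
      isotropic_at (t1 + d, t1) s &
      spinor_at (t1 + d, t1) s (ptseq (t1 + d, t1) (a * t1) 0 0 0 0 (- b) 0)].
Proof.
move=> t1_0 d0 a0 b0 ab0 ab'0; rewrite {}/s; split.
- split=> [|| w H]; [kernel_id | kernel_vec | apply: forall7].
  + by kcertify H b [:: (- 1, 9%N); (1, 7%N)].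
  + by kcertify H b [:: (1, 6%N)].
  + by rewrite /=; ring.
  + by kcertify H (b * d * (a + b)) [:: (- a * t1, 9%N); (b, 3%N)].
  + by kcertify H (b * d * (a + b)) [:: (- a * t1 - a * d - b * d, 9%N); (b, 3%N)].
  + by rewrite /=; ring.
  + by kcertify H a [:: (1, 5%N)].
- split=> [|| w H]; [kernel_id | kernel_vec | apply: forall7].
  + by kcertify H (a * t1) [:: (1, 1%N); (- 1, 4%N)].
  + by rewrite /=; ring.
  + by rewrite /=; ring.
  + by kcertify H (d * (a + b)) [:: (1, 1%N); (1, 3%N)].
  + by kcertify H (a * t1 * d * (a + b)) [:: (a * t1 + a * d + b * d, 1%N); (a * t1, 3%N)].
  + by rewrite /=; ring.
  + by rewrite /=; ring.
- isotropic.
- move=> w; spinor_vanish.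
Qed.

Lemma generic_c34 (t1 b e : K)
    (s := conic_pt ((b + e - t1) * b) (t1 * e) (b * e))
    (S := [:: [:: - (b + e - t1) * b ^+ 2 - t1 * e ^+ 2; - (b + e - t1) * b ^+ 2; - (b + e - t1) * b ^+ 2; t1 * e ^+ 2; 0; 0; 0];
            [:: t1 * (b + e - t1) * (b + e); t1 * (b + e - t1) * (b + e) - t1 * e ^+ 2; t1 * (b + e - t1) * (b + e);
                0; t1 * e ^+ 2; 0; 0]]) :
  t1 != 0 -> b != 0 -> e != 0 -> b + e != 0 -> b + e - t1 != 0 ->
  b - t1 != 0 ->
  [/\ kernel_basis 10 (b + e, t1) s (t1 * e ^+ 2) S [:: 3; 4]%N,
      kernel_basis 5 (b + e, t1) s (t1 * e ^+ 2) S [:: 3; 4]%N,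
      isotropic_at (b + e, t1) s &
      spinor_at (b + e, t1) s
        (conic_spin (b + e, t1) ((b + e - t1) * b) (t1 * e) (b * e))].
Proof.
move=> t1_0 b0 e0 be0 bet0 bt0; rewrite {}/S {}/s; split.
- split=> [|| w H]; [kernel_id | kernel_vec | apply: forall7].
  + by kcertify H (b * (b + e - t1)) [:: (- b * e, 1%N); (b ^+ 2 - b * t1, 3%N); (- t1 * e ^+ 2, 5%N); (- b * t1 * e + t1 ^+ 2 * e - t1 * e ^+ 2, 6%N)].
  + by kcertify H (b * (b + e - t1)) [:: (b * e, 2%N); (b ^+ 2 - b * t1, 3%N); (- b * t1 * e + t1 ^+ 2 * e - t1 * e ^+ 2, 6%N)].
  + by kcertify H (b * (b - t1)) [:: (b ^+ 2 - b * t1, 3%N); (- b * t1 * e + t1 ^+ 2 * e - t1 * e ^+ 2, 6%N)].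
  + by rewrite /=; ring.
  + by rewrite /=; ring.
  + by kcertify H (b * (b - t1)) [:: (t1 * e ^+ 2, 6%N)].
  + by kcertify H (b * (b + e - t1)) [:: (t1 * e ^+ 2, 5%N)].
- split=> [|| w H]; [kernel_id | kernel_vec | apply: forall7].
  + by kcertify H (b * (b + e - t1)) [:: (- b ^+ 2 + b * t1 - b * e, 0%N); (- b * e - e ^+ 2, 4%N)].
  + by kcertify H ((b + e - t1)) [:: (- b + t1 - e, 0%N); (- e, 4%N)].
  + by kcertify H ((b - t1)) [:: (- b + t1 - e, 0%N); (- e, 2%N); (- e, 4%N)].
  + by rewrite /=; ring.
  + by rewrite /=; ring.
  + by kcertify H ((b + e - t1) * (b - t1)) [:: (b * e - t1 * e + e ^+ 2, 0%N); (e ^+ 2, 2%N); (b * e - t1 * e, 3%N); (e ^+ 2, 4%N)].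
  + by kcertify H (b * (b + e - t1)) [:: (- b * e, 1%N); (- b * e, 2%N); (e ^+ 2, 4%N)].
- isotropic.
- move=> w; spinor_vanish.
Qed.

End GenericPoints.

Ltac prove_ispoly := repeat first
  [ assumption | exact: ispolyC | exact: ispolyX | apply: ispolyD | apply: ispolyM
  | apply: ispolyN | apply: ispoly_exp ].

(** * Tangent vectors as derivatives of polynomial paths *)

Section Tangents.
Variables (K : fieldType).
Hypothesis natK : injective (fun k : nat => k%:R : K).
Implicit Types (t : K * K) (f g : {mpoly K[7]}) (p w : 'rV[K]_7).

Lemma mpoly_gen_ind (P : {mpoly K[7]} -> Prop) :
  (forall c, P c%:MP) -> (forall i, P 'X_i) ->
  (forall f g, P f -> P g -> P (f + g)) -> (forall f g, P f -> P g -> P (f * g)) ->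
  forall f, P f.
Proof.
move=> PC PX PD PM f; rewrite [f]mpolyE.
apply: (big_ind P) => [||m _]; [by rewrite -mpolyC0|exact: PD|].
rewrite -mul_mpolyC; apply: (PM) => //; rewrite mpolyXE_id.
apply: (big_ind P) => [||i _]; [by rewrite -mpolyC1|exact: PM|].
elim: (m i) => [|k IHk]; first by rewrite expr0 -mpolyC1.
by rewrite exprS; apply: PM.
Qed.

(** First-order Taylor expansion with a polynomial remainder. It holds for constants and variables
    and is stable under sums and products, by the Leibniz rule. *)
Lemma dir_path f p w (c z : K -> 'rV[K]_7) : ispath z ->
  (forall u, c u = p + u *: w + u ^+ 2 *: z u) ->
  exists2 h, ispoly h &
    forall u, f.@[c u 0] = f.@[p 0] + u * dir f p w + u ^+ 2 * h u.
Proof.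
move=> pz cE; elim/mpoly_gen_ind: f => [a|i|f1 f2|f1 f2].
- exists (fun=> 0) => [|u]; first exact: ispolyC.
  by rewrite !mevalC dirC !mulr0 !addr0.
- exists (fun u => z u 0 i) => // u.
  by rewrite !mevalXU cE !mxE -[in 'X_i](inord_val i) -/(y K i) dir_var inord_val.
- move=> [h1 ph1 h1E] [h2 ph2 h2E]; exists (fun u => h1 u + h2 u).
    exact: ispolyD.
  by move=> u; rewrite !mevalD dirD h1E h2E; ring.
- move=> [h1 ph1 h1E] [h2 ph2 h2E].
  exists (fun u => f1.@[p 0] * h2 u + h1 u * f2.@[p 0] + dir f1 p w * dir f2 p w
    + u * (dir f1 p w * h2 u + h1 u * dir f2 p w) + u ^+ 2 * (h1 u * h2 u)).
    by prove_ispoly.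
  by move=> u; rewrite !mevalM dirM h1E h2E; ring.
Qed.

(* w is the derivative at 0 of a polynomial path in C_t through p. *)
Definition curve_tangent t p w := exists c z : K -> 'rV[K]_7,
  [/\ ispath c, ispath z, forall u, c u = p + u *: w + u ^+ 2 *: z u &
      forall u, c u != 0 -> curve t (c u)].

(** Since f vanishes along the path, its expansion can be divided by u and then evaluated at u = 0.
    Parameters where the path meets the zero vector are discarded by a coordinate of p that is
    nonzero. *)
Lemma dir_curve t p w f : p != 0 -> curve_tangent t p w ->
  (forall q, curve t q -> f.@[q 0] = 0) -> dir f p w = 0.
Proof.
move=> p0 [c [z [pc pz cE cC]]] f0.
have [h ph fE] := dir_path f pz cE.
have c0 : c 0 = p by rewrite cE scale0r expr0n scale0r !addr0.
have fp : f.@[p 0] = 0 by rewrite -c0; apply/f0/cC; rewrite c0.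
have /rV0Pn[i pi0] := p0.
have [u1 cu1] : exists u, u * c u 0 i != 0.
  apply: (ispoly_nz2 natK (u1 := 1) (u2 := 0)); [exact: ispolyX|exact: pc|..].
    exact: oner_neq0.
  by rewrite c0.
have pdh : ispoly (fun u => dir f p w + u * h u).
  by apply: ispolyD; [exact: ispolyC | apply: ispolyM => //; exact: ispolyX].
have := ispoly_vanish natK pdh (ispolyM (ispolyX K) (pc i)) cu1.
move=> /(_ _ 0); rewrite mul0r addr0; apply=> u; rewrite mulf_eq0 negb_or => /andP[u0 cu].
have cu0 : c u != 0 by apply: contraNneq cu => ->; rewrite mxE.
have := fE u; rewrite (f0 _ (cC u cu0)) fp add0r => E.
by apply: (mulfI u0); rewrite mulr0 [RHS]E; ring.
Qed.

End Tangents.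

Section Kernels.
Variable K : fieldType.

Lemma foldr_sum (I : Type) (s : seq I) (F : I -> K) :
  foldr (fun i r => F i + r) 0 s = \sum_(i <- s) F i.
Proof. by elim: s => [|i s IHs]; rewrite ?big_nil // big_cons -IHs. Qed.

(** Selecting the free coordinates f and dividing by g inverts T on the right, so the vectors of S
    are independent; the last hypothesis makes them span the kernel. The rank of W then follows from
    rank-nullity. *)
Lemma rank_kernel m (W : 'M[K]_(7, m)) (g : K) (S : seq (seq K)) (f : seq nat) :
  g != 0 -> (size S <= 7)%N -> all (fun k => k < 7)%N f -> size f = size S ->
  (forall i j, (i < size S)%N -> (j < size S)%N ->
    nth 0 (nth [::] S i) (nth 0%N f j) = if i == j then g else 0) ->
  (forall i, (i < size S)%N -> row7 (nth [::] S i) *m W = 0) ->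
  (forall w : 'rV[K]_7, w *m W = 0 -> forall k, (k < 7)%N ->
    g * co w k = foldr (fun i r => co w (nth 0%N f i) * nth 0 (nth [::] S i) k + r)
      0 (iota 0 (size S))) ->
  let T := \matrix_(i < size S) row7 (nth [::] S i) in
  [/\ \rank W = (7 - size S)%N, \rank T = size S &
      forall w : 'rV[K]_7, (w <= T)%MS <-> w *m W = 0].
Proof.
move=> g0 S7 f7 fS Sid SW WS T.
have rT : \rank T = size S.
  apply/eqP/row_freeP.
  exists (g^-1 *: \matrix_(l < 7, j < size S) (l == nth 0%N f j :> nat)%:R).
  rewrite -scalemxAr; apply: (scalerI g0); rewrite scalerA divff // scale1r.
  apply/matrixP => i j; rewrite !mxE mulr_natr.
  have fj : (nth 0%N f j < 7)%N by apply: all_nthP f7 _ _; rewrite fS.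
  rewrite (bigD1 (Ordinal fj)) //= big1 => [|l]; last first.
    by rewrite !mxE -val_eqE /= => /negbTE ->; rewrite mulr0.
  rewrite !mxE /= eqxx mulr1 addr0 Sid // mulrb.
  by rewrite -val_eqE.
have TW : T *m W = 0.
  by apply/row_matrixP => i; rewrite row_mul rowK SW // row0.
have eqT (w : 'rV[K]_7) : (w <= T)%MS <-> w *m W = 0.
  split=> [/submxP[D ->]|wW]; first by rewrite -mulmxA TW mulmx0.
  have -> : w = (\row_i (g^-1 * co w (nth 0%N f i))) *m T.
    apply: (scalerI g0); apply/rowP => k; rewrite !mxE.
    have := WS w wW k (ltn_ord k); rewrite /co inord_val => ->.
    rewrite foldr_sum.
    have -> : iota 0 (size S) = index_iota 0 (size S) by rewrite /index_iota subn0.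
    rewrite big_mkord mulr_sumr.
    by apply: eq_bigr => i _; rewrite !mxE -mulrA mulVKf.
  exact: submxMl.
split=> //.
have kT : (kermx W :=: T)%MS.
  apply/eqmxP/andP; split; last by apply/sub_kermxP.
  by apply/row_subP => i; apply/eqT; rewrite -row_mul mulmx_ker row0.
have := mxrank_ker W; rewrite kT rT => ->.
by rewrite subKn // rank_leq_row.
Qed.

End Kernels.

(** * Points of the curve, and the vanishing of the quadrics on it *)

Section CurveParametrization.
Variable K : fieldType.
Implicit Types (t : K * K) (p q w : 'rV[K]_7).

Definition line_pt (v : label) (a b : K) : seq K :=
  match v with
  | c0 => [:: a; 0; 0; 0; 0; 0; b]
  | c1 => [:: a; b; 0; 0; 0; 0; 0]
  | c2 => [:: a; a; b; 0; 0; 0; 0]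
  | c34 => [::]
  | c5 => [:: 0; 0; a - b; a; a; b; 0]
  | c6 => [:: 0; 0; 0; a - b; a; a; b]
  | c7 => [:: 0; 0; 0; 0; a; b; b]
  | c8 => [:: 0; 0; 0; 0; 0; a; b]
  | c9 => [:: - a - b; 0; 0; a; 0; 0; b]
  | c10 => [:: 0; a; 0; 0; b; 0; 0]
  | c11 => [:: 0; 0; a; 0; 0; b; 0]
  end.

Definition conic_eq t (y2 y3 y4 : K) : Prop :=
  t.1 * y2 * y3 - t.2 * y2 * y4 + (- t.1 + t.2) * y3 * y4 = 0.

Lemma forall_cons (T : eqType) (P : T -> Prop) x s :
  (forall z, z \in x :: s -> P z) <-> P x /\ forall z, z \in s -> P z.
Proof.
split=> [H|[Px Ps] z].
  by split=> [|z zs]; apply: H; rewrite inE ?eqxx // zs orbT.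
by rewrite inE => /orP[/eqP ->|/Ps].
Qed.

Lemma forall_nil (T : eqType) (P : T -> Prop) :
  (forall z, z \in [::] -> P z) <-> True.
Proof. by split. Qed.

Lemma curve_compE t v q : curve_comp t v q <-> q != 0 /\
  match v with
  | c0 => [/\ co q 5 = 0, co q 4 = 0, co q 3 = 0, co q 2 = 0 & co q 1 = 0]
  | c1 => [/\ co q 6 = 0, co q 5 = 0, co q 4 = 0, co q 3 = 0 & co q 2 = 0]
  | c2 => [/\ co q 6 = 0, co q 5 = 0, co q 4 = 0, co q 3 = 0 & co q 0 - co q 1 = 0]
  | c34 => [/\ conic_eq t (co q 2) (co q 3) (co q 4), co q 6 = 0, co q 5 = 0,
      co q 1 - co q 2 + co q 4 = 0 & co q 0 - co q 2 + co q 3 = 0]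
  | c5 => [/\ co q 6 = 0, co q 3 - co q 4 = 0, co q 2 - co q 4 + co q 5 = 0,
      co q 1 = 0 & co q 0 = 0]
  | c6 => [/\ co q 4 - co q 5 = 0, co q 3 - co q 5 + co q 6 = 0, co q 2 = 0,
      co q 1 = 0 & co q 0 = 0]
  | c7 => [/\ co q 5 - co q 6 = 0, co q 3 = 0, co q 2 = 0, co q 1 = 0 & co q 0 = 0]
  | c8 => [/\ co q 4 = 0, co q 3 = 0, co q 2 = 0, co q 1 = 0 & co q 0 = 0]
  | c9 => [/\ co q 5 = 0, co q 4 = 0, co q 2 = 0, co q 1 = 0 &
      co q 0 + co q 3 + co q 6 = 0]
  | c10 => [/\ co q 6 = 0, co q 5 = 0, co q 3 = 0, co q 2 = 0 & co q 0 = 0]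
  | c11 => [/\ co q 6 = 0, co q 4 = 0, co q 3 = 0, co q 1 = 0 & co q 0 = 0]
  end.
Proof.
have yE i : (y K i).@[q 0] = co q i by rewrite mevalXU.
rewrite /curve_comp /= /conic_eq; case: v;
  rewrite /= !forall_cons forall_nil ?(mevalD, mevalB, mevalN, mevalM, mevalC) !yE;
  by split=> -[q0]; [move=> [? [? [? [? [? _]]]]] | move=> [? ? ? ? ?]].
Qed.

Lemma line_ptP t v q : v <> c34 -> curve_comp t v q ->
  exists a b, q = row7 (line_pt v a b).
Proof.
move=> vc /curve_compE[_]; case: v vc => // _ [H1 H2 H3 H4 H5].
- by exists (co q 0), (co q 6); rewrite [q in LHS]row7_co H1 H2 H3 H4 H5.
- by exists (co q 0), (co q 1); rewrite [q in LHS]row7_co H1 H2 H3 H4 H5.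
- exists (co q 0), (co q 2); rewrite [q in LHS]row7_co H1 H2 H3 H4.
  by move/eqP: H5; rewrite subr_eq0 => /eqP ->.
- exists (co q 4), (co q 5); rewrite [q in LHS]row7_co H1 H4 H5.
  move/eqP: H2; rewrite subr_eq0 => /eqP ->; congr row7; congr [:: _; _; _; _; _; _; _].
  by apply/eqP; rewrite -subr_eq0 -[X in _ == X]H3; apply/eqP; ring.
- exists (co q 5), (co q 6); rewrite [q in LHS]row7_co H3 H4 H5.
  move/eqP: H1; rewrite subr_eq0 => /eqP ->; congr row7; congr [:: _; _; _; _; _; _; _].
  by apply/eqP; rewrite -subr_eq0 -[X in _ == X]H2; apply/eqP; ring.
- exists (co q 4), (co q 6); rewrite [q in LHS]row7_co H2 H3 H4 H5.
  by move/eqP: H1; rewrite subr_eq0 => /eqP ->.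
- by exists (co q 5), (co q 6); rewrite [q in LHS]row7_co H1 H2 H3 H4 H5.
- exists (co q 3), (co q 6); rewrite [q in LHS]row7_co H1 H2 H3 H4.
  congr row7; congr [:: _; _; _; _; _; _; _].
  by apply/eqP; rewrite -subr_eq0 -[X in _ == X]H5; apply/eqP; ring.
- by exists (co q 1), (co q 4); rewrite [q in LHS]row7_co H1 H2 H3 H4 H5.
- by exists (co q 2), (co q 5); rewrite [q in LHS]row7_co H1 H2 H3 H4 H5.
Qed.

Lemma conic_ptP t q : curve_comp t c34 q -> exists y2 y3 y4,
  conic_eq t y2 y3 y4 /\ q = row7 (conic_pt y2 y3 y4).
Proof.
move=> /curve_compE[_ [H1 H2 H3 H4 H5]].
exists (co q 2), (co q 3), (co q 4); split=> //.
rewrite [q in LHS]row7_co H2 H3; congr row7; congr [:: _; _; _; _; _; _; _].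
  by apply/eqP; rewrite -subr_eq0 -[X in _ == X]H5; apply/eqP; ring.
by apply/eqP; rewrite -subr_eq0 -[X in _ == X]H4; apply/eqP; ring.
Qed.

Lemma curve_comp_line t v a b : v <> c34 -> row7 (line_pt v a b) != 0 ->
  curve_comp t v (row7 (line_pt v a b)).
Proof.
move=> vc q0; apply/curve_compE; split=> //.
by case: v vc {q0} => // _; rewrite !co_row7 //=; split; ring.
Qed.

Lemma curve_comp_conic t y2 y3 y4 : conic_eq t y2 y3 y4 ->
  row7 (conic_pt y2 y3 y4) != 0 -> curve_comp t c34 (row7 (conic_pt y2 y3 y4)).
Proof.
move=> yC q0; apply/curve_compE; split=> //.
by rewrite !co_row7 //=; split; [exact: yC|ring..].
Qed.

Lemma row7_line v a b : v <> c34 -> row7 (line_pt v a b) = 0 -> a = 0 /\ b = 0.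
Proof.
move=> vc p0; have E k : co (row7 (line_pt v a b)) k = 0 by rewrite p0 /co mxE.
have := (E 0%N, E 1%N, E 2%N, E 3%N, E 4%N, E 5%N, E 6%N).
by case: v vc {p0 E} => // _; rewrite !co_row7 //= => -[[[[[[? ?] ?] ?] ?] ?] ?].
Qed.

Lemma dquad_ext t (y y' v v' : nat -> K) : (forall k, (k < 7)%N -> y k = y' k) ->
  (forall k, (k < 7)%N -> v k = v' k) -> dquad t y v =1 dquad t y' v'.
Proof.
move=> yy' vv' [|[|[|[|[|[|[|[|[|[|//]]]]]]]]]];
  by rewrite /dquad !yy' // !vv'.
Qed.

Lemma quadrics_homog t k : (k < 10)%N -> (quadrics t)`_k \is 2.-homog.
Proof.
have yh i : y K i \is 1.-homog by rewrite dhomogX /= mdeg1.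
have yyh i j : y K i * y K j \is 2.-homog by apply: (dhomogM (yh i) (yh j)).
have ch (c : K) i j : c%:MP_[7] * y K i * y K j \is 2.-homog.
  by rewrite -mulrA mul_mpolyC; apply: dhomogZ.
have nch (c : K) i j : - c%:MP_[7] * y K i * y K j \is 2.-homog.
  by rewrite -mpolyCN.
have bch (c d : K) i j : (c%:MP_[7] - d%:MP_[7]) * y K i * y K j \is 2.-homog.
  by rewrite -mpolyCB.
have nbch (c d : K) i j : - (c%:MP_[7] - d%:MP_[7]) * y K i * y K j \is 2.-homog.
  by rewrite -mpolyCB.
do 10 (case: k => [_|k]; first
  by rewrite /=; repeat first [done | apply: dhomogD | rewrite dhomogN]).
by [].
Qed.

Hypothesis two0 : 2%:R != 0 :> K.

(** Euler's identity for quadrics; it lets the values of the quadrics be computed through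
    [dquad]. *)
Lemma quadrics_euler t q k : (k < 10)%N ->
  2%:R * ((quadrics t)`_k).@[q 0] = dquad t (co q) (co q) k.
Proof.
do 10 (case: k => [_|k]; first
  by rewrite /= ?(mevalD, mevalN, mevalM, mevalC) /y !mevalXU /dquad /co; ring).
by [].
Qed.

Lemma quadrics_curve t q k : (k < 10)%N -> curve t q -> ((quadrics t)`_k).@[q 0] = 0.
Proof.
move=> k10 [v _ qv]; apply: (mulfI two0); rewrite mulr0 quadrics_euler //.
have [vc|vc] : v = c34 \/ v <> c34 by case: v {qv}; [right..|left|right|right|right|right|right|right|right].
  have [y2 [y3 [y4 [yC ->]]]] : exists y2 y3 y4,
      conic_eq t y2 y3 y4 /\ q = row7 (conic_pt y2 y3 y4).
    by apply: conic_ptP; rewrite -vc.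
  rewrite (dquad_ext _ (@co_row7 _ _) (@co_row7 _ _)).
  (* On component 34 the first four quadrics restrict to the equation of the conic up to sign and
     the others to zero; the factor 2 comes from Euler's identity. *)
  have [c ->] : exists c, dquad t (nth 0 (conic_pt y2 y3 y4))
      (nth 0 (conic_pt y2 y3 y4)) k =
      c * (t.1 * y2 * y3 - t.2 * y2 * y4 + (- t.1 + t.2) * y3 * y4).
    case: k k10 => [|[|[|[|[|k]]]]] k10; [exists (- 2%:R)|exists (- 2%:R)|exists 2%:R|exists 2%:R|exists 0|exists 0];
      try by rewrite /=; ring.
    by move: k k10 => [|[|[|[|[|//]]]]] _; rewrite /=; ring.
  by rewrite yC mulr0.
have [a [b ->]] := line_ptP vc qv.
rewrite (dquad_ext _ (@co_row7 _ _) (@co_row7 _ _)).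
by case: v vc {qv} => // _; move: k k10 => [|[|[|[|[|[|[|[|[|[|//]]]]]]]]]] _;
  rewrite /=; ring.
Qed.

End CurveParametrization.

(** * From certificates to smooth points and half spinors *)

Section GenericSpinors.
Variable K : fieldType.
Hypothesis natK : injective (fun k : nat => k%:R : K).
Implicit Types (t : K * K) (s x : seq K) (p w : 'rV[K]_7).

Definition row16 x : 'rV[K]_16 := \row_i nth 0 x i.

Lemma co_row16 x k : (k < 16)%N -> co (row16 x) k = nth 0 x k.
Proof. by move=> k16; rewrite /co mxE inordK. Qed.

Let two0 : 2%:R != 0 :> K.
Proof. by apply/eqP => /(@natK 2%N 0%N). Qed.

Lemma Wperp_row t s w k : (k < 10)%N ->
  (w *m Wperp t (row7 s)) 0 (inord k) = dquad t (nth 0 s) (co w) k.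
Proof.
move=> k10; rewrite -[LHS]/(zc _ k) zc_Wperp //.
exact: (dquad_ext _ (@co_row7 _ _)).
Qed.

Lemma mul_Wperp0 t s w : w *m Wperp t (row7 s) = 0 <->
  forall k, (k < 10)%N -> dquad t (nth 0 s) (co w) k = 0.
Proof.
split=> [wW k k10|H]; first by rewrite -Wperp_row // wW mxE.
apply/rowP => j; rewrite -[j in LHS](inord_val (j : 'I_10)) Wperp_row // H //.
by rewrite mxE.
Qed.

Lemma mul_lsubWperp0 t s w : w *m lsubmx (Wperp t (row7 s)) = 0 <->
  forall k, (k < 5)%N -> dquad t (nth 0 s) (co w) k = 0.
Proof.
have E (j : 'I_5) : (w *m lsubmx (Wperp t (row7 s))) 0 j =
    dquad t (nth 0 s) (co w) j.
  rewrite -Wperp_row ?(leq_trans (ltn_ord j)) // !mxE; apply: eq_bigr => i _.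
  rewrite mxE; congr (_ * Wperp _ _ _ _); apply/val_inj.
  by rewrite /= inordK // (leq_trans (ltn_ord j)).
split=> [wW k k5|H]; last by apply/rowP => j; rewrite E H // mxE.
by have := E (Ordinal k5); rewrite wW mxE.
Qed.

Lemma Uinf_kermx : (Uinf K :=: kermx (col_mx 1%:M 0 : 'M_(5 + 5, 5)))%MS.
Proof.
apply/eqmxP/andP; split.
  by apply/sub_kermxP; rewrite /Uinf mul_row_col mul0mx mulmx0 addr0.
have sub (v : 'rV[K]_(5 + 5)) :
    v *m (col_mx 1%:M 0 : 'M_(5 + 5, 5)) = 0 -> (v <= Uinf K)%MS.
  rewrite -[v]hsubmxK mul_row_col mulmx1 mulmx0 addr0 => ->.
  apply/submxP; exists (rsubmx v).
  by rewrite /Uinf mul_mx_row mulmx0 mulmx1.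
by apply/row_subP => i; apply: sub; rewrite -row_mul mulmx_ker row0.
Qed.

(** U_infty is the kernel of the projection to the first five coordinates; apply rank-nullity to its
    restriction to W. *)
Lemma rank_capUinf m (W : 'M[K]_(m, 5 + 5)) :
  (\rank (lsubmx W) + \rank (W :&: Uinf K)%MS = \rank W)%N.
Proof.
have <- : W *m (col_mx 1%:M 0 : 'M_(5 + 5, 5)) = lsubmx W.
  by rewrite -[W in LHS]hsubmxK mul_row_col mulmx1 mulmx0 addr0.
by rewrite -(mxrank_mul_ker W (col_mx 1%:M 0)) (cap_eqmx (eqmx_refl W) Uinf_kermx).
Qed.

(* The conditions making row7 s a smooth point of C_t with spinor x. *)
Definition generic_at t s x : Prop := exists g S f g' L f',
  [/\ [/\ g != 0, size S = 2%N, all (fun k => k < 7)%N f & size f = 2%N],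
      [/\ g' != 0, (size L <= 7)%N, all (fun k => k < 7)%N f', size f' = size L &
        odd (7 - size L)],
      kernel_basis 10 t s g S f /\ kernel_basis 5 t s g' L f',
      isotropic_at t s /\ spinor_at t s x &
      forall i, (i < 2)%N -> curve_tangent t (row7 s) (row7 (nth [::] S i))].

(** The two vectors of S are derivatives of paths, so they lie in the Zariski tangent space.
    Conversely the quadrics vanish on C_t, so every tangent vector is killed by their differentials
    and lies in the span of S. *)
Lemma generic_half_spinor t s x : generic_at t s x -> curve t (row7 s) ->
  row7 s != 0 -> row16 x != 0 ->
  smooth_point t (row7 s) /\ half_spinor (Wperp t (row7 s)) (row16 x).
Proof.
move=> [g [S [f [g' [L [f' [[g0 S2 f7 fS] [g'0 L7 f'7 f'L oL] [kS kL] [iso spin] tan]]]]]]].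
move=> sC p0 x0; set p := row7 s; set W := Wperp t p.
have dq k (w : seq K) : (k < 10)%N ->
    dquad t (nth 0 s) (co (row7 w)) k = dquad t (nth 0 s) (nth 0 w) k.
  by move=> k10; apply: (dquad_ext _ (fun _ _ => erefl) (@co_row7 _ _)).
have [rW rT WT] : [/\ \rank W = (7 - size S)%N,
    \rank (\matrix_(i < size S) row7 (nth [::] S i)) = size S &
    forall w, (w <= \matrix_(i < size S) row7 (nth [::] S i))%MS <-> w *m W = 0].
  case: kS => Sid S0 Sw.
  apply: (@rank_kernel _ _ W g S f) => //; rewrite ?S2 //.
  - by move=> i i2; apply/mul_Wperp0 => k k10; rewrite dq // S0 ?S2.
  - by move=> w /mul_Wperp0 wW k k7; rewrite Sw ?S2.
have [rWl _ _] : [/\ \rank (lsubmx W) = (7 - size L)%N,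
    \rank (\matrix_(i < size L) row7 (nth [::] L i)) = size L &
    forall w, (w <= \matrix_(i < size L) row7 (nth [::] L i))%MS <->
      w *m lsubmx W = 0].
  case: kL => Lid L0 Lw.
  apply: (@rank_kernel _ _ (lsubmx W) g' L f') => //.
  - move=> i iL; apply/mul_lsubWperp0 => k k5.
    by rewrite dq ?(leq_trans k5) // L0.
  - by move=> w /mul_lsubWperp0 wW k k7; rewrite Lw.
split.
  split=> //; exists (<<\matrix_(i < size S) row7 (nth [::] S i)>>%MS).
    by rewrite genmxE rT S2.
  move=> w; rewrite genmxE; split=> [/submxP[D ->] d h hd h0|H].
    rewrite -/(dir h p _).
    have lin (a : K) (v v' : 'rV_7) : dir h p (a *: v + v') = a * dir h p v + dir h p v'.
      rewrite mulr_sumr -big_split; apply: eq_bigr => j _; rewrite !mxE /=.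
      by ring.
    have dir0 : dir h p 0 = 0 by apply: big1 => j _; rewrite mxE mulr0.
    rewrite mulmx_sum_row; apply: (big_ind (fun v => dir h p v = 0)) => //.
      by move=> v v' v0 v'0; rewrite -[v]scale1r lin v0 v'0 mulr0 addr0.
    move=> i _; rewrite -[_ *: _]addr0 lin dir0 addr0 rowK.
    rewrite (dir_curve natK p0 (tan _ _) h0) ?mulr0 //.
    by rewrite -S2.
  apply/WT/mul_Wperp0 => k k10.
  have := H _ _ (quadrics_homog t k10) (fun q => quadrics_curve two0 k10).
  rewrite -/(dir (quadrics t)`_k p w) dir_quadrics //.
  by rewrite (dquad_ext _ (@co_row7 _ _) (fun _ _ => erefl)).
apply: half_spinorP => //.
- split=> [|z /submxP[w ->]]; first by rewrite rW S2.
  rewrite -[RHS](iso (co w)); apply: eq_bigr => k _.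
  have k5 := ltn_ord k; rewrite -!Wperp_row; [|lia..].
  congr (_ * _); congr (fun_of_matrix _ _ _); apply/val_inj => /=.
    by rewrite inordK //; lia.
  by rewrite inordK; lia.
(* The rank of W is 5 and that of its projection is 7 - size L, which is odd; the difference is
   even. *)
- have := rank_capUinf W; rewrite rW rWl S2 => E.
  by rewrite -(oddb (odd _)); move: E oL; move: (\rank _) (7 - _)%N; lia.
- move=> w i; rewrite -[RHS](spin (co w) i).
  have E1 : dquad t (co p) (co w) =1 dquad t (nth 0 s) (co w).
    exact: (dquad_ext _ (@co_row7 _ _)).
  have E2 k : (k < 16)%N -> co (row16 x) k = nth 0 x k by apply: co_row16.
  by do 16 (case: i => [|i]; first by rewrite /spin_eq !E1 !E2).
Qed.

End GenericSpinors.

(** * The components of X_t, their nodes and their limits *)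

Section Lines.
Variable K : fieldType.
Hypothesis natK : injective (fun k : nat => k%:R : K).
Implicit Types (t : K * K) (v : label).

Definition line_spin v t (a b : K) : seq K :=
  match v with
  | c0 => ptseq t 0 0 (a * t.2) 0 0 0 (- b)
  | c1 => ptseq t 0 b a 0 0 0 0
  | c2 => ptseq t (- b) a a 0 0 0 0
  | c34 => [::]
  | c5 => ptseq t (- a * t.2 + b * t.2) 0 0 a 0 b 0
  | c6 => ptseq t 0 0 (- b * t.2) (a - b) (b * t.2) a (- b)
  | c7 => ptseq t 0 0 (- a * t.2) 0 (a * t.2) b (- b)
  | c8 => ptseq t 0 0 0 0 0 a (- b)
  | c9 => ptseq t 0 0 (b * t.2) (- a) (a * t.2) 0 b
  | c10 => ptseq t 0 a (- b) 0 b 0 0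
  | c11 => ptseq t (a * t.2) 0 0 0 0 (- b) 0
  end.

Definition lineA v t : 'rV[K]_16 :=
  match v with
  | c0 => pt t 0 0 1 0 0 0 0
  | c1 => pt t 0 1 0 0 0 0 0
  | c2 => pt t 1 0 0 0 0 0 0
  | c34 => 0
  | c5 => pt t (- t.2) 0 0 1 0 0 0
  | c6 => pt t 0 0 0 1 0 1 0
  | c7 => pt t 0 0 (- 1) 0 1 0 0
  | c8 => pt t 0 0 0 0 0 1 0
  | c9 => pt t 0 0 0 1 (- t.2) 0 0
  | c10 => pt t 0 1 0 0 0 0 0
  | c11 => pt t 1 0 0 0 0 0 0
  end.

Definition lineB v t : 'rV[K]_16 :=
  match v with
  | c0 => pt t 0 0 0 0 0 0 1
  | c1 => pt t 0 0 1 0 0 0 0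
  | c2 => pt t 0 1 1 0 0 0 0
  | c34 => 0
  | c5 => pt t (t.1 * t.2) 0 0 0 0 t.1 0
  | c6 => pt t 0 0 t.2 1 (- t.2) 0 1
  | c7 => pt t 0 0 0 0 0 (- 1) 1
  | c8 => pt t 0 0 0 0 0 0 1
  | c9 => pt t 0 0 (t.1 * t.2) 0 0 0 t.1
  | c10 => pt t 0 0 (- 1) 0 1 0 0
  | c11 => pt t 0 0 0 0 0 1 0
  end.

Definition line v t : set 'rV[K]_16 := plinear (col_mx (lineA v t) (lineB v t)).

Lemma row16_pt t z1 z2 z3 z4 z5 z6 z7 :
  row16 (ptseq t z1 z2 z3 z4 z5 z6 z7) = pt t z1 z2 z3 z4 z5 z6 z7.
Proof. by []. Qed.

Lemma row7_eq (s s' : seq K) : (forall k, (k < 7)%N -> nth 0 s k = nth 0 s' k) ->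
  row7 s = row7 s'.
Proof. by move=> ss'; apply/rowP => i; rewrite !mxE ss'. Qed.

Lemma tangent_line v t a b a' b' : v <> c34 ->
  curve_tangent t (row7 (line_pt v a b)) (row7 (line_pt v a' b')).
Proof.
move=> vc; exists (fun u => row7 (line_pt v (a + u * a') (b + u * b'))), (fun=> 0).
have cE u : row7 (line_pt v (a + u * a') (b + u * b')) =
    row7 (line_pt v a b) + u *: row7 (line_pt v a' b').
  apply/rowP => i; rewrite !mxE.
  by case: v vc => // _; case: i => [[|[|[|[|[|[|[|//]]]]]]] ?] /=; ring.
split=> [|||u u0].
- move=> i; apply: ispoly_ext (_ : ispoly (fun u => (row7 (line_pt v a b) +
    u *: row7 (line_pt v a' b')) 0 i)) => [u|]; first by rewrite cE.
  apply: ispathD; first exact: ispathC.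
  by apply: ispathZ; [exact: ispolyX | exact: ispathC].
- exact: ispathC.
- by move=> u; rewrite scaler0 addr0.
- by exists v => //; exact: curve_comp_line.
Qed.

Ltac use_generic H v a b :=
  let k10 := fresh in let k5 := fresh in let iso := fresh in let spin := fresh in
  have [k10 k5 iso spin] := H;
  match type of k10 with kernel_basis _ _ _ _ ?S ?f =>
  match type of k5 with kernel_basis _ _ _ _ ?L ?f' =>
    exists 1, S, f, 1, L, f'; split; [split=> //; exact: oner_neq0
      |split=> //; exact: oner_neq0|split; [exact: k10|exact: k5]|split; [exact: iso|exact: spin]
      |case=> [|[|//]] _;
        [rewrite [X in curve_tangent _ _ X](@row7_eq _ (line_pt v 1 0)); [exact: tangent_line|apply: forall7; rewrite /=; ring]
        |rewrite [X in curve_tangent _ _ X](@row7_eq _ (line_pt v 0 1)); [exact: tangent_line|apply: forall7; rewrite /=; ring]]]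
  end end.

Lemma generic_line v (t1 d a b : K) : v <> c34 ->
  t1 != 0 -> d != 0 -> a != 0 -> b != 0 -> a - b != 0 -> a + b != 0 ->
  generic_at (t1 + d, t1) (line_pt v a b) (line_spin v (t1 + d, t1) a b).
Proof.
move=> vc t10 d0 a0 b0 ab ab'; case: v vc => // _.
- use_generic (generic_c0 t10 d0 a0 b0 ab ab') c0 a b.
- use_generic (generic_c1 t10 d0 a0 b0 ab ab') c1 a b.
- use_generic (generic_c2 t10 d0 a0 b0 ab ab') c2 a b.
- use_generic (generic_c5 t10 d0 a0 b0 ab ab') c5 a b.
- use_generic (generic_c6 t10 d0 a0 b0 ab ab') c6 a b.
- use_generic (generic_c7 t10 d0 a0 b0 ab ab') c7 a b.
- use_generic (generic_c8 t10 d0 a0 b0 ab ab') c8 a b.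
- use_generic (generic_c9 t10 d0 a0 b0 ab ab') c9 a b.
- use_generic (generic_c10 t10 d0 a0 b0 ab ab') c10 a b.
- use_generic (generic_c11 t10 d0 a0 b0 ab ab') c11 a b.
Qed.

Lemma generic_split t : generic_t t -> exists t1 d : K,
  [/\ t = (t1 + d, t1), t1 != 0, d != 0 & t1 + d != 0].
Proof.
case: t => t0 t1 /and3P[/= t00 t10 t01]; exists t1, (t0 - t1).
by rewrite subr_eq0 addrC subrK.
Qed.

Lemma ispath_line_spin v t (p q : K -> K) : ispoly p -> ispoly q ->
  ispath (fun u => row16 (line_spin v t (p u) (q u))).
Proof.
move=> pp pq i.
apply: (ispoly_ext (g := fun u => nth 0 (line_spin v t (p u) (q u)) i)) => [u|].
  by rewrite mxE.
by case: v; case: i => [[|[|[|[|[|[|[|[|[|[|[|[|[|[|[|[|//]]]]]]]]]]]]]]]] ?] /=;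
  prove_ispoly.
Qed.

Lemma line_lineP v t x : v <> c34 -> t.2 != 0 -> line v t x ->
  exists a b, x = row16 (line_spin v t a b).
Proof.
move=> vc t20 /plinear2P[_ [s [r ->]]].
case: v vc => // _; rewrite /lineA /lineB pt_comb;
 [exists (s / t.2), (- r)|exists r, s|exists r, (- s)|exists s, (r * t.1)|
  exists s, (- r)|exists (s / t.2), (- r)|exists s, (- r)|exists (- s), (r * t.1)|
  exists s, r|exists (s / t.2), (- r)];
 rewrite row16_pt; congr pt; by field.
Qed.

Lemma half_spinor_unit7 t s x : half_spinor (Wperp t (row7 s)) x ->
  forall i j, spin_eq (dquad t (nth 0 s) (nth 0 (unit7 i))) (co x) j = 0.
Proof.
move=> hx i j; rewrite -[RHS](half_spinor_eqs hx (row7 (unit7 i)) j).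
have E := dquad_ext t (@co_row7 _ s) (@co_row7 _ (unit7 i)).
by do 16 (case: j => [|j]; first by rewrite /spin_eq !E).
Qed.

Lemma plinear2_coords (g c d : K) x s s' : x != 0 -> g != 0 ->
  (forall k, (k < 16)%N -> g * co x k = c * nth 0 s k + d * nth 0 s' k) ->
  plinear (col_mx (row16 s) (row16 s')) x.
Proof.
move=> x0 g0 H; apply/plinear2P; split=> //; exists (c / g), (d / g).
apply: co_inj => k k16; apply: (mulfI g0); rewrite H //.
by rewrite /co !mxE inordK //; field.
Qed.

Lemma spinor_in_line v t p x : v <> c34 -> generic_t t -> curve_comp t v p ->
  half_spinor (Wperp t p) x -> line v t x.
Proof.
move=> vc /generic_split[t1 [d [-> t10 d0 t00]]] pv hx.
have x0 : x != 0 by case: hx.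
have p0 : p != 0 by case: pv.
have [a [b pE]] := line_ptP vc pv; move: hx p0; rewrite {}pE => hx p0.
have ab : (a != 0) || (b != 0).
  apply: contraNT p0; rewrite negb_or !negbK => /andP[/eqP-> /eqP->].
  apply/eqP/rowP => i; rewrite !mxE.
  by case: v {pv hx} vc => // _; case: i => [[|[|[|[|[|[|[|//]]]]]]] ?] /=; ring.
have H := half_spinor_unit7 hx; have o0 := oner_neq0 K.
case: v vc pv hx p0 H => // _ _ _ _ H.
- exact: plinear2_coords x0 o0 (line_of_spin_c0 t10 d0 ab H).
- exact: plinear2_coords x0 o0 (line_of_spin_c1 t10 d0 ab H).
- exact: plinear2_coords x0 o0 (line_of_spin_c2 t10 d0 ab H).
- have := plinear2_coords x0 t00 (line_of_spin_c5 t10 d0 ab H).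
  by rewrite !row16_pt (_ : t1 ^+ 2 + t1 * d = (t1 + d) * t1); last by ring.
- exact: plinear2_coords x0 o0 (line_of_spin_c6 t10 d0 ab H).
- exact: plinear2_coords x0 o0 (line_of_spin_c7 t10 d0 ab H).
- exact: plinear2_coords x0 o0 (line_of_spin_c8 t10 d0 ab H).
- have := plinear2_coords x0 t00 (line_of_spin_c9 t10 d0 ab H).
  by rewrite !row16_pt (_ : t1 ^+ 2 + t1 * d = (t1 + d) * t1); last by ring.
- exact: plinear2_coords x0 o0 (line_of_spin_c10 t10 d0 ab H).
- exact: plinear2_coords x0 o0 (line_of_spin_c11 t10 d0 ab H).
Qed.

Lemma X_line v t : v <> c34 -> generic_t t -> X v t = line v t.
Proof.
move=> vc gt; apply/seteqP; split=> x.
  have cl : zclosed (line v t) by apply: zclosed_plinear.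
  move=> [x0 clx]; rewrite cl; split=> // d f fd f0; apply: clx fd _ => z.
  by move=> [p [pv _ hz]]; apply: f0; apply: spinor_in_line gt pv hz.
have [t1 [d [tE t10 d0 t00]]] := generic_split gt; rewrite {t gt}tE => xl.
have x0 : x != 0 by case: xl.
have [a [b xE]] := line_lineP (t := (t1 + d, t1)) vc t10 xl.
(* The path runs to (a, b) = (1, 2), where a, b, a - b and a + b are all nonzero; hence all but
   finitely many of its points come from general points of the curve. *)
pose p u := a + u * (1 - a); pose q u := b + u * (2%:R - b).
have pp : ispoly p by rewrite /p; prove_ispoly.
have pq : ispoly q by rewrite /q; prove_ispoly.
pose w u := row16 (line_spin v (t1 + d, t1) (p u) (q u)).
have pw : ispath w by apply: ispath_line_spin.
pose g u := p u * (q u * ((p u - q u) * (p u + q u))).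
have pg : ispoly g by rewrite /g; prove_ispoly.
have w0 : w 0 = x by rewrite /w /p /q !mul0r !addr0.
have /rV0Pn[i xi] := x0.
have two k l : k != l -> (k%:R : K) != l%:R by apply: contraNneq => /natK ->.
have g1 : g 1 != 0.
  have [p1 q1] : p 1 = 1%:R /\ q 1 = 2%:R by rewrite /p /q; split; ring.
  rewrite /g p1 q1 -natrD !mulf_neq0 ?subr_eq0 //; first exact: (two 1 0)%N.
  - exact: (two 2 0)%N.
  - exact: (two 1 2)%N.
  - exact: (two 3 0)%N.
have wi0 : w 0 0 i != 0 by rewrite w0.
have [u1 gw] := ispoly_nz2 natK pg (pw i) g1 wi0.
apply: (zclosure_path natK pw (ispolyM pg (pw i)) gw x0 w0) => u.
rewrite !mulf_eq0 !negb_or => /andP[/and4P[pu qu pqu pqu'] wiu].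
have wu0 : w u != 0 by apply: contraNneq wiu => ->; rewrite mxE.
have p0 : row7 (line_pt v (p u) (q u)) != 0.
  by apply: contraNneq pu => /(row7_line vc) [-> _].
have gen := generic_line vc t10 d0 pu qu pqu pqu'.
have cp := curve_comp_line (t1 + d, t1) vc p0.
have [|sm hs] := generic_half_spinor natK gen _ p0 wu0; first by exists v.
by exists (row7 (line_pt v (p u) (q u))).
Qed.

End Lines.

(** * Component 34 for generic t *)

Section Conic.
Variable K : fieldType.
Hypothesis natK : injective (fun k : nat => k%:R : K).
Implicit Types (t : K * K).

Definition conic_row t y2 y3 y4 : 'rV[K]_16 := row16 (conic_spin t y2 y3 y4).

Definition conic t : set 'rV[K]_16 := [set x | x != 0 /\ exists y2 y3 y4,
  conic_eq t y2 y3 y4 /\ x = conic_row t y2 y3 y4].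

Lemma conic_rowZ t (c : K) y2 y3 y4 :
  c *: conic_row t y2 y3 y4 = conic_row t (c * y2) (c * y3) (c * y4).
Proof. by rewrite /conic_row !row16_pt pt_scale; congr pt; ring. Qed.

Ltac prove_form := repeat first
  [ assumption | exact: form0 | apply: formZ | apply: formD | apply: formN ].

Lemma zclosed_conic t : t.1 != 0 -> t.2 != 0 -> zclosed (conic t).
Proof.
move=> t00 t10.
(* The parameters y_2, y_3, y_4 recovered as linear forms in x_12, x_35 and x_24; closedness follows
   by writing all conditions in them. *)
pose f2 (x : 'rV[K]_16) := - (t.2^-1 * co x 1); pose f3 (x : 'rV[K]_16) := t.1^-1 * co x 9.
pose f4 (x : 'rV[K]_16) := - (t.2^-1 * (co x 1 + co x 6)).
have cf k : form 1 (fun x : 'rV[K]_16 => co x k) by apply: form_coord.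
have [h2 h3 h4] : [/\ form 1 f2, form 1 f3 & form 1 f4] by split; prove_form.
pose F (i : 'I_16) (x : 'rV[K]_16) := x 0 i - nth 0 (conic_spin t (f2 x) (f3 x) (f4 x)) i.
have Fi i : form 1 (F i).
  apply: formB; first exact: form_coord.
  by case: i => [[|[|[|[|[|[|[|[|[|[|[|[|[|[|[|[|//]]]]]]]]]]]]]]]] ?] /=; prove_form.
pose q x := t.1 * (f2 x * f3 x) - t.2 * (f2 x * f4 x) + (- t.1 + t.2) * (f3 x * f4 x).
have qq : form 2 q.
  have fM := @formM _ _ 1 1.
  by apply: formD; first apply: formB; apply: formZ; apply: fM.
have f2E y2 y3 y4 : f2 (conic_row t y2 y3 y4) = y2.
  by rewrite /f2 !co_row16 //=; field.
have f3E y2 y3 y4 : f3 (conic_row t y2 y3 y4) = y3.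
  by rewrite /f3 !co_row16 //=; field.
have f4E y2 y3 y4 : f4 (conic_row t y2 y3 y4) = y4.
  by rewrite /f4 !co_row16 //=; field.
rewrite [X in zclosed X](_ : _ = [set x | x != 0 /\ forall i, F i x = 0] `&`
    [set x | x != 0 /\ q x = 0]).
  apply: zclosedI; last exact: zclosed_form qq.
  exact: (@zclosed_forms _ _ _ (fun=> 1%N) F).
apply/seteqP; split=> x.
  move=> [x0 [y2 [y3 [y4 [yC xE]]]]]; split; split=> //.
    by move=> i; rewrite /F xE f2E f3E f4E mxE subrr.
  by rewrite /q xE f2E f3E f4E !mulrA.
move=> [[x0 Fx] [_ qx]]; split=> //; exists (f2 x), (f3 x), (f4 x); split.
  by move: qx; rewrite /q /conic_eq !mulrA.
by apply/rowP => i; rewrite mxE; apply/eqP; rewrite -subr_eq0; apply/eqP/Fx.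
Qed.

Lemma conic_coords t (g c : K) x y2 y3 y4 : x != 0 -> g != 0 ->
  conic_eq t y2 y3 y4 ->
  (forall k, (k < 16)%N -> g * co x k = c * nth 0 (conic_spin t y2 y3 y4) k) ->
  conic t x.
Proof.
move=> x0 g0 yC H; split=> //.
exists (c / g * y2), (c / g * y3), (c / g * y4); split.
  rewrite /conic_eq; transitivity ((c / g) ^+ 2 *
    (t.1 * y2 * y3 - t.2 * y2 * y4 + (- t.1 + t.2) * y3 * y4)); first by ring.
  by rewrite yC mulr0.
rewrite -conic_rowZ; apply: co_inj => k k16; apply: (mulfI g0); rewrite H //.
by rewrite /co !mxE inordK //; field.
Qed.

Lemma spinor_in_conic t p x : generic_t t -> curve_comp t c34 p ->
  half_spinor (Wperp t p) x -> conic t x.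
Proof.
move=> /generic_split[t1 [d [-> t10 d0 t00]]] pC hx; have x0 : x != 0 by case: hx.
have p0 : p != 0 by case: pC.
have [y2 [y3 [y4 [yC pE]]]] := conic_ptP pC.
rewrite {}pE in hx p0; have H := half_spinor_unit7 hx.
have nz : (y2 != 0) || (y3 != 0) || (y4 != 0).
  apply: contraNT p0; rewrite !negb_or !negbK => /andP[/andP[/eqP-> /eqP->] /eqP->].
  by apply/eqP/rowP => i; rewrite !mxE; case: i => [[|[|[|[|[|[|[|//]]]]]]] ?] /=; ring.
have yC' := yC; rewrite /conic_eq /= in yC'.
have [y20|y20] := eqVneq y2 0.
  have /eqP : d * (y3 * y4) = 0.
    by rewrite -[RHS]oppr0 -[in RHS]yC' y20; ring.
  rewrite mulf_eq0 (negbTE d0) mulf_eq0 /= => /orP[/eqP y30|/eqP y40].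
    subst y2 y3; rewrite eqxx /= in nz.
    apply: conic_coords x0 _ yC (conic_of_spin_node4 t10 d0 nz H).
    by rewrite mulf_neq0 ?oppr_eq0.
  subst y2 y4; rewrite eqxx /= orbF in nz.
  apply: conic_coords x0 _ yC (conic_of_spin_node3 t10 d0 nz H).
  by rewrite -mulrDr mulf_neq0.
have [y30|y30] := eqVneq y3 0.
  have /eqP : t1 * (y2 * y4) = 0.
    by rewrite -[RHS]oppr0 -[in RHS]yC' y30; ring.
  rewrite mulf_eq0 (negbTE t10) mulf_eq0 (negbTE y20) /= => /eqP y40.
  subst y3 y4; apply: conic_coords x0 _ yC (conic_of_spin_node2 t10 d0 y20 H).
  by rewrite mulf_neq0.
have [y40|y40] := eqVneq y4 0.
  have /eqP : (t1 + d) * (y2 * y3) = 0 by rewrite -[RHS]yC' y40; ring.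
  by rewrite !mulf_eq0 (negbTE t00) (negbTE y20) (negbTE y30).
have E : y2 * ((t1 + d) * y3 - t1 * y4) = d * y3 * y4.
  by apply/eqP; rewrite -subr_eq0 -[X in _ == X]yC'; apply/eqP; ring.
have e0 : (t1 + d) * y3 - t1 * y4 != 0.
  apply: contraNneq (mulf_neq0 (mulf_neq0 d0 y30) y40) => E0.
  by rewrite -E E0 mulr0.
(* Inverts y = l ((t_0 - t_1) b, t_1 e, b e) with b + e = t_0. *)
pose b := t1 * y4 / y3; pose e := t1 + d - b; pose l := y3 / (t1 * e).
have b0 : b != 0 by rewrite !mulf_neq0 ?invr_eq0.
have bE : b * y3 = t1 * y4 by rewrite divfK.
have eE : y3 * e = (t1 + d) * y3 - t1 * y4 by rewrite -bE /e; ring.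
have e'0 : e != 0 by apply: contraNneq e0 => e_0; rewrite -eE e_0 mulr0.
have l0 : l != 0 by rewrite mulf_neq0 ?invr_eq0 ?mulf_neq0.
have lE : l * (t1 * e) = y3 by rewrite divfK ?mulf_neq0.
have be : b + e = t1 + d by rewrite addrC subrK.
have bet : b + e - t1 = d by rewrite be; ring.
have [E2 E3 E4] : [/\ l * (b + e - t1) * b = y2, l * t1 * e = y3 & l * b * e = y4].
  rewrite bet; split; last 2 first.
  - by rewrite -mulrA.
  - by apply: (mulfI t10); rewrite -bE -lE; ring.
  apply: (mulIf e0); rewrite E -eE; apply: (mulfI t10).
  transitivity (l * (t1 * e) * (b * y3) * d); first by ring.
  by rewrite lE bE; ring.
have H' : forall i j, spin_eq (dquad (b + e, t1) (nth 0 (conic_pt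
    (l * (b + e - t1) * b) (l * t1 * e) (l * b * e))) (nth 0 (unit7 i))) (co x) j = 0.
  by rewrite E2 E3 E4 be.
have be0 : b + e != 0 by rewrite be.
have bet0 : b + e - t1 != 0 by rewrite bet.
have := conic_of_spin_generic t10 l0 b0 e'0 be0 bet0 H'; rewrite E2 E3 E4 be => HX.
by apply: conic_coords x0 _ yC HX; rewrite mulf_neq0.
Qed.

(** Homogeneous form of the parametrization of [conic_of_spin_generic]: its b is b / a and its e is
    t_0 - b / a, after multiplication by a^2. The vertices are now included. *)
Definition conic_y2 t (a b : K) := (t.1 - t.2) * (a * b).
Definition conic_y3 t (a b : K) := t.2 * (a * (t.1 * a - b)).
Definition conic_y4 t (a b : K) := b * (t.1 * a - b).

Lemma conic_eq_param t a b :
  conic_eq t (conic_y2 t a b) (conic_y3 t a b) (conic_y4 t a b).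
Proof. by rewrite /conic_eq /conic_y2 /conic_y3 /conic_y4; ring. Qed.

(** The parameter is [a : b] = [y_3 : t_1 y_4]. If t_0 y_3 = t_1 y_4, the equation of the conic
    forces y_3 = y_4 = 0, and this vertex has the parameter [1 : t_0]. *)
Lemma conic_paramP t y2 y3 y4 : generic_t t -> conic_eq t y2 y3 y4 ->
  exists c a b, [/\ y2 = c * conic_y2 t a b, y3 = c * conic_y3 t a b &
    y4 = c * conic_y4 t a b].
Proof.
move=> /generic_split[t1 [d [-> t10 d0 t00]]] yC.
rewrite /conic_y2 /conic_y3 /conic_y4 /=; rewrite /conic_eq /= in yC.
have [e0|e0] := eqVneq ((t1 + d) * y3 - t1 * y4) 0.
  have /eqP : d * (y3 * y4) = 0.
    transitivity (y2 * ((t1 + d) * y3 - t1 * y4)); last by rewrite e0 mulr0.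
    by rewrite -[RHS]subr0 -[X in _ = _ - X]yC; ring.
  rewrite mulf_eq0 (negbTE d0) mulf_eq0 /= => y34.
  have [y30 y40] : y3 = 0 /\ y4 = 0.
    case/orP: y34 => /eqP yi0; move/eqP: e0; rewrite yi0 mulr0 ?sub0r ?subr0 ?oppr_eq0 mulf_eq0;
      by rewrite ?(negbTE t10) ?(negbTE t00) => /eqP.
  exists (y2 / (d * (t1 + d))), 1, (t1 + d); rewrite y30 y40.
  by split; field; rewrite ?d0 ?t00.
exists (t1 * ((t1 + d) * y3 - t1 * y4))^-1, y3, (t1 * y4); split.
- apply: (mulIf (mulf_neq0 t10 e0)); rewrite mulrAC mulVf ?mul1r ?mulf_neq0 //.
  by rewrite -[RHS]addr0 -[X in _ = _ + X](mulr0 t1) -[X in _ = _ + t1 * X]yC; ring.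
- by field; rewrite t10 e0.
- by field; rewrite t10 e0.
Qed.

Lemma spinor_at_conicZ t s (c : K) y2 y3 y4 : spinor_at t s (conic_spin t y2 y3 y4) ->
  spinor_at t s (conic_spin t (c * y2) (c * y3) (c * y4)).
Proof.
move=> H w i; rewrite -[RHS](mulr0 c) -[in RHS](H w i).
by do 16 (case: i => [|i]; first by rewrite /spin_eq /conic_spin /ptseq /=; ring);
  rewrite /= mulr0.
Qed.

(** The path scales the representative by 1 + al u and moves b to b + be u and e to e - be u,
    keeping t_0 = b + e. The two independent motions give the two tangent directions of the cone. *)
Lemma tangent_conic (t1 b e al be : K) :
  curve_tangent (b + e, t1) (row7 (conic_pt ((b + e - t1) * b) (t1 * e) (b * e)))
    (row7 (conic_pt ((b + e - t1) * (al * b + be)) (t1 * (al * e - be))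
       (al * b * e + be * (e - b)))).
Proof.
pose z u := row7 (conic_pt ((b + e - t1) * al * be) (- (t1 * al * be))
  (- be ^+ 2 + al * be * (e - b) - al * be ^+ 2 * u)).
pose w u := row7 (conic_pt ((1 + al * u) * ((b + e - t1) * (b + be * u)))
  ((1 + al * u) * (t1 * (e - be * u))) ((1 + al * u) * ((b + be * u) * (e - be * u)))).
have pz : ispath z.
  move=> i; apply: (ispoly_ext (g := fun u => nth 0 (conic_pt ((b + e - t1) * al * be)
    (- (t1 * al * be)) (- be ^+ 2 + al * be * (e - b) - al * be ^+ 2 * u)) i)) => [u|].
    by rewrite mxE.
  by case: i => [[|[|[|[|[|[|[|//]]]]]]] ?] /=; prove_ispoly.
have pw : ispath w.
  move=> i; apply: (ispoly_ext (g := fun u => nth 0 (conic_pt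
    ((1 + al * u) * ((b + e - t1) * (b + be * u))) ((1 + al * u) * (t1 * (e - be * u)))
    ((1 + al * u) * ((b + be * u) * (e - be * u)))) i)) => [u|].
    by rewrite mxE.
  by case: i => [[|[|[|[|[|[|[|//]]]]]]] ?] /=; prove_ispoly.
exists w, z; split=> // u.
  apply/rowP => i; rewrite !mxE.
  by case: i => [[|[|[|[|[|[|[|//]]]]]]] ?] /=; ring.
move=> wu0; exists c34 => //; apply: curve_comp_conic wu0.
by rewrite /conic_eq /=; ring.
Qed.

Lemma generic_conic (t1 b e c : K) : t1 != 0 -> b != 0 -> e != 0 -> b + e != 0 ->
  b + e - t1 != 0 -> b - t1 != 0 ->
  let y2 := (b + e - t1) * b in let y3 := t1 * e in let y4 := b * e in
  generic_at (b + e, t1) (conic_pt y2 y3 y4)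
    (conic_spin (b + e, t1) (c * y2) (c * y3) (c * y4)).
Proof.
move=> t10 b0 e0 be0 bet0 bt0 /=.
have [k10 k5 iso spin] := generic_c34 t10 b0 e0 be0 bet0 bt0.
have g0 : t1 * e ^+ 2 != 0 by rewrite mulf_neq0 ?expf_neq0.
match type of k10 with kernel_basis _ _ _ _ ?S ?f =>
  exists (t1 * e ^+ 2), S, f, (t1 * e ^+ 2), S, f end.
split=> //; first by split=> //; exact: spinor_at_conicZ.
case=> [|[|//]] _ /=.
(* The pair (al, be) solves for the tangent vector with y_4 = 0 and y_3 = t_1 e^2; in the second
   case, for y_3 = 0 and y_4 = t_1 e^2. *)
- have := tangent_conic t1 b e (e - b) (- (b * e)).
  rewrite [X in curve_tangent _ _ X](_ : _ = row7 [:: - (b + e - t1) * b ^+ 2 - t1 * e ^+ 2;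
     - (b + e - t1) * b ^+ 2; - (b + e - t1) * b ^+ 2; t1 * e ^+ 2; 0; 0; 0]) //.
  by apply: row7_eq; apply: forall7; rewrite /=; ring.
- have := tangent_conic t1 b e t1 (t1 * e).
  rewrite [X in curve_tangent _ _ X](_ : _ = row7 [:: t1 * (b + e - t1) * (b + e);
    t1 * (b + e - t1) * (b + e) - t1 * e ^+ 2; t1 * (b + e - t1) * (b + e);
    0; t1 * e ^+ 2; 0; 0]) //.
  by apply: row7_eq; apply: forall7; rewrite /=; ring.
Qed.

Lemma X_conic t : generic_t t -> X c34 t = conic t.
Proof.
move=> gt; have [/= t00 t10 t01] := and3P gt; apply/seteqP; split=> x.
  have cl := zclosed_conic t00 t10.
  move=> [x0 clx]; rewrite cl; split=> // d f fd f0; apply: clx fd _ => z.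
  by move=> [p [pv _ hz]]; apply: f0; apply: spinor_in_conic gt pv hz.
move=> [x0 [y2 [y3 [y4 [yC xE]]]]].
have [c [a [b [y2E y3E y4E]]]] := conic_paramP gt yC.
(* The path of parameters ends at [1 : u0]. The excluded values b / a = 0, t_0, t_1, together with a
   = 0, are the four nodes on component 34. *)
have [u0 /and3P[u01 u02 u03]] : exists u, [&& u != 0, u != t.1 & u != t.2].
  have pX (k : K) : ispoly (fun u => u - k) by prove_ispoly.
  have nz (k : K) : k + 1 - k != 0 by rewrite addrAC subrr add0r oner_neq0.
  have [u12 h12] := ispoly_nz2 natK (pX 0) (pX t.1) (nz _) (nz _).
  have [u h] := ispoly_nz2 natK (ispolyM (pX 0) (pX t.1)) (pX t.2) h12 (nz _).
  exists u; move: h; rewrite !mulf_eq0 !negb_or !subr_eq0 => /andP[/andP[-> ->] ->].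
  by [].
pose p u := a + u * (1 - a); pose q u := b + u * (u0 - b).
have pp : ispoly p by rewrite /p; prove_ispoly.
have pq : ispoly q by rewrite /q; prove_ispoly.
pose w u := conic_row t (c * conic_y2 t (p u) (q u)) (c * conic_y3 t (p u) (q u))
  (c * conic_y4 t (p u) (q u)).
have pw : ispath w.
  move=> i; apply: (ispoly_ext (g := fun u => nth 0 (conic_spin t
    (c * conic_y2 t (p u) (q u)) (c * conic_y3 t (p u) (q u))
    (c * conic_y4 t (p u) (q u))) i)) => [u|]; first by rewrite mxE.
  rewrite /conic_spin /conic_y2 /conic_y3 /conic_y4.
  by case: i => [[|[|[|[|[|[|[|[|[|[|[|[|[|[|[|[|//]]]]]]]]]]]]]]]] ?] /=; prove_ispoly.
pose g u := p u * (q u * ((t.1 * p u - q u) * (q u - t.2 * p u))).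
have pg : ispoly g by rewrite /g; prove_ispoly.
have w0 : w 0 = x by rewrite /w /p /q !mul0r !addr0 -y2E -y3E -y4E.
have /rV0Pn[i xi] := x0.
have g1 : g 1 != 0.
  have [p1 q1] : p 1 = 1 /\ q 1 = u0 by rewrite /p /q; split; ring.
  by rewrite /g p1 q1 !mulr1 mul1r !mulf_neq0 // subr_eq0 // eq_sym.
have wi0 : w 0 0 i != 0 by rewrite w0.
have [u1 gw] := ispoly_nz2 natK pg (pw i) g1 wi0.
apply: (zclosure_path natK pw (ispolyM pg (pw i)) gw x0 w0) => u.
rewrite !mulf_eq0 !negb_or => /andP[/and4P[pu qu eu btu] wiu].
have wu0 : w u != 0 by apply: contraNneq wiu => ->; rewrite mxE.
pose b' := q u / p u; pose e' := t.1 - b'.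
have b'0 : b' != 0 by rewrite mulf_neq0 ?invr_eq0.
have e'E : t.1 * p u - q u = e' * p u by rewrite /e' mulrBl divfK.
have e'0 : e' != 0 by apply: contraNneq eu => e0; rewrite e'E e0 mul0r.
have be : b' + e' = t.1 by rewrite addrC subrK.
have bt0 : b' - t.2 != 0.
  by apply: contraNneq btu => /eqP; rewrite subr_eq0 => /eqP <-; rewrite divfK // subrr.
have be0 : b' + e' != 0 by rewrite be.
have bet0 : b' + e' - t.2 != 0 by rewrite be subr_eq0.
have gen := generic_conic (c * p u ^+ 2) t10 b'0 e'0 be0 bet0 bt0.
cbv zeta in gen; rewrite be -surjective_pairing in gen.
have qE : q u = b' * p u by rewrite divfK.
have wE : row16 (conic_spin t (c * p u ^+ 2 * ((t.1 - t.2) * b'))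
    (c * p u ^+ 2 * (t.2 * e')) (c * p u ^+ 2 * (b' * e'))) = w u.
  rewrite /w /conic_row /conic_y2 /conic_y3 /conic_y4 e'E qE; congr row16.
  by congr conic_spin; ring.
set s := conic_pt _ _ _ in gen.
have s0 : row7 s != 0.
  apply: contraNneq (mulf_neq0 b'0 e'0) => s0.
  by have := co_row7 s (isT : (4 < 7)%N); rewrite s0 /co mxE /= => <-.
have sC : conic_eq t ((t.1 - t.2) * b') (t.2 * e') (b' * e').
  by rewrite /conic_eq -be; ring.
have cp := curve_comp_conic sC s0.
have [||sm hs] := generic_half_spinor natK gen _ s0; first by exists c34.
  by rewrite wE.
by exists (row7 s); rewrite -wE.
Qed.

End Conic.

(** * Nodes of X_t for generic t *)

Section Nodes.
Variable K : fieldType.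
Hypothesis natK : injective (fun k : nat => k%:R : K).
Implicit Types (t : K * K).

Lemma tvec_pt (f1 f2 f3 f4 f5 f6 f7 : K * K -> K) :
  tcoef f1 -> tcoef f2 -> tcoef f3 -> tcoef f4 -> tcoef f5 -> tcoef f6 -> tcoef f7 ->
  tvec (fun t => pt t (f1 t) (f2 t) (f3 t) (f4 t) (f5 t) (f6 t) (f7 t)).
Proof.
move=> h1 h2 h3 h4 h5 h6 h7 i.
have ext (c c' : K * K -> K) : c =1 c' -> tcoef c' -> tcoef c.
  by move=> cc' [q qE]; exists q => t; rewrite cc'.
apply: (ext _ (fun t => nth 0 (ptseq t (f1 t) (f2 t) (f3 t) (f4 t) (f5 t) (f6 t) (f7 t)) i)) => [t|].
  by rewrite mxE.
have cf := @tcoef_fst K; have cs := @tcoef_snd K.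
by case: i => [[|[|[|[|[|[|[|[|[|[|[|[|[|[|[|[|//]]]]]]]]]]]]]]]] ?] /=;
  repeat first [assumption | exact: tcoefC | apply: tcoefD | apply: tcoefN | apply: tcoefM].
Qed.

Lemma pt_neq0 t (z : seq K) z1 z2 z3 z4 z5 z6 z7 : t.1 != 0 ->
  z = [:: z1; z2; z3; z4; z5; z6; z7] -> has (fun c => c != 0) z ->
  pt t z1 z2 z3 z4 z5 z6 z7 != 0.
Proof.
move=> t0 -> zn; rewrite pt_eq0 //; apply: contraTN zn => /allP z0.
by apply/hasPn => c /z0 /= /eqP ->; rewrite eqxx.
Qed.

Ltac node_simpl := rewrite ?(mulr0, mulr1, mul0r, addr0, add0r, mulrN1, mulrN).

Lemma node_lines u v t n : u <> c34 -> v <> c34 -> generic_t t ->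
  (forall c, exists s r s' r', c *: n = s *: lineA u t + r *: lineB u t /\
     c *: n = s' *: lineA v t + r' *: lineB v t) ->
  (forall s r s' r', s *: lineA u t + r *: lineB u t = s' *: lineA v t + r' *: lineB v t ->
     exists c, s *: lineA u t + r *: lineB u t = c *: n) ->
  node u v t = plinear n.
Proof.
move=> uc vc gt sub sup; rewrite /node !X_line //; apply/seteqP; split=> x.
  move=> [/plinear2P[x0 [s [r xE]]] /plinear2P[_ [s' [r' xE']]]].
  apply/plinear1P; split=> //; have [|c cE] := sup s r s' r'; first by rewrite -xE.
  by exists c; rewrite xE.
move=> /plinear1P[x0 [c xE]]; have [s [r [s' [r' [nE nE']]]]] := sub c.
by split; apply/plinear2P; split=> //; [exists s, r | exists s', r']; rewrite xE.
Qed.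

Lemma node_conic_line v t n : v <> c34 -> generic_t t ->
  (forall c, exists y2 y3 y4 s' r', [/\ conic_eq t y2 y3 y4,
     c *: n = conic_row t y2 y3 y4 &
     c *: n = s' *: lineA v t + r' *: lineB v t]) ->
  (forall y2 y3 y4 s' r', conic_row t y2 y3 y4 = s' *: lineA v t + r' *: lineB v t ->
     exists c, conic_row t y2 y3 y4 = c *: n) ->
  node c34 v t = plinear n.
Proof.
move=> vc gt sub sup; rewrite /node X_conic // X_line //; apply/seteqP; split=> x.
  move=> [[x0 [y2 [y3 [y4 [yC xE]]]]] /plinear2P[_ [s' [r' xE']]]].
  apply/plinear1P; split=> //; have [|c cE] := sup y2 y3 y4 s' r'; first by rewrite -xE.
  by exists c; rewrite xE.
move=> /plinear1P[x0 [c xE]]; have [y2 [y3 [y4 [s' [r' [yC nE nE']]]]]] := sub c.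
split; first by split=> //; exists y2, y3, y4; rewrite xE.
by apply/plinear2P; split=> //; exists s', r'; rewrite xE.
Qed.

Ltac node_in := rewrite /lineA /lineB ?pt_comb pt_scale; split; congr pt; by field.

Lemma node_c0_c1 t : generic_t t -> node c0 c1 t = plinear (pt t 0 0 1 0 0 0 0).
Proof.
move=> gt; have [t00 t10 _] := and3P gt; apply: node_lines => // [c|s r s' r'].
  by exists c, 0, 0, c; node_in.
rewrite /lineA /lineB !pt_comb => /(pt_inj t00)[_ _ _ _ [_ _]].
node_simpl => r0; exists s; rewrite pt_scale r0; congr pt; ring.
Qed.

Lemma node_c1_c2 t : generic_t t -> node c1 c2 t = plinear (pt t 0 1 1 0 0 0 0).
Proof.
move=> gt; have [t00 t10 _] := and3P gt; apply: node_lines => // [c|s r s' r'].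
  by exists c, c, 0, c; node_in.
rewrite /lineA /lineB !pt_comb => /(pt_inj t00)[_ + + _ _].
node_simpl => -> ->; exists r'; rewrite pt_scale; congr pt; ring.
Qed.

Lemma node_c1_c10 t : generic_t t -> node c1 c10 t = plinear (pt t 0 1 0 0 0 0 0).
Proof.
move=> gt; have [t00 t10 _] := and3P gt; apply: node_lines => // [c|s r s' r'].
  by exists c, 0, c, 0; node_in.
rewrite /lineA /lineB !pt_comb => /(pt_inj t00)[_ _ + _ [+ _ _]].
node_simpl => -> <-; exists s; rewrite pt_scale; congr pt; ring.
Qed.

Lemma node_c5_c6 t : generic_t t -> node c5 c6 t = plinear (pt t 0 0 0 1 0 1 0).
Proof.
move=> gt; have [t00 t10 _] := and3P gt; apply: node_lines => // [c|s r s' r'].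
  by exists c, (c / t.1), c, 0; node_in.
rewrite /lineA /lineB !pt_comb => /(pt_inj t00)[_ _ _ + [_ + +]].
node_simpl => E4 E6 E7; rewrite -E7 addr0 in E4; exists s; rewrite pt_scale.
have rE : r * t.1 = s by rewrite E6 E4.
by congr pt; rewrite -?rE; ring.
Qed.

Lemma node_c8_c11 t : generic_t t -> node c8 c11 t = plinear (pt t 0 0 0 0 0 1 0).
Proof.
move=> gt; have [t00 t10 _] := and3P gt; apply: node_lines => // [c|s r s' r'].
  by exists c, 0, 0, c; node_in.
rewrite /lineA /lineB !pt_comb => /(pt_inj t00)[_ _ _ _ [_ _]].
node_simpl => ->; exists s; rewrite pt_scale; congr pt; ring.
Qed.

Lemma node_c6_c7 t : generic_t t ->
  node c6 c7 t = plinear (pt t 0 0 (- t.2) 0 t.2 1 (- 1)).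
Proof.
move=> gt; have [t00 t10 _] := and3P gt; apply: node_lines => // [c|s r s' r'].
  by exists c, (- c), (c * t.2), (- c); node_in.
rewrite /lineA /lineB !pt_comb => /(pt_inj t00)[_ _ _ + _].
node_simpl => /eqP; rewrite addr_eq0 => /eqP ->; exists (- r); rewrite pt_scale.
by congr pt; ring.
Qed.

Lemma node_c7_c8 t : generic_t t -> node c7 c8 t = plinear (pt t 0 0 0 0 0 1 (- 1)).
Proof.
move=> gt; have [t00 t10 _] := and3P gt; apply: node_lines => // [c|s r s' r'].
  by exists 0, (- c), c, (- c); node_in.
rewrite /lineA /lineB !pt_comb => /(pt_inj t00)[_ _ _ _ [+ _ _]].
node_simpl => ->; exists (- r); rewrite pt_scale; congr pt; ring.
Qed.

Lemma node_c6_c9 t : generic_t t ->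
  node c6 c9 t = plinear (pt t 0 0 t.2 1 (- t.2) 0 1).
Proof.
move=> gt; have [t00 t10 _] := and3P gt; apply: node_lines => // [c|s r s' r'].
  by exists 0, c, c, (c / t.1); node_in.
rewrite /lineA /lineB !pt_comb => /(pt_inj t00)[_ _ _ _ [_ + _]].
node_simpl => ->; exists r; rewrite pt_scale; congr pt; ring.
Qed.

Lemma node_c0_c8 t : generic_t t -> node c0 c8 t = plinear (pt t 0 0 0 0 0 0 1).
Proof.
move=> gt; have [t00 t10 _] := and3P gt; apply: node_lines => // [c|s r s' r'].
  by exists 0, c, 0, c; node_in.
rewrite /lineA /lineB !pt_comb => /(pt_inj t00)[_ _ + _ _].
node_simpl => ->; exists r; rewrite pt_scale; congr pt; ring.
Qed.

Lemma conic_row_pt t y2 y3 y4 : conic_row t y2 y3 y4 =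
  pt t (- t.2 * y2) (t.2 * (y2 - y4)) (t.2 * (y2 - y4)) y3 (- t.2 * (y3 - y4)) 0 0.
Proof. by []. Qed.

Ltac conic_node_in := rewrite /lineA /lineB conic_row_pt pt_comb pt_scale;
  split; [rewrite /conic_eq; by field | congr pt; by field..].

Lemma node_c34_c9 t : generic_t t -> node c34 c9 t = plinear (pt t 0 0 0 1 (- t.2) 0 0).
Proof.
move=> gt; have [t00 t10 _] := and3P gt; apply: node_conic_line => // [c|y2 y3 y4 s r].
  by exists 0, c, 0, c, 0; conic_node_in.
rewrite /lineA /lineB conic_row_pt pt_comb => /(pt_inj t00)[+ + _ _ _].
node_simpl => /eqP; rewrite mulf_eq0 oppr_eq0 (negbTE t10) /= => /eqP ->.
move=> /eqP; rewrite mulf_eq0 (negbTE t10) sub0r oppr_eq0 /= => /eqP ->.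
by exists y3; rewrite pt_scale; congr pt; ring.
Qed.

Lemma node_c34_c10 t : generic_t t -> node c34 c10 t = plinear (pt t 0 1 1 0 (- 1) 0 0).
Proof.
move=> gt; have [t00 t10 _] := and3P gt; apply: node_conic_line => // [c|y2 y3 y4 s r].
  by exists 0, 0, (- c / t.2), c, (- c); conic_node_in.
rewrite /lineA /lineB conic_row_pt pt_comb => /(pt_inj t00)[+ _ _ + _].
node_simpl => /eqP; rewrite mulf_eq0 oppr_eq0 (negbTE t10) /= => /eqP -> ->.
by exists (- t.2 * y4); rewrite pt_scale; congr pt; ring.
Qed.

Lemma node_c34_c2 t : generic_t t -> node c34 c2 t = plinear (pt t 1 (- 1) (- 1) 0 0 0 0).
Proof.
move=> gt; have [t00 t10 _] := and3P gt; apply: node_conic_line => // [c|y2 y3 y4 s r].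
  by exists (- c / t.2), 0, 0, c, (- c); conic_node_in.
rewrite /lineA /lineB conic_row_pt pt_comb => /(pt_inj t00)[_ _ _ + [+ _ _]].
node_simpl => ->; node_simpl => /eqP; rewrite ?oppr_eq0 mulf_eq0 ?oppr_eq0 (negbTE t10) /=.
by move=> /eqP ->; exists (- t.2 * y2); rewrite pt_scale; congr pt; ring.
Qed.

Lemma node_c34_c5 t : generic_t t -> node c34 c5 t = plinear (pt t (- t.2) 0 0 1 0 0 0).
Proof.
move=> gt; have [t00 t10 _] := and3P gt; apply: node_conic_line => // [c|y2 y3 y4 s r].
  by exists c, c, c, c, 0; conic_node_in.
rewrite /lineA /lineB conic_row_pt pt_comb => /(pt_inj t00)[_ + _ _ [+ _ _]].
node_simpl => /eqP; rewrite mulf_eq0 (negbTE t10) subr_eq0 /= => /eqP ->.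
move=> /eqP; rewrite mulf_eq0 oppr_eq0 (negbTE t10) subr_eq0 /= => /eqP ->.
by exists y4; rewrite pt_scale; congr pt; ring.
Qed.

End Nodes.

(** * Limits of the lines and nodes, and equations for the limit of component 34 *)

Section LimitsOfComponents.
Variable K : fieldType.
Hypothesis natK : injective (fun k : nat => k%:R : K).
Implicit Types (t tau : K * K).

Ltac prove_tcoef := repeat first
  [ exact: tcoefC | exact: tcoef_fst | exact: tcoef_snd | apply: tcoefD | apply: tcoefN
  | apply: tcoefM ].

Lemma generic_fst t : generic_t t -> t.1 != 0.
Proof. by case/and3P. Qed.

Lemma Xlim_line v tau : v <> c34 -> tau.1 != 0 -> Xlim tau v = line v tau.
Proof.
move=> vc tau0.
have [tA tB] : tvec (@lineA K v) /\ tvec (@lineB K v).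
  by rewrite /lineA /lineB; case: v vc => // _; split; apply tvec_pt; prove_tcoef.
(* [ij] lists, for each line, pivot coordinates in which the basis has the matrix g times the
   identity. *)
pose g (t : K * K) : K := match v with c5 | c9 => t.1 | _ => 1 end.
pose ij : nat * nat := match v with
  | c0 => (8, 14) | c1 => (6, 8) | c2 => (1, 6) | c34 => (0, 0) | c5 => (9, 12)
  | c6 => (12, 14) | c7 => (10, 14) | c8 => (12, 14) | c9 => (9, 14) | c10 => (6, 10)
  | c11 => (1, 12) end%N.
have g0 t : t.1 != 0 -> g t != 0 by rewrite /g; case: (v); rewrite ?oner_neq0.
apply: (limit_line natK (a := lineA v) (b := lineB v) (g := g) (i := inord ij.1) (j := inord ij.2)) => //.
- exact: g0.
- by move=> t gt; apply/g0/generic_fst.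
- move=> t; rewrite /lineA /lineB -!/(co _ _) /g /ij.
  by clear tA tB g0; case: v vc g ij => // _ g ij; rewrite !co_pt //= ?(mulr0, mulr1, addr0, add0r, addrN).
- by move=> t gt; apply: X_line.
Qed.

Lemma pt_tau_neq0 tau z1 z2 z3 z4 z5 z6 z7 : tau.1 != 0 ->
  has (fun c => c != 0) [:: z1; z2; z3; z4; z5; z6; z7] ->
  pt tau z1 z2 z3 z4 z5 z6 z7 != 0.
Proof. by move=> tau0; apply: pt_neq0. Qed.

Ltac limit_node H := move=> tau0; apply: (limit_point natK (w := fun t => pt t _ _ _ _ _ _ _));
  [apply tvec_pt; prove_tcoef
  |by apply: pt_tau_neq0; rewrite //= ?oppr_eq0 oner_neq0 ?orbT
  |exact: H].

Lemma nodelim_c0_c1 tau : tau.1 != 0 ->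
  nodelim tau c0 c1 = plinear (pt tau 0 0 1 0 0 0 0).
Proof. limit_node (@node_c0_c1 K natK). Qed.

Lemma nodelim_c1_c2 tau : tau.1 != 0 ->
  nodelim tau c1 c2 = plinear (pt tau 0 1 1 0 0 0 0).
Proof. limit_node (@node_c1_c2 K natK). Qed.

Lemma nodelim_c1_c10 tau : tau.1 != 0 ->
  nodelim tau c1 c10 = plinear (pt tau 0 1 0 0 0 0 0).
Proof. limit_node (@node_c1_c10 K natK). Qed.

Lemma nodelim_c5_c6 tau : tau.1 != 0 ->
  nodelim tau c5 c6 = plinear (pt tau 0 0 0 1 0 1 0).
Proof. limit_node (@node_c5_c6 K natK). Qed.

Lemma nodelim_c8_c11 tau : tau.1 != 0 ->
  nodelim tau c8 c11 = plinear (pt tau 0 0 0 0 0 1 0).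
Proof. limit_node (@node_c8_c11 K natK). Qed.

Lemma nodelim_c6_c7 tau : tau.1 != 0 ->
  nodelim tau c6 c7 = plinear (pt tau 0 0 (- tau.2) 0 tau.2 1 (- 1)).
Proof.
move=> tau0; apply: (limit_point natK (w := fun t => pt t 0 0 (- t.2) 0 t.2 1 (- 1))).
- by apply tvec_pt; prove_tcoef.
- by apply: pt_tau_neq0; rewrite //= ?oppr_eq0 oner_neq0 ?orbT.
- exact: node_c6_c7.
Qed.

Lemma nodelim_c7_c8 tau : tau.1 != 0 ->
  nodelim tau c7 c8 = plinear (pt tau 0 0 0 0 0 1 (- 1)).
Proof. limit_node (@node_c7_c8 K natK). Qed.

Lemma nodelim_c6_c9 tau : tau.1 != 0 ->
  nodelim tau c6 c9 = plinear (pt tau 0 0 tau.2 1 (- tau.2) 0 1).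
Proof.
move=> tau0; apply: (limit_point natK (w := fun t => pt t 0 0 t.2 1 (- t.2) 0 1)).
- by apply tvec_pt; prove_tcoef.
- by apply: pt_tau_neq0; rewrite //= ?oppr_eq0 oner_neq0 ?orbT.
- exact: node_c6_c9.
Qed.

Lemma nodelim_c0_c8 tau : tau.1 != 0 ->
  nodelim tau c0 c8 = plinear (pt tau 0 0 0 0 0 0 1).
Proof. limit_node (@node_c0_c8 K natK). Qed.

Lemma nodelim_c34_c9 tau : tau.1 != 0 ->
  nodelim tau c34 c9 = plinear (pt tau 0 0 0 1 (- tau.2) 0 0).
Proof.
move=> tau0; apply: (limit_point natK (w := fun t => pt t 0 0 0 1 (- t.2) 0 0)).
- by apply tvec_pt; prove_tcoef.
- by apply: pt_tau_neq0; rewrite //= ?oppr_eq0 oner_neq0 ?orbT.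
- exact: node_c34_c9.
Qed.

Lemma nodelim_c34_c10 tau : tau.1 != 0 ->
  nodelim tau c34 c10 = plinear (pt tau 0 1 1 0 (- 1) 0 0).
Proof. limit_node (@node_c34_c10 K natK). Qed.

Lemma nodelim_c2_c34 tau : tau.1 != 0 ->
  nodelim tau c2 c34 = plinear (pt tau 1 (- 1) (- 1) 0 0 0 0).
Proof.
have H t : generic_t t -> node c2 c34 t = plinear (pt t 1 (- 1) (- 1) 0 0 0 0).
  by move=> gt; rewrite /node setIC; apply: node_c34_c2.
limit_node H.
Qed.

Lemma nodelim_c34_c5 tau : tau.1 != 0 ->
  nodelim tau c34 c5 = plinear (pt tau (- tau.2) 0 0 1 0 0 0).
Proof.
move=> tau0; apply: (limit_point natK (w := fun t => pt t (- t.2) 0 0 1 0 0 0)).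
- by apply tvec_pt; prove_tcoef.
- by apply: pt_tau_neq0; rewrite //= ?oppr_eq0 oner_neq0 ?orbT.
- exact: node_c34_c5.
Qed.

(** In the coordinates z_i the quadric z_1 z_5 + (t_0 - t_1) z_2 z_4 equals t_1 times the equation
    of the conic. It is the equation to carry to the limit, since it stays nontrivial at t_1 = 0;
    the linear equations among the coordinates pass to the limit directly. *)
Lemma Xlim_conic_sub tau x : tau.1 = 1 -> Xlim tau c34 x -> exists z1 z2 z4 z5,
  [/\ x = pt tau z1 z2 z2 z4 z5 0 0, z1 + z2 + tau.2 * z4 + z5 = 0 &
      z1 * z5 + (tau.1 - tau.2) * (z2 * z4) = 0].
Proof.
move=> tau1 limx.
have vanish d F : tform d F ->
    (forall t y2 y3 y4, conic_eq t y2 y3 y4 -> F t (conic_row t y2 y3 y4) = 0) ->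
    F tau x = 0.
  move=> dF F0; apply: limit_vanish dF _ limx => t z gt.
  by rewrite X_conic // => -[_ [y2 [y3 [y4 [yC ->]]]]]; apply: F0.
have cX k : tform 1 (fun (_ : K * K) x => co x k) by apply: tformX.
have tB d F G : tform d F -> tform d G -> tform d (fun (t : K * K) x => F t x - G t x).
  by move=> dF dG; apply: tformD => //; apply: tformN.
have same k l (c c' : K * K -> K) : tcoef c -> tcoef c' ->
    (forall t y2 y3 y4, c t * co (conic_row t y2 y3 y4) k
       = c' t * co (conic_row t y2 y3 y4) l) ->
    c tau * co x k = c' tau * co x l.
  move=> tc tc' cc'; apply/eqP; rewrite -subr_eq0; apply/eqP.
  apply: (vanish 1 (fun t x => c t * co x k - c' t * co x l)).
    by apply: tB; apply: tformZ.
  by move=> t y2 y3 y4 _; rewrite cc' subrr.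
have one k l (c : K * K -> K) : tcoef c ->
    (forall t y2 y3 y4, t.1 * co (conic_row t y2 y3 y4) k
       = c t * co (conic_row t y2 y3 y4) l) -> co x k = c tau * co x l.
  move=> tc H; rewrite -[LHS]mul1r -tau1.
  by apply: (same k l (fun t => t.1)) => //; exact: tcoef_fst.
have zero k : (forall t y2 y3 y4, co (conic_row t y2 y3 y4) k = 0) -> co x k = 0.
  move=> H; rewrite (one k 0%N (fun=> 0)) ?mul0r // => [|t y2 y3 y4].
    exact: tcoefC.
  by rewrite H mulr0 mul0r.
exists (co x 1), (co x 6), (co x 9), (co x 10); split.
- have tf := @tcoef_fst K; have ts := @tcoef_snd K.
  have E5 : co x 5 = tau.2 * co x 9 + co x 10.
    apply/eqP; rewrite -subr_eq0 -(mul1r (co x 5)) -(mul1r (co x 10)) -tau1; apply/eqP.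
    apply: (vanish 1%N (fun t x => t.1 * co x 5 - (t.2 * co x 9 + t.1 * co x 10))).
      by apply: tB; [|apply: tformD]; apply: tformZ.
    by move=> t y2 y3 y4 _; rewrite /conic_row !co_row16 //=; ring.
  have E21 : co x 2 = co x 1.
    rewrite -(mul1r (co x 1)) -tau1; apply: (one 2%N 1%N (fun t => t.1)) => //.
    by move=> t y2 y3 y4; rewrite /conic_row !co_row16.
  have E75 : co x 7 = co x 5.
    rewrite -(mul1r (co x 5)) -tau1; apply: (one 7%N 5%N (fun t => t.1)) => //.
    by move=> t y2 y3 y4; rewrite /conic_row !co_row16.
  have E86 : co x 8 = co x 6.
    rewrite -(mul1r (co x 6)) -tau1; apply: (one 8%N 6%N (fun t => t.1)) => //.
    by move=> t y2 y3 y4; rewrite /conic_row !co_row16.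
  apply: co_inj; apply: eq16; rewrite !co_pt //= ?E75 ?E5 //; try
    by apply: zero => t y2 y3 y4; rewrite /conic_row !co_row16.
  + apply: (one 0%N 9%N (fun t => t.1 * t.2 - t.2 ^+ 2)); first by prove_tcoef.
    by move=> t y2 y3 y4; rewrite /conic_row !co_row16 //=; ring.
  + apply: (one 4%N 9%N (fun t => t.1 - t.2)); first by prove_tcoef.
    by move=> t y2 y3 y4; rewrite /conic_row !co_row16 //=; ring.
  + by rewrite tau1 mul1r.
- transitivity (tau.1 * (co x 1 + (co x 6 + co x 10)) + tau.2 * co x 9).
    by rewrite tau1; ring.
  apply: (vanish 1%N (fun t x => t.1 * (co x 1 + (co x 6 + co x 10)) + t.2 * co x 9)).
    have := @tcoef_fst K; have := @tcoef_snd K => *.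
    by repeat first [assumption | exact: cX | apply: tformD | apply: tformZ].
  by move=> t y2 y3 y4 _; rewrite /conic_row !co_row16 //=; ring.
- rewrite -[co x 1]mul1r -tau1.
  apply: (vanish 2%N (fun t x => t.1 * co x 1 * co x 10 + (t.1 - t.2) * (co x 6 * co x 9))).
    apply: tformD.
      apply: (tformM (d := 1) (e := 1)) => //; apply: tformZ => //.
      exact: tcoef_fst.
    apply: tformZ; first by prove_tcoef.
    exact: (tformM (d := 1) (e := 1)).
  (* Since x_35 = t_0 z_4, the form is t_0 t_1 times the equation of the conic. *)
  move=> t y2 y3 y4 yC; rewrite /conic_row !co_row16 //=.
  rewrite -[RHS](mulr0 (t.1 * t.2)) -[in RHS]yC; ring.
Qed.

(* The points of conic t, divided by -t_1, in terms of the parameter [a : b];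
   this stays meaningful at t_1 = 0. *)
Definition conic_lim t (a b : K) : 'rV[K]_16 :=
  pt t (- ((t.1 - t.2) * (a * b))) (- (b * (t.2 * a - b))) (- (b * (t.2 * a - b)))
    (a * (t.1 * a - b)) (- ((t.2 * a - b) * (t.1 * a - b))) 0 0.

Lemma conic_lim_in t (c a b : K) : t.2 != 0 -> c *: conic_lim t a b != 0 ->
  conic t (c *: conic_lim t a b).
Proof.
move=> t10 x0; split=> //.
exists (c / t.2 * conic_y2 t a b), (c / t.2 * conic_y3 t a b), (c / t.2 * conic_y4 t a b).
split.
  rewrite /conic_eq; transitivity ((c / t.2) ^+ 2 * (t.1 * conic_y2 t a b * conic_y3 t a b
    - t.2 * conic_y2 t a b * conic_y4 t a b
    + (- t.1 + t.2) * conic_y3 t a b * conic_y4 t a b)); first by ring.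
  by rewrite conic_eq_param mulr0.
rewrite /conic_lim pt_scale conic_row_pt /conic_y2 /conic_y3 /conic_y4.
by congr pt; field.
Qed.

Lemma Xlim_conic_lim tau c a b : c *: conic_lim tau a b != 0 ->
  Xlim tau c34 (c *: conic_lim tau a b).
Proof.
move=> x0; apply: (limit_tvec natK (w := fun t => c *: conic_lim t a b)) => //.
  have tv : tvec (fun t => conic_lim t a b) by apply tvec_pt; prove_tcoef.
  move=> i; have [q qE] := tcoefM (tcoefC c) (tv i).
  by exists q => t; rewrite mxE qE.
move=> t gt w0; have [_ t10 _] := and3P gt.
by rewrite X_conic //; apply: conic_lim_in.
Qed.

End LimitsOfComponents.

(** * Component 34 at t = 1 and at t = infinity *)

Section ConicLimits.
Variable K : fieldType.
Hypothesis natK : injective (fun k : nat => k%:R : K).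
Notation one := ((1, 1) : K * K).
Notation infty := ((1, 0) : K * K).

(** [L3a] and [L3b] represent the nodes 3-9 and 3-10, [L4a] and [L4b] the nodes 2-4 and 4-5. The
    sign of [L3a] makes [L3a + L3b] represent the node 3-4, as the normalization of the scroll
    requires. *)
Definition L3a : 'rV[K]_16 := pt one 0 0 0 (- 1) 1 0 0.
Definition L3b : 'rV[K]_16 := pt one 0 1 1 0 (- 1) 0 0.
Definition L3 : set 'rV[K]_16 := plinear (col_mx L3a L3b).
Definition L4a : 'rV[K]_16 := pt one 1 (- 1) (- 1) 0 0 0 0.
Definition L4b : 'rV[K]_16 := pt one (- 1) 0 0 1 0 0 0.
Definition L4 : set 'rV[K]_16 := plinear (col_mx L4a L4b).

(* Near t = (1, 1), where the points of line 4 arise as a / b -> 1: with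
   t = (1 + al u + u^2, 1) and [a : b] = [1 : 1 + be u], the points of the
   conic are divisible by u. *)
Lemma Xlim_L4 c (al be : K) :
  c *: pt one (- al) be be (al - be) 0 0 0 != 0 ->
  Xlim one c34 (c *: pt one (- al) be be (al - be) 0 0 0).
Proof.
(* The term u^2 keeps p u - 1 = u (al + u) from vanishing identically when al = 0, so that the curve
   has generic points. *)
move=> x0; pose p (u : K) := 1 + (al * u + u ^+ 2).
have pp : ispoly p by rewrite /p; prove_ispoly.
pose w u := c *: pt (p u, 1) (- ((al + u) * (1 + be * u))) (be * (1 + be * u))
  (be * (1 + be * u)) (al + u - be) (be * u * (al + u - be)) 0 0.
have pw : ispath w.
  apply: ispathZ; first exact: ispolyC.
  move=> i; apply: (ispoly_ext (g := fun u => nth 0 (ptseq (p u, 1)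
    (- ((al + u) * (1 + be * u))) (be * (1 + be * u)) (be * (1 + be * u))
    (al + u - be) (be * u * (al + u - be)) 0 0) i)) => [u|]; first by rewrite mxE.
  by case: i => [[|[|[|[|[|[|[|[|[|[|[|[|[|[|[|[|//]]]]]]]]]]]]]]]] ?] /=; prove_ispoly.
have [u1 gu1] : exists u, generic_t (p u, 1).
  have pX (k : K) : ispoly (fun u => u - k) by prove_ispoly.
  have nz (k : K) : k + 1 - k != 0 by rewrite addrAC subrr add0r oner_neq0.
  have [u2 h2] := ispoly_nz2 natK (pX 0) (pX (- al)) (nz _) (nz _).
  have p00 : p 0 != 0 by rewrite /p mulr0 expr0n !addr0 oner_neq0.
  have [u h] := ispoly_nz2 natK (ispolyM (pX 0) (pX (- al))) pp h2 p00.
  exists u; move: h; rewrite !mulf_eq0 !negb_or subr0 opprK => /andP[/andP[u0 ual] pu].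
  apply/and3P; split=> //=; first exact: oner_neq0.
  rewrite -subr_eq0 (_ : p u - 1 = u * (u + al)) ?mulf_neq0 //.
  by rewrite /p; ring.
apply: (limit_path natK (p := p) (q := fun=> 1) (w := w) (g := id) (u0 := 1) (u1 := u1)) => //.
- exact: ispolyC.
- exact: ispolyX.
- exact: oner_neq0.
- by rewrite /p mulr0 expr0n !addr0.
- rewrite /w /p !mulr0 expr0n !addr0 mul0r mulr1.
  by congr (_ *: pt _ _ _ _ _ _ _ _); rewrite ?mulr1.
move=> u u0 gt wu0; rewrite X_conic //.
have wE : w u = (c / u) *: conic_lim (p u, 1) 1 (1 + be * u).
  by rewrite /w /conic_lim !pt_scale /p /=; congr pt; field.
by rewrite wE; apply: conic_lim_in; rewrite ?oner_neq0 // -wE.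
Qed.

Lemma Xlim_conic_one : Xlim one c34 = L3 `|` L4.
Proof.
have o0 : one.1 != 0 by exact: oner_neq0.
apply/seteqP; split=> x.
  move=> limx; have x0 : x != 0 by case: limx.
  have [//|z1 [z2 [z4 [z5 [xE]]]]] := Xlim_conic_sub natK _ limx.
  rewrite /= mul1r subrr mul0r addr0 => sum0 /eqP.
  rewrite mulf_eq0 => /orP[] /eqP z0; [left|right]; apply/plinear2P; split=> //.
    exists (- z4), z2; rewrite xE pt_comb z0.
    have z5E : z5 = - z2 - z4 by rewrite -[LHS](subr0) -sum0 z0; ring.
    by congr pt; rewrite ?z5E; ring.
  exists (- z2), z4; rewrite xE pt_comb z0.
  have z1E : z1 = - z2 - z4 by rewrite -[LHS](subr0) -sum0 z0; ring.
  by congr pt; rewrite ?z1E; ring.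
have L4sub : L4 `<=` Xlim one c34.
  move=> {}x /plinear2P[x0 [s [r xE]]].
  have E : x = 1 *: pt one (- (r - s)) (- s) (- s) (r - s - - s) 0 0 0.
    by rewrite xE /L4a /L4b pt_comb scale1r; congr pt; ring.
  by rewrite E; apply: Xlim_L4; rewrite -E.
case=> [/plinear2P[x0 [s [r xE]]]|]; last exact: L4sub.
have [rs|rs] := eqVneq r s.
  apply: L4sub; apply/plinear2P; split=> //; exists (- s), (- s).
  by rewrite xE rs /L3a /L3b /L4a /L4b !pt_comb; congr pt; ring.
(* The representative of [a : b] is normalized by a - b = 1. *)
have E : x = (r - s) *: conic_lim one (- s / (r - s)) (- s / (r - s) - 1).
  have rs1 : r - s != 0 by rewrite subr_eq0.
  rewrite xE /L3a /L3b pt_comb /conic_lim pt_scale /=.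
  by congr pt; field.
by rewrite E; apply: Xlim_conic_lim; rewrite -?E.
Qed.

Definition conic_infty : set 'rV[K]_16 := [set x | x != 0 /\ exists z1 z2 z4,
  x = pt infty z1 z2 z2 z4 (- z1 - z2) 0 0 /\ z1 * (z1 + z2) = z2 * z4].

(** The parameter is [a : b] = [- z_1 : z_2]; z_2 = 0 forces z_1 = 0 and leaves the single point
    [1 : 0]. *)
Lemma conic_infty_lim x : conic_infty x -> exists c a b, x = c *: conic_lim infty a b.
Proof.
move=> [x0 [z1 [z2 [z4 [xE zq]]]]].
have [z20|z20] := eqVneq z2 0.
  have z10 : z1 = 0.
    by apply/eqP; move/eqP: zq; rewrite z20 addr0 mul0r mulf_eq0 orbb.
  by exists z4, 1, 0; rewrite xE z10 z20 /conic_lim pt_scale /=; congr pt; ring.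
have z4E : z4 = z1 * (z1 + z2) / z2 by rewrite zq mulrAC divff // mul1r.
exists z2, (- z1 / z2), 1.
by rewrite xE /conic_lim pt_scale /= z4E; congr pt; field.
Qed.

Lemma Xlim_conic_infty : Xlim infty c34 = conic_infty.
Proof.
apply/seteqP; split=> x.
  move=> limx; have x0 : x != 0 by case: limx.
  have [//|z1 [z2 [z4 [z5 [xE]]]]] := Xlim_conic_sub natK _ limx.
  rewrite /= mul0r addr0 subr0 mul1r => sum0 q0.
  have z5E : z5 = - z1 - z2 by rewrite -[LHS](subr0) -sum0; ring.
  split=> //; exists z1, z2, z4; rewrite xE z5E; split=> //.
  by rewrite -[RHS](addr0) -[X in _ = _ + X]oppr0 -[X in _ = _ - X]q0 z5E; ring.
move=> cx; have [x0 _] := cx; have [c [a [b xE]]] := conic_infty_lim cx.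
by rewrite xE; apply: Xlim_conic_lim; rewrite -?xE.
Qed.

End ConicLimits.

(** * Planes and scrolls *)

Section Components.
Variables (K : fieldType) (n : nat).
Hypothesis natK : injective (fun k : nat => k%:R : K).
Implicit Types (A B Y Z : set 'rV[K]_n) (Zs : seq (set 'rV[K]_n)).

Lemma zclosedU A B : zclosed A -> zclosed B -> zclosed (A `|` B).
Proof.
move=> cA cB; apply: zclosedP => [x [Ax|Bx]|x [x0 clx]].
- exact: zclosed_neq0 cA Ax.
- exact: zclosed_neq0 cB Bx.
apply: contrapT => /not_orP[nA nB].
have [d [F [[f fd Ff] FA Fx]]] := zclosureP cA x0 nA.
have [e [G [[g ge Gg] GB Gx]]] := zclosureP cB x0 nB.
have /eqP : (f * g).@[x 0] = 0.
  apply: clx (dhomogM fd ge) _ => z [/FA|/GB]; rewrite mevalM -?Ff -?Gg => ->.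
    by rewrite mul0r.
  by rewrite mulr0.
by rewrite mevalM -Ff -Gg mulf_eq0 (negbTE Fx) (negbTE Gx).
Qed.

Lemma irreducible_bigcup Z Zs : irreducible_closed Z ->
  (forall A, A \in Zs -> zclosed A) -> Z `<=` \bigcup_(A in [set` Zs]) A ->
  exists2 A, A \in Zs & Z `<=` A.
Proof.
move=> [cZ [x Zx] iZ]; elim: Zs => [|A Zs IHZs] cZs ZZs.
  by have [A] := ZZs x Zx.
have cup (s : seq (set 'rV[K]_n)) : (forall B, B \in s -> zclosed B) ->
    zclosed (\bigcup_(B in [set` s]) B).
  elim: s => [|B s IHs] cs.
    apply: zclosedP => [y []//|y [y0 cly]].
    have /eqP : (1 : {mpoly K[n]}).@[y 0] = 0 by apply: cly (dhomog1 _ _) _ => z [].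
    by rewrite meval1 oner_eq0.
  rewrite [X in zclosed X](_ : _ = B `|` \bigcup_(C in [set` s]) C).
    apply: zclosedU; first by apply: cs; rewrite mem_head.
    by apply: IHs => C Cs; apply: cs; rewrite inE Cs orbT.
  apply/seteqP; split=> y.
    by move=> [C /=]; rewrite inE => /orP[/eqP ->|Cs] Cy; [left|right; exists C].
  by move=> [By|[C Cs Cy]]; [exists B; rewrite //= mem_head|exists C; rewrite //= inE Cs orbT].
have cZs' B : B \in Zs -> zclosed B by move=> BZs; apply: cZs; rewrite inE BZs orbT.
have [|||ZA|ZU] := iZ A (\bigcup_(B in [set` Zs]) B).
- by apply: cZs; rewrite mem_head.
- exact: cup.
- move=> y /ZZs[B /=]; rewrite inE => /orP[/eqP ->|BZs] By; [left|right] => //.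
  by exists B.
- by exists A; rewrite ?mem_head.
have [B BZs ZB] := IHZs cZs' ZU.
by exists B => //; rewrite inE BZs orbT.
Qed.

(** A point p i on the i-th member only excludes inclusions between members, and an irreducible
    closed subset of their finite union lies in one of them. *)
Lemma has_components_witness Y Zs (p : nat -> 'rV[K]_n) :
  (forall Z, Z \in Zs -> irreducible_closed Z) -> Y = \bigcup_(Z in [set` Zs]) Z ->
  (forall i, (i < size Zs)%N -> nth set0 Zs i (p i)) ->
  (forall i j, (i < size Zs)%N -> (j < size Zs)%N -> nth set0 Zs j (p i) -> i = j) ->
  has_components Y Zs.
Proof.
move=> iZs YE pZ pij.
have sub i j : (i < size Zs)%N -> (j < size Zs)%N ->
    nth set0 Zs i `<=` nth set0 Zs j -> i = j.
  by move=> iZ jZ ij; apply: pij => //; apply/ij/pZ.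
have cZs A : A \in Zs -> zclosed A by move=> /iZs[].
have ZsY Z : Z \in Zs -> Z `<=` Y by move=> ZZs x Zx; rewrite YE; exists Z.
split=> //.
  apply/(uniqP set0) => i j iZ jZ ij; apply: sub => //; rewrite ij.
  exact: subset_refl.
have eqsub Z Z' : Z \in Zs -> Z' \in Zs -> Z `<=` Z' -> Z = Z'.
  move=> /(nthP set0)[i iZ <-] /(nthP set0)[j jZ <-] ij.
  by rewrite (sub i j).
apply/seteqP; split=> Z /=.
  move=> [iZ ZY maxZ]; have [|A AZs ZA] := irreducible_bigcup iZ cZs; first by rewrite -YE.
  by rewrite -(maxZ A (iZs A AZs) ZA (ZsY A AZs)).
move=> ZZs; split; [exact: iZs|exact: ZsY|move=> Z' iZ' ZZ' Z'Y].
have [|A AZs Z'A] := irreducible_bigcup iZ' cZs; first by rewrite -YE.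
have ZA : Z = A by apply: eqsub => //; apply: subset_trans Z'A.
by apply/seteqP; split=> //; rewrite ZA.
Qed.

End Components.

(** * Spans of lines: irreducibility and dimension *)

Section PlanesAndScrolls.
Variables (K : fieldType) (n : nat).
Hypothesis natK : injective (fun k : nat => k%:R : K).
Implicit Types (a b c x : 'rV[K]_n).

Lemma plinear_scale a (k : K) : k != 0 -> plinear (k *: a) = plinear a.
Proof.
move=> k0; apply/seteqP; split=> x /plinear1P[x0 [s xE]]; apply/plinear1P; split=> //.
  by exists (s * k); rewrite xE scalerA.
by exists (s / k); rewrite xE scalerA divfK.
Qed.

Lemma plinear_swap a b : plinear (col_mx a b) = plinear (col_mx b a).
Proof.
apply/seteqP; split=> x /plinear2P[x0 [s [r xE]]]; apply/plinear2P; split=> //;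
  by exists r, s; rewrite xE addrC.
Qed.

Lemma is_plinear_free m (U : 'M[K]_(m.+1, n)) : row_free U -> is_plinear m (plinear U).
Proof.
move=> /eqP rU; exists (<<U>>%MS); first by rewrite genmxE.
by apply/seteqP; split=> x [x0 xU]; split=> //; rewrite genmxE in xU *.
Qed.

Lemma row_free2 a b : (forall s r, s *: a + r *: b = 0 -> s = 0 /\ r = 0) ->
  row_free (col_mx a b).
Proof.
move=> ind; rewrite -kermx_eq0; apply/eqP/row_matrixP => i; rewrite row0.
have : row i (kermx (col_mx a b)) *m col_mx a b = 0 by rewrite -row_mul mulmx_ker row0.
move: (row i _) => v; rewrite -[v]hsubmxK mul_row_col.
rewrite [lsubmx v]mx11_scalar [rsubmx v]mx11_scalar !mul_scalar_mx => /ind[-> ->].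
by rewrite !raddf0 row_mx0.
Qed.

Lemma row_free3 a b c :
  (forall s r q, s *: a + (r *: b + q *: c) = 0 -> [/\ s = 0, r = 0 & q = 0]) ->
  row_free (col_mx a (col_mx b c)).
Proof.
move=> ind; rewrite -kermx_eq0; apply/eqP/row_matrixP => i; rewrite row0.
have : row i (kermx (col_mx a (col_mx b c))) *m col_mx a (col_mx b c) = 0.
  by rewrite -row_mul mulmx_ker row0.
move: (row i _) => v; rewrite -[v]hsubmxK mul_row_col; move: (lsubmx v) (rsubmx v).
move=> v1 v2; rewrite -[v2]hsubmxK mul_row_col; move: (lsubmx v2) (rsubmx v2) => v3 v4.
rewrite [v1]mx11_scalar [v3]mx11_scalar [v4]mx11_scalar.
rewrite !mul_scalar_mx => /ind[-> -> ->].
by rewrite !raddf0 !row_mx0.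
Qed.

Lemma pspan_plane (S : set 'rV[K]_n) a b c : S a -> S b -> S c ->
  S `<=` plinear (col_mx a (col_mx b c)) -> pspan S = plinear (col_mx a (col_mx b c)).
Proof.
move=> Sa Sb Sc SU; apply/seteqP; split=> x [x0 xS]; split=> //.
  have -> : (x <= col_mx a (col_mx b c))%MS = (x <= <<col_mx a (col_mx b c)>>)%MS.
    by rewrite genmxE.
  by apply: xS => z /SU[_]; rewrite genmxE.
move=> U SsubU; apply: submx_trans xS _.
by rewrite !col_mx_sub !SsubU.
Qed.

Section Plane.
Variables a b c : 'rV[K]_n.
Hypothesis ind : forall s r q, s *: a + (r *: b + q *: c) = 0 ->
  [/\ s = 0, r = 0 & q = 0].
Let U := col_mx a (col_mx b c).

Lemma plane_neq0 : U != 0.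
Proof. by rewrite -mxrank_eq0 (eqP (row_free3 ind)). Qed.

Lemma plane_irreducible : irreducible_closed (plinear U).
Proof. exact: (irreducible_plinear natK plane_neq0). Qed.

Lemma homog_lines d (F : 'rV[K]_n -> K) x y :
  form d F -> (forall u, u != 0 -> F (x + u *: y) = 0) -> F x = 0.
Proof.
move=> [f fd Ff] F0; rewrite -[x]addr0 -(scale0r y).
have pw : ispath (fun u => x + u *: y).
  apply: ispathD; first exact: ispathC.
  by apply: ispathZ; [exact: ispolyX | exact: ispathC].
rewrite Ff; apply: (ispoly_vanish natK (f := fun u => f.@[(x + u *: y) 0])
  (ispoly_meval f pw) (ispolyX K) (oner_neq0 K)) => u u0.
by rewrite -Ff F0.
Qed.

Lemma form_scale d (F : 'rV[K]_n -> K) k x : form d F -> k != 0 -> F (k *: x) = 0 -> F x = 0.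
Proof.
move=> [f fd Ff] k0; rewrite !Ff (mevalZ_homog _ _ fd) => /eqP.
by rewrite mulf_eq0 expf_eq0 (negbTE k0) andbF => /eqP.
Qed.

Lemma plane_dim : has_dim (plinear U) 2.
Proof.
have irr := plane_irreducible.
have a0 : a != 0.
  apply/eqP => a0; have [|/eqP] := ind (s := 1) (r := 0) (q := 0).
    by rewrite a0 scaler0 !scale0r !addr0.
  by rewrite oner_eq0.
have ch : charted 1 (plinear U) (fun s r => a + (s *: b + r *: c)).
  split.
  - move=> s i; apply: (dpoly_ext (g := fun u => (a 0 i + s * b 0 i) + u * c 0 i)) => [u|].
      by rewrite !mxE addrA.
    apply: dpolyD; first exact: dpolyC.
    exact: (@dpolyM K 1 0 _ _ (dpolyX K) (dpolyC 0 _)).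
  - move=> r i; apply: (dpoly_ext (g := fun u => (a 0 i + r * c 0 i) + u * b 0 i)) => [u|].
      by rewrite !mxE; ring.
    apply: dpolyD; first exact: dpolyC.
    exact: (@dpolyM K 1 0 _ _ (dpolyX K) (dpolyC 0 _)).
  - move=> d F dF F0.
    have F1 s r q : s != 0 -> F (s *: a + (r *: b + q *: c)) = 0.
      move=> s0; apply: (@form_scale d F s^-1); rewrite ?invr_eq0 //.
      by rewrite !scalerDr !scalerA mulVf // scale1r F0.
    move=> x /plinear3P[_ [s [r [q ->]]]].
    have [s0|/F1 //] := eqVneq s 0.
    (* Points with s = 0 lie outside the affine chart and are approached in the direction of a. *)
    apply: (homog_lines (y := a) dF) => u u0.
    by rewrite addrC addrA -scalerDl s0 addr0 F1.
apply: (has_dim2 natK (U1 := a) (U2 := col_mx a b) ch irr a0); split.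
- move=> x /plinear1P[x0 [s xE]]; apply/plinear2P; split=> //.
  by exists s, 0; rewrite xE scale0r addr0.
- move=> /(_ b) H; have /plinear1P[b0 [s bE]] : plinear a b.
    apply: H; apply/plinear2P; split; last by exists 0, 1; rewrite scale0r add0r scale1r.
    apply/eqP => b0; have [|_ /eqP] := ind (s := 0) (r := 1) (q := 0).
      by rewrite b0 scaler0 !scale0r !addr0.
    by rewrite oner_eq0.
  have [|_ /eqP] := ind (s := s) (r := - 1) (q := 0).
    by rewrite -bE scale0r addr0 scaleN1r subrr.
  by rewrite oppr_eq0 oner_eq0.
- move=> x /plinear2P[x0 [s [r xE]]]; apply/plinear3P; split=> //.
  by exists s, r, 0; rewrite xE scale0r addr0.
- move=> /(_ c) H; have /plinear2P[c0 [s [r cE]]] : plinear (col_mx a b) c.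
    apply: H; apply/plinear3P; split.
      apply/eqP => c0; have [|_ _ /eqP] := ind (s := 0) (r := 0) (q := 1).
        by rewrite c0 scaler0 !scale0r !addr0.
      by rewrite oner_eq0.
    by exists 0, 0, 1; rewrite !scale0r !add0r scale1r.
  have [|_ _ /eqP] := ind (s := s) (r := r) (q := - 1).
    by rewrite addrA -cE scaleN1r subrr.
  by rewrite oppr_eq0 oner_eq0.
Qed.

End Plane.

End PlanesAndScrolls.

(** * Scrolls of two skew lines *)

Section Scrolls.
Variables (K : fieldType) (n : nat).
Hypothesis natK : injective (fun k : nat => k%:R : K).
Variables a b a' b' : 'rV[K]_n.
Hypothesis ind : forall s r s' r', (s *: a + r *: b) + (s' *: a' + r' *: b') = 0 ->
  [/\ s = 0, r = 0, s' = 0 & r' = 0].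
Implicit Types x : 'rV[K]_n.

Definition scroll_pt (s r mu nu : K) : 'rV[K]_n :=
  mu *: (s *: a + r *: b) + nu *: (s *: a' + r *: b').

Definition scroll_set : set 'rV[K]_n :=
  [set x | x != 0 /\ exists s r mu nu, x = scroll_pt s r mu nu].

(** A 2 x 2 matrix with rows (s, r) and (s', r') and zero determinant is a column (mu, nu) times a
    row (s0, r0). *)
Lemma scroll_coords s r s' r' : s * r' = r * s' -> exists s0 r0 mu nu,
  (s *: a + r *: b) + (s' *: a' + r' *: b') = scroll_pt s0 r0 mu nu.
Proof.
move=> sr; have [s0|s0] := eqVneq s 0; last first.
  exists s, r, 1, (s' / s); rewrite /scroll_pt scale1r; congr (_ + _).
  rewrite scalerDr !scalerA divfK //; congr (_ + _ *: _).
  by apply: (mulfI s0); rewrite sr; field.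
have [r0|r0] := eqVneq r 0.
  by exists s', r', 0, 1; rewrite /scroll_pt s0 r0 !scale0r !add0r scale1r.
exists s, r, 1, (r' / r); rewrite /scroll_pt scale1r; congr (_ + _).
rewrite scalerDr !scalerA divfK //; congr (_ *: _ + _).
by apply: (mulfI r0); rewrite -sr; field.
Qed.

Let U : 'M[K]_((1 + 1) + (1 + 1), n) := col_mx (col_mx a b) (col_mx a' b').

Lemma mul_row4 (v1 v2 v3 v4 : 'rV[K]_1) :
  row_mx (row_mx v1 v2) (row_mx v3 v4) *m U =
  (v1 0 0 *: a + v2 0 0 *: b) + (v3 0 0 *: a' + v4 0 0 *: b').
Proof.
rewrite !mul_row_col [v1 in LHS]mx11_scalar [v2 in LHS]mx11_scalar.
by rewrite [v3 in LHS]mx11_scalar [v4 in LHS]mx11_scalar !mul_scalar_mx.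
Qed.

Lemma row_free4 : row_free U.
Proof.
rewrite -kermx_eq0; apply/eqP/row_matrixP => i; rewrite row0.
have : row i (kermx U) *m U = 0 by rewrite -row_mul mulmx_ker row0.
move: (row i _) => v; rewrite -[v]hsubmxK; move: (lsubmx v) (rsubmx v) => v1 v2.
rewrite -[v1]hsubmxK -[v2]hsubmxK; move: (lsubmx v1) (rsubmx v1) (lsubmx v2) (rsubmx v2).
move=> w1 w2 w3 w4; rewrite mul_row4 => /ind[e1 e2 e3 e4].
rewrite [w1]mx11_scalar [w2]mx11_scalar [w3]mx11_scalar [w4]mx11_scalar e1 e2 e3 e4.
by rewrite !raddf0 !row_mx0.
Qed.

(** In the 3-space spanned by a, b, a', b' the scroll is the quadric of vanishing determinant; a
    right inverse [N] of the basis matrix provides the coordinates as linear forms on the ambient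
    space. *)
Lemma zclosed_scroll : zclosed scroll_set.
Proof.
have /row_freeP[N UN] := row_free4.
pose i1 : 'I_((1 + 1) + (1 + 1)) := lshift (1 + 1) (lshift 1 (0 : 'I_1)).
pose i2 : 'I_((1 + 1) + (1 + 1)) := lshift (1 + 1) (rshift 1 (0 : 'I_1)).
pose i3 : 'I_((1 + 1) + (1 + 1)) := rshift (1 + 1) (lshift 1 (0 : 'I_1)).
pose i4 : 'I_((1 + 1) + (1 + 1)) := rshift (1 + 1) (rshift 1 (0 : 'I_1)).
pose f (i : 'I_((1 + 1) + (1 + 1))) x := (x *m N) 0 i.
have fU w1 w2 w3 w4 : let x := row_mx (row_mx w1 w2) (row_mx w3 w4) *m U in
    [/\ f i1 x = w1 0 0, f i2 x = w2 0 0, f i3 x = w3 0 0 & f i4 x = w4 0 0].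
  rewrite /f /= -mulmxA UN mulmx1.
  by split; rewrite ?row_mxEl ?row_mxEr ?row_mxEl ?row_mxEr.
pose q x := f i1 x * f i4 x - f i2 x * f i3 x.
have ff i : form 1 (f i) by apply: form_mulmx.
have qq : form 2 q.
  by apply: formB; apply: (formM (d := 1) (e := 1)).
rewrite [X in zclosed X](_ : _ = plinear U `&` [set x | x != 0 /\ q x = 0]).
  by apply: zclosedI; [exact: zclosed_plinear | exact: zclosed_form qq].
apply/seteqP; split=> x.
  move=> [x0 [s [r [mu [nu xE]]]]].
  have E : x = row_mx (row_mx (mu * s)%:M (mu * r)%:M)
      (row_mx (nu * s)%:M (nu * r)%:M) *m U.
    by rewrite mul_row4 !mxE eqxx !mulr1n xE /scroll_pt !scalerDr !scalerA.
  split; split=> //; first by rewrite E submxMl.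
  have [e1 e2 e3 e4] := fU (mu * s)%:M (mu * r)%:M (nu * s)%:M (nu * r)%:M.
  by rewrite /q E e1 e2 e3 e4 !mxE eqxx !mulr1n; ring.
move=> [[x0 /submxP[D xE]] [_ qx]]; split=> //; move: qx; rewrite {}xE.
rewrite -[D]hsubmxK; move: (lsubmx D) (rsubmx D) => v1 v2.
rewrite -[v1]hsubmxK -[v2]hsubmxK; move: (lsubmx v1) (rsubmx v1) (lsubmx v2) (rsubmx v2).
move=> w1 w2 w3 w4; rewrite /q; have [-> -> -> ->] := fU w1 w2 w3 w4; rewrite mul_row4.
move: (w1 0 0) (w2 0 0) (w3 0 0) (w4 0 0) => s r s' r' /eqP.
rewrite subr_eq0 => /eqP sr; exact: scroll_coords.
Qed.

Lemma ispath_scroll (s r mu nu : K -> K) : ispoly s -> ispoly r -> ispoly mu ->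
  ispoly nu -> ispath (fun u => scroll_pt (s u) (r u) (mu u) (nu u)).
Proof.
by move=> ? ? ? ?; apply: ispathD; apply: ispathZ => //; apply: ispathD; apply: ispathZ => //;
  exact: ispathC.
Qed.

Lemma scroll_in s r mu nu : scroll_pt s r mu nu != 0 -> scroll_set (scroll_pt s r mu nu).
Proof. by move=> x0; split=> //; exists s, r, mu, nu. Qed.

Lemma basis_neq0 : [/\ a != 0, b != 0, a' != 0 & b' != 0].
Proof.
by split; apply/eqP => e0;
 [have [|/eqP] := ind (s := 1) (r := 0) (s' := 0) (r' := 0)
 |have [|_ /eqP] := ind (s := 0) (r := 1) (s' := 0) (r' := 0)
 |have [|_ _ /eqP] := ind (s := 0) (r := 0) (s' := 1) (r' := 0)
 |have [|_ _ _ /eqP] := ind (s := 0) (r := 0) (s' := 0) (r' := 1)];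
 rewrite ?e0 ?scaler0 ?scale0r ?addr0 ?oner_eq0.
Qed.

(** Linear interpolation of the four parameters s, r, mu, nu joins any two points inside the
    scroll. *)
Lemma scroll_irreducible : irreducible_closed scroll_set.
Proof.
have [a0 _ _ _] := basis_neq0.
apply: (irreducible_paths natK zclosed_scroll).
  by exists a; split=> //; exists 1, 0, 1, 0; rewrite /scroll_pt !scale0r !addr0 !scale1r.
move=> x y [_ [s [r [mu [nu xE]]]]] [_ [s1 [r1 [mu1 [nu1 yE]]]]].
have pl (c d : K) : ispoly (fun u => c + u * (d - c)) by prove_ispoly.
exists (fun u => scroll_pt (s + u * (s1 - s)) (r + u * (r1 - r)) (mu + u * (mu1 - mu))
  (nu + u * (nu1 - nu))); split.
- by apply: ispath_scroll; apply: pl.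
- by rewrite !mul0r !addr0.
- by rewrite !mul1r ![_ + (_ - _)]addrC !subrK.
- by move=> u; apply: scroll_in.
Qed.

Lemma scroll_dim : has_dim scroll_set 2.
Proof.
have [a0 b0 a'0 b'0] := basis_neq0; have irr := scroll_irreducible.
have ch : charted 1 scroll_set (fun s r => scroll_pt 1 s 1 r).
  split.
  - move=> s i; apply: (dpoly_ext (g := fun u => (a 0 i + s * b 0 i)
      + u * (a' 0 i + s * b' 0 i))) => [u|]; first by rewrite !mxE; ring.
    apply: dpolyD; first exact: dpolyC.
    exact: (@dpolyM K 1 0 _ _ (dpolyX K) (dpolyC 0 _)).
  - move=> r i; apply: (dpoly_ext (g := fun u => (a 0 i + r * a' 0 i)
      + u * (b 0 i + r * b' 0 i))) => [u|]; first by rewrite !mxE; ring.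
    apply: dpolyD; first exact: dpolyC.
    exact: (@dpolyM K 1 0 _ _ (dpolyX K) (dpolyC 0 _)).
  - move=> d F dF F0 x [_ [s [r [mu [nu xE]]]]].
    have F1 s1 r1 mu1 nu1 : s1 != 0 -> mu1 != 0 -> F (scroll_pt s1 r1 mu1 nu1) = 0.
      move=> s0 mu0; have sm0 : (s1 * mu1)^-1 != 0 by rewrite invr_eq0 mulf_neq0.
      apply: (form_scale dF sm0).
      rewrite (_ : _ *: _ = scroll_pt 1 (r1 / s1) 1 (nu1 / mu1)) ?F0 //.
      by apply/rowP => i; rewrite !mxE; field; rewrite s0.
    have [f fd Ff] := dF.
    have pl (c e : K) : ispoly (fun u => c + u * (e - c)) by prove_ispoly.
    (* Points with s = 0 or mu = 0 lie outside the chart s = mu = 1; moving both parameters to 1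
       approaches them. *)
    pose w u := scroll_pt (s + u * (1 - s)) r (mu + u * (1 - mu)) nu.
    have pw : ispath w by apply: ispath_scroll => //; exact: ispolyC.
    have := ispoly_vanish natK (ispoly_meval f pw) (ispolyM (pl s 1) (pl mu 1)) (u0 := 1).
    rewrite !mul1r ![_ + (_ - _)]addrC !subrK mulr1 oner_neq0 => /(_ isT) H.
    have := H _ 0; rewrite -Ff /w !mul0r !addr0 -xE; apply=> u.
    by rewrite mulf_eq0 negb_or -Ff => /andP[su muu]; apply: F1.
apply: (has_dim2 natK (U1 := a) (U2 := col_mx a b) ch irr a0); split.
- move=> x /plinear1P[x0 [s xE]]; apply/plinear2P; split=> //.
  by exists s, 0; rewrite xE scale0r addr0.
- move=> /(_ b) H; have /plinear1P[_ [s bE]] : plinear a b.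
    apply: H; apply/plinear2P; split=> //.
    by exists 0, 1; rewrite scale0r add0r scale1r.
  have [|_ /eqP] := ind (s := s) (r := - 1) (s' := 0) (r' := 0).
    by rewrite -bE !scale0r !addr0 scaleN1r subrr.
  by rewrite oppr_eq0 oner_eq0.
- move=> x /plinear2P[x0 [s [r xE]]]; split=> //.
  by exists s, r, 1, 0; rewrite xE /scroll_pt scale0r addr0 scale1r.
- move=> /(_ a') H; have /plinear2P[_ [s [r cE]]] : plinear (col_mx a b) a'.
    apply: H; split=> //.
    by exists 1, 0, 0, 1; rewrite /scroll_pt !scale0r add0r addr0 !scale1r.
  have [|_ _ /eqP] := ind (s := s) (r := r) (s' := - 1) (r' := 0).
    by rewrite -cE scale0r addr0 scaleN1r subrr.
  by rewrite oppr_eq0 oner_eq0.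
Qed.

Lemma is_line_span (c d : 'rV[K]_n) : (forall s r, s *: c + r *: d = 0 -> s = 0 /\ r = 0) ->
  is_line (plinear (col_mx c d)).
Proof. by move=> cd; apply: (@is_plinear_free K n 1); apply: row_free2. Qed.

Lemma ind_ab s r : s *: a + r *: b = 0 -> s = 0 /\ r = 0.
Proof.
by move=> e; have [|-> ->] // := ind (s := s) (r := r) (s' := 0) (r' := 0);
  rewrite !scale0r !addr0.
Qed.

Lemma ind_ab' s r : s *: a' + r *: b' = 0 -> s = 0 /\ r = 0.
Proof.
by move=> e; have [|_ _ -> ->] // := ind (s := 0) (r := 0) (s' := s) (r' := r);
  rewrite !scale0r !add0r.
Qed.

(* An isomorphism of lines is determined by the images of three points. *)
Lemma scroll_is_scroll : is_scroll_of (plinear (col_mx a b)) (plinear (col_mx a' b'))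
  [:: (plinear a, plinear a'); (plinear (a + b), plinear (a' + b'));
      (plinear b, plinear b')] scroll_set.
Proof.
have [a0 b0 a'0 b'0] := basis_neq0.
have img (c d : 'rV[K]_n) (M : 'M[K]_n) : c != 0 -> d != 0 ->
    maps_point M (plinear c) (plinear d) -> exists2 l, l != 0 & c *m M = l *: d.
  move=> c0 d0 [p [p0 cp dp]].
  have /plinear1P[_ [k cE]] : plinear p c by rewrite -cp; apply/plinear1P; split=> //; exists 1; rewrite scale1r.
  have /plinear1P[_ [l dE]] : plinear (p *m M) d by rewrite -dp; apply/plinear1P; split=> //; exists 1; rewrite scale1r.
  have l0 : l != 0 by apply: contraNneq d0 => l0; rewrite dE l0 scale0r.
  have k0 : k != 0 by apply: contraNneq c0 => k0; rewrite cE k0 scale0r.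
  exists (k / l); first by rewrite mulf_neq0 ?invr_eq0.
  by rewrite cE -scalemxAl dE scalerA divfK.
have ab0 : a + b != 0.
  apply/eqP => e; have [|/eqP] := @ind_ab 1 1; first by rewrite !scale1r.
  by rewrite oner_eq0.
have ab'0 : a' + b' != 0.
  apply/eqP => e; have [|/eqP] := @ind_ab' 1 1; first by rewrite !scale1r.
  by rewrite oner_eq0.
split.
  (* [N] reads off the coordinates with respect to a and b, so M sends a to a' and b to b'. *)
  have /row_freeP[N UN] := row_free2 ind_ab.
  pose M := N *m col_mx a' b'.
  have UM : col_mx a b *m M = col_mx a' b' by rewrite mulmxA UN mul1mx.
  have [aM bM] : a *m M = a' /\ b *m M = b'.
    by move: UM; rewrite mul_col_mx => /eq_col_mx.
  exists M; split.
    split; [exact: is_line_span ind_ab|exact: is_line_span ind_ab'|].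
    have sM s r : (s *: a + r *: b) *m M = s *: a' + r *: b'.
      by rewrite mulmxDl -!scalemxAl aM bM.
    apply/seteqP; split=> x.
      move=> [p /plinear2P[p0 [s [r pE]]] <-]; apply/plinear2P.
      rewrite pE sM; split; last by exists s, r.
      apply: contraNneq p0 => /ind_ab'[s0 r0].
      by rewrite pE s0 r0 !scale0r addr0.
    move=> /plinear2P[x0 [s [r xE]]]; exists (s *: a + r *: b); last by rewrite sM xE.
    apply/plinear2P; split; last by exists s, r.
    apply: contraNneq x0 => /ind_ab[s0 r0].
    by rewrite xE s0 r0 !scale0r addr0.
  apply/forall_cons; split; first by exists a; rewrite aM.
  apply/forall_cons; split; first by exists (a + b); rewrite mulmxDl aM bM.
  apply/forall_cons; split; first by exists b; rewrite bM.
  by [].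
move=> M [_ NN].
have [/= maps_a [maps_ab [maps_b _]]] : maps_point M (plinear a) (plinear a') /\
    maps_point M (plinear (a + b)) (plinear (a' + b')) /\
    maps_point M (plinear b) (plinear b') /\ True.
  have /forall_cons[h1 /forall_cons[h2 /forall_cons[h3 _]]] := NN.
  by split; [exact: h1|split; [exact: h2|split; [exact: h3|]]].
have [la la0 aM] := img _ _ _ a0 a'0 maps_a.
have [lb lb0 bM] := img _ _ _ b0 b'0 maps_b.
have [lc lc0 abM] := img _ _ _ ab0 ab'0 maps_ab.
(* The vectors a, b, a + b go to multiples of a', b', a' + b'; independence of a' and b' makes the
   three multipliers equal, so on the first line M is lc times the map sending a to a' and b to
   b'. *)
have [lac lbc] : la = lc /\ lb = lc.
  have [|ac bc] := @ind_ab' (la - lc) (lb - lc).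
    rewrite !scalerBl addrACA -opprD -scalerDr -abM mulmxDl aM bM.
    by rewrite subrr.
  by move/eqP: ac; move/eqP: bc; rewrite !subr_eq0 => /eqP -> /eqP ->.
have sM s r : (s *: a + r *: b) *m M = lc *: (s *: a' + r *: b').
  by rewrite mulmxDl -!scalemxAl aM bM lac lbc scalerDr !scalerA ![lc * _]mulrC.
apply/seteqP; split=> x.
  move=> [x0 [s [r [mu [nu xE]]]]]; exists (s *: a + r *: b).
    apply/plinear2P; split; last by exists s, r.
    apply: contraNneq x0 => /ind_ab[s0 r0].
    by rewrite xE /scroll_pt s0 r0 !scale0r !addr0 !scaler0 addr0.
  apply/plinear2P; split=> //; exists mu, (nu / lc).
  by rewrite sM scalerA divfK.
move=> [p /plinear2P[p0 [s [r pE]]] /plinear2P[x0 [mu [nu xE]]]]; split=> //.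
exists s, r, mu, (nu * lc).
by rewrite xE pE sM scalerA.
Qed.

End Scrolls.

(** * The nodal sections *)

Section NodalSection.
Variable K : fieldType.
Implicit Types (t : K * K) (x : 'rV[K]_16).

Lemma ptD t z1 z2 z3 z4 z5 z6 z7 w1 w2 w3 w4 w5 w6 w7 :
  pt t z1 z2 z3 z4 z5 z6 z7 + pt t w1 w2 w3 w4 w5 w6 w7 =
  pt t (z1 + w1) (z2 + w2) (z3 + w3) (z4 + w4) (z5 + w5) (z6 + w6) (z7 + w7).
Proof.
rewrite -[pt t z1 _ _ _ _ _ _]scale1r -[pt t w1 _ _ _ _ _ _]scale1r pt_comb.
by congr pt; rewrite !mul1r.
Qed.

Lemma pt0 t : pt t 0 0 0 0 0 0 0 = 0.
Proof.
by have := pt_scale t 0 0 0 0 0 0 0 0; rewrite scale0r !mul0r.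
Qed.

Lemma coD x x' k : co (x + x') k = co x k + co x' k.
Proof. by rewrite /co mxE. Qed.

Lemma coZ (c : K) x k : co (c *: x) k = c * co x k.
Proof. by rewrite /co mxE. Qed.

Lemma co_delta I k : (index I even_sets < 16)%N -> (k < 16)%N ->
  co (delta_mx 0 (even_index I) : 'rV[K]_16) k = (k == index I even_sets)%:R.
Proof.
by move=> I16 k16; rewrite /co mxE eqxx /= -val_eqE /= !inordK.
Qed.

Lemma Pnod_row t k : (k < 7)%N -> (Pnod_basis t)`_k =
  pt t (k == 0%N)%:R (k == 1%N)%:R (k == 2%N)%:R (k == 3%N)%:R (k == 4%N)%:R
    (k == 5%N)%:R (k == 6%N)%:R.
Proof.
rewrite /Pnod_basis.
have v0 j (j16 : (j < 16)%N) : co (e2 K 1 2) j = (j == 1%N)%:R by exact: (@co_delta [:: 1; 2]%N j isT j16).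
have v1 j (j16 : (j < 16)%N) : co (e2 K 1 3) j = (j == 2%N)%:R by exact: (@co_delta [:: 1; 3]%N j isT j16).
have v2 j (j16 : (j < 16)%N) : co (e2 K 2 4) j = (j == 6%N)%:R by exact: (@co_delta [:: 2; 4]%N j isT j16).
have v3 j (j16 : (j < 16)%N) : co (e2 K 3 4) j = (j == 8%N)%:R by exact: (@co_delta [:: 3; 4]%N j isT j16).
have v4 j (j16 : (j < 16)%N) : co (e0 K) j = (j == 0%N)%:R by exact: (@co_delta [::] j isT j16).
have v5 j (j16 : (j < 16)%N) : co (e2 K 1 5) j = (j == 4%N)%:R by exact: (@co_delta [:: 1; 5]%N j isT j16).
have v6 j (j16 : (j < 16)%N) : co (e2 K 2 3) j = (j == 5%N)%:R by exact: (@co_delta [:: 2; 3]%N j isT j16).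
have v7 j (j16 : (j < 16)%N) : co (e2 K 2 5) j = (j == 7%N)%:R by exact: (@co_delta [:: 2; 5]%N j isT j16).
have v8 j (j16 : (j < 16)%N) : co (e2 K 3 5) j = (j == 9%N)%:R by exact: (@co_delta [:: 3; 5]%N j isT j16).
have v9 j (j16 : (j < 16)%N) : co (e2 K 4 5) j = (j == 10%N)%:R by exact: (@co_delta [:: 4; 5]%N j isT j16).
have v10 j (j16 : (j < 16)%N) : co (e4 K 1 2 3 5) j = (j == 12%N)%:R by exact: (@co_delta [:: 1; 2; 3; 5]%N j isT j16).
have v11 j (j16 : (j < 16)%N) : co (e4 K 1 3 4 5) j = (j == 14%N)%:R by exact: (@co_delta [:: 1; 3; 4; 5]%N j isT j16).
move: (e2 K 1 2) v0 => w0 v0.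
move: (e2 K 1 3) v1 => w1 v1.
move: (e2 K 2 4) v2 => w2 v2.
move: (e2 K 3 4) v3 => w3 v3.
move: (e0 K) v4 => w4 v4.
move: (e2 K 1 5) v5 => w5 v5.
move: (e2 K 2 3) v6 => w6 v6.
move: (e2 K 2 5) v7 => w7 v7.
move: (e2 K 3 5) v8 => w8 v8.
move: (e2 K 4 5) v9 => w9 v9.
move: (e4 K 1 2 3 5) v10 => w10 v10.
move: (e4 K 1 3 4 5) v11 => w11 v11.
by case: k => [|[|[|[|[|[|[|//]]]]]]] _; apply: co_inj => k k16; rewrite co_pt //=;
  rewrite ?coD ?coZ ?v0 ?v1 ?v2 ?v3 ?v4 ?v5 ?v6 ?v7 ?v8 ?v9 ?v10 ?v11 //;
  move: k k16; apply: eq16; rewrite /=; ring.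
Qed.

Lemma PnodP t x : Pnod t x <-> x != 0 /\ exists z1 z2 z3 z4 z5 z6 z7,
  x = pt t z1 z2 z3 z4 z5 z6 z7.
Proof.
have rowE (D : 'rV[K]_7) : D *m (\matrix_(k < 7) (Pnod_basis t)`_k) =
    pt t (co D 0) (co D 1) (co D 2) (co D 3) (co D 4) (co D 5) (co D 6).
  rewrite mulmx_sum_row.
  have -> : \sum_i D 0 i *: row i (\matrix_(k < 7) (Pnod_basis t)`_k) =
      \sum_(i < 7) co D i *: pt t (i == 0%N :> nat)%:R (i == 1%N :> nat)%:R
        (i == 2%N :> nat)%:R (i == 3%N :> nat)%:R (i == 4%N :> nat)%:R
        (i == 5%N :> nat)%:R (i == 6%N :> nat)%:R.
    by apply: eq_bigr => i _; rewrite rowK Pnod_row // /co inord_val.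
  rewrite !big_ord_recl big_ord0 !pt_scale -(pt0 t) !ptD /=.
  by congr pt; rewrite /bump /=; ring.
rewrite /Pnod /plinear; split=> -[x0].
  by move=> /submxP[D xE]; split=> //; rewrite xE rowE; do 7 eexists.
move=> [z1 [z2 [z3 [z4 [z5 [z6 [z7 xE]]]]]]]; split=> //; apply/submxP.
by exists (row7 [:: z1; z2; z3; z4; z5; z6; z7]); rewrite rowE !co_row7.
Qed.

(** Each equation of OG(5, 10) loses its terms in x_14, x_1234, x_1245 and x_2345, which vanish on
    P_nod. *)
Lemma Y_pt t z1 z2 z3 z4 z5 z6 z7 : let d := t.1 - t.2 in
  Y t (pt t z1 z2 z3 z4 z5 z6 z7) <-> pt t z1 z2 z3 z4 z5 z6 z7 != 0 /\
  [/\ [/\ - (t.2 * z4 + z5) * z5 + z2 * (t.1 * z4) - (t.2 * z4 + z5) * z3 = 0,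
        z1 * z7 = 0,
        (t.1 * t.2 - t.2 ^+ 2) * z4 * z7 - z1 * z5 - d * z4 * z3 = 0,
        z2 * z6 = 0 & z1 * z5 + d * z4 * z2 = 0] &
      [/\ z3 * z6 = (t.2 * z4 + z5) * z7,
        (t.1 * t.2 - t.2 ^+ 2) * z4 * z6 - z1 * (t.1 * z4) + z1 * (t.2 * z4 + z5)
          - d * z4 * (t.2 * z4 + z5) = 0,
        z2 * z7 = 0, z1 * z2 = z1 * z3 & (t.2 * z4 + z5) * z7 + z5 * z6 = 0]].
Proof.
move=> d; set x := pt t z1 z2 z3 z4 z5 z6 z7.
have E0 : x0 x = (t.1 * t.2 - t.2 ^+ 2) * z4 by rewrite -[LHS]/(co x 0) co_pt.
have E12 : x2 x 1 2 = z1 by rewrite -[LHS]/(co x 1) co_pt.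
have E13 : x2 x 1 3 = z1 by rewrite -[LHS]/(co x 2) co_pt.
have E14 : x2 x 1 4 = 0 by rewrite -[LHS]/(co x 3) co_pt.
have E15 : x2 x 1 5 = d * z4 by rewrite -[LHS]/(co x 4) co_pt.
have E23 : x2 x 2 3 = t.2 * z4 + z5 by rewrite -[LHS]/(co x 5) co_pt.
have E24 : x2 x 2 4 = z2 by rewrite -[LHS]/(co x 6) co_pt.
have E25 : x2 x 2 5 = t.2 * z4 + z5 by rewrite -[LHS]/(co x 7) co_pt.
have E34 : x2 x 3 4 = z3 by rewrite -[LHS]/(co x 8) co_pt.
have E35 : x2 x 3 5 = t.1 * z4 by rewrite -[LHS]/(co x 9) co_pt.
have E45 : x2 x 4 5 = z5 by rewrite -[LHS]/(co x 10) co_pt.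
have E1234 : x4 x 1 2 3 4 = 0 by rewrite -[LHS]/(co x 11) co_pt.
have E1235 : x4 x 1 2 3 5 = z6 by rewrite -[LHS]/(co x 12) co_pt.
have E1245 : x4 x 1 2 4 5 = 0 by rewrite -[LHS]/(co x 13) co_pt.
have E1345 : x4 x 1 3 4 5 = z7 by rewrite -[LHS]/(co x 14) co_pt.
have E2345 : x4 x 2 3 4 5 = 0 by rewrite -[LHS]/(co x 15) co_pt.
have sw (u v : K) (P : Prop) : u = v -> (u = 0 <-> P) -> (v = 0 <-> P) by move=> ->.
rewrite /Y /OG510 /=.
split.
  move=> [_ [x0 []]].
  rewrite E0 E12 E13 E14 E15 E23 E24 E25 E34 E35 E45 E1234 E1235 E1245 E1345 E2345.
  move=> [h1 h2 h3 h4 h5] [h6 h7 h8 h9 h10]; split=> //; split; split.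
  - by rewrite -[RHS]h1; ring.
  - by rewrite -[RHS]h2; ring.
  - by rewrite -[RHS]h3; ring.
  - by rewrite -[RHS]h4; ring.
  - by rewrite -[RHS]oppr0 -[in RHS]h5; ring.
  - by apply/eqP; rewrite -subr_eq0 -[X in _ == X]h6; apply/eqP; ring.
  - by rewrite -[RHS]h7; ring.
  - by rewrite -[RHS]oppr0 -[in RHS]h8; ring.
  - by apply/eqP; rewrite -subr_eq0 -[X in _ == X]h9; apply/eqP; ring.
  - by rewrite -[RHS]oppr0 -[in RHS]h10; ring.
move=> [x0 [[h1 h2 h3 h4 h5] [h6 h7 h8 h9 h10]]]; split.
  by apply/PnodP; split=> //; do 7 eexists.
split=> //.
rewrite E0 E12 E13 E14 E15 E23 E24 E25 E34 E35 E45 E1234 E1235 E1245 E1345 E2345.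
split; split.
- by rewrite -[RHS]h1; ring.
- by rewrite -[RHS]h2; ring.
- by rewrite -[RHS]h3; ring.
- by rewrite -[RHS]h4; ring.
- by rewrite -[RHS]oppr0 -[in RHS]h5; ring.
- by rewrite -[RHS](subrr (z3 * z6)) [in RHS]h6; rewrite -?h6; ring.
- by rewrite -[RHS]h7; ring.
- by rewrite -[RHS]oppr0 -[in RHS]h8; ring.
- by rewrite -[RHS](subrr (z1 * z3)) -[in X in _ = X - _]h9; ring.
- by rewrite -[RHS]oppr0 -[in RHS]h10; ring.
Qed.

End NodalSection.

Section CoordinateTactics.
Variable K : fieldType.

Lemma eq_lin (u v a b : K) : a = b -> u - v = a - b -> u = v.
Proof. by move=> -> /eqP; rewrite subrr subr_eq0 => /eqP. Qed.

Lemma eq_linN (u v a b : K) : a = b -> u - v = b - a -> u = v.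
Proof. by move=> -> /eqP; rewrite subrr subr_eq0 => /eqP. Qed.

Lemma absurd_lin (k a b : K) : k != 0 -> a = b -> k = a - b -> False.
Proof. by move=> k0 -> /eqP; rewrite subrr (negbTE k0). Qed.

End CoordinateTactics.

(** Closes a goal that is, up to sign, a rearrangement of the equation h modulo the ring laws. *)
Ltac by_eq h := solve [apply: (eq_lin h); ring | apply: (eq_linN h); ring].

Ltac by_eqs := solve [ring | match goal with H : _ = _ |- _ => by_eq H end].

(** * The section at t = 1 *)

Section NodalSectionAtOne.
Variable K : fieldType.
Hypothesis natK : injective (fun k : nat => k%:R : K).
Notation one := ((1, 1) : K * K).
Implicit Types x : 'rV[K]_16.
Let o0 : one.1 != 0 := oner_neq0 K.

Definition plane_0_9 : set 'rV[K]_16 := plinear (col_mx (pt one 0 0 1 0 0 0 0)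
  (col_mx (pt one 0 0 0 0 0 0 1) (pt one 0 0 0 1 (- 1) 0 0))).
Definition plane_2_4 : set 'rV[K]_16 := plinear (col_mx (pt one 1 0 0 0 0 0 0)
  (col_mx (pt one 0 1 1 0 0 0 0) (pt one (- 1) 0 0 1 0 0 0))).
Definition plane_5_11 : set 'rV[K]_16 := plinear (col_mx (pt one 1 0 0 0 0 0 0)
  (col_mx (pt one 0 0 0 0 0 1 0) (pt one (- 1) 0 0 1 0 0 0))).
Definition scroll_1_10_3 : set 'rV[K]_16 := scroll_set (pt one 0 0 1 0 0 0 0)
  (pt one 0 1 0 0 0 0 0) (L3a K) (L3b K).
(** The four vectors represent the nodes 5-6, 6-9, 8-11 and 0-8; the signs of the second and fourth
    make the sums along the two lines represent 6-7 and 7-8. *)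
Definition scroll_6_7_8 : set 'rV[K]_16 := scroll_set (pt one 0 0 0 1 0 1 0)
  (pt one 0 0 (- 1) (- 1) 1 0 (- 1)) (pt one 0 0 0 0 0 1 0) (pt one 0 0 0 0 0 0 (- 1)).

Lemma plane_0_9P x : plane_0_9 x <->
  x != 0 /\ exists z3 z4 z7, x = pt one 0 0 z3 z4 (- z4) 0 z7.
Proof.
rewrite /plane_0_9; split=> [/plinear3P[x0 [s [r [q xE]]]]|[x0 [z3 [z4 [z7 xE]]]]].
  by split=> //; exists s, q, r; rewrite xE !pt_scale !ptD; congr pt; ring.
by apply/plinear3P; split=> //; exists z3, z7, z4; rewrite xE !pt_scale !ptD; congr pt; ring.
Qed.

Lemma plane_2_4P x : plane_2_4 x <->
  x != 0 /\ exists z1 z2 z4, x = pt one z1 z2 z2 z4 0 0 0.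
Proof.
rewrite /plane_2_4; split=> [/plinear3P[x0 [s [r [q xE]]]]|[x0 [z1 [z2 [z4 xE]]]]].
  by split=> //; exists (s - q), r, q; rewrite xE !pt_scale !ptD; congr pt; ring.
apply/plinear3P; split=> //; exists (z1 + z4), z2, z4.
by rewrite xE !pt_scale !ptD; congr pt; ring.
Qed.

Lemma plane_5_11P x : plane_5_11 x <->
  x != 0 /\ exists z1 z4 z6, x = pt one z1 0 0 z4 0 z6 0.
Proof.
rewrite /plane_5_11; split=> [/plinear3P[x0 [s [r [q xE]]]]|[x0 [z1 [z4 [z6 xE]]]]].
  by split=> //; exists (s - q), q, r; rewrite xE !pt_scale !ptD; congr pt; ring.
apply/plinear3P; split=> //; exists (z1 + z4), z6, z4.
by rewrite xE !pt_scale !ptD; congr pt; ring.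
Qed.

Lemma scroll_1_10_3P x : scroll_1_10_3 x <-> x != 0 /\ exists z2 z3 z4 z5,
  x = pt one 0 z2 z3 z4 z5 0 0 /\ z4 * (z2 - z3 - z5) = z5 * (z5 + z3).
Proof.
split=> -[x0].
  move=> [s [r [mu [nu xE]]]]; split=> //.
  exists (mu * r + nu * r), (mu * s + nu * r), (- (nu * s)), (nu * s - nu * r).
  split; last by ring.
  by rewrite xE /scroll_pt /L3a /L3b !(pt_scale, ptD); congr pt; ring.
move=> [z2 [z3 [z4 [z5 [xE q0]]]]]; split=> //.
(* The vanishing determinant: in the basis of the scroll x has coordinates (z_3 + z_4 + z_5, z_2 +
   z_4 + z_5) and (- z_4, - z_4 - z_5). *)
have E : (z3 + z4 + z5) * (- z4 - z5) = (z2 + z4 + z5) * (- z4) by by_eq q0.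
have [s [r [mu [nu srE]]]] := scroll_coords (pt one 0 0 1 0 0 0 0)
  (pt one 0 1 0 0 0 0 0) (L3a K) (L3b K) E.
exists s, r, mu, nu; rewrite -srE xE /L3a /L3b !(pt_scale, ptD).
by congr pt; ring.
Qed.

Lemma scroll_6_7_8P x : scroll_6_7_8 x <-> x != 0 /\ exists z3 z4 z6 z7,
  x = pt one 0 0 z3 z4 (- z3) z6 z7 /\ (z4 - z3) * z7 = z3 * z6.
Proof.
split=> -[x0].
  move=> [s [r [mu [nu xE]]]]; split=> //.
  exists (- (mu * r)), (mu * s - mu * r), (mu * s + nu * s), (- (mu * r) - nu * r).
  split; last by ring.
  by rewrite xE /scroll_pt !(pt_scale, ptD); congr pt; ring.
move=> [z3 [z4 [z6 [z7 [xE q0]]]]]; split=> //.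
(* Here the coordinates are (z_4 - z_3, - z_3) and (z_6 - z_4 + z_3, z_3 - z_7). *)
have E : (z4 - z3) * (z3 - z7) = - z3 * (z6 - z4 + z3) by by_eq q0.
have [s [r [mu [nu srE]]]] := scroll_coords (pt one 0 0 0 1 0 1 0)
  (pt one 0 0 (- 1) (- 1) 1 0 (- 1)) (pt one 0 0 0 0 0 1 0) (pt one 0 0 0 0 0 0 (- 1)) E.
exists s, r, mu, nu; rewrite -srE xE !(pt_scale, ptD).
by congr pt; ring.
Qed.

Lemma Y_oneE : Y one = plane_0_9 `|` (scroll_1_10_3 `|` (plane_2_4 `|` (plane_5_11 `|` scroll_6_7_8))).
Proof.
apply/seteqP; split=> x.
  move=> Yx; have [/PnodP[x0 [z1 [z2 [z3 [z4 [z5 [z6 [z7 xE]]]]]]]] _] := Yx.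
  rewrite xE in x0 Yx; have /Y_pt[_ /=] := Yx; rewrite subrr !mul1r.
  move=> [[h1 h2 h3 h4 h5] [h6 h7 h8 h9 h10]]; rewrite xE.
  have h15 : z1 * z5 = 0 by by_eq h5.
  have h1' : z4 * (z2 - z3 - z5) = z5 * (z5 + z3) by by_eq h1.
  have h11 : z6 * (z3 + z5) = 0.
    by move: h10; rewrite -h6 => h10; by_eq h10.
  have [z10|z10] := eqVneq z1 0; last first.
    right; right; have z50 : z5 = 0 by apply: (mulfI z10); rewrite mulr0.
    have z70 : z7 = 0 by apply: (mulfI z10); rewrite mulr0.
    have z23 : z2 = z3 by exact: (mulfI z10).
    have [z20|z20] := eqVneq z2 0.
      right; left; apply/plane_5_11P; split=> //; exists z1, z4, z6.
      by rewrite -z23 z20 z50 z70.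
    left; apply/plane_2_4P; split=> //; exists z1, z2, z4.
    by rewrite -z23 z50 z70; congr pt; apply: (mulfI z20); rewrite mulr0.
  have [z20|z20] := eqVneq z2 0; last first.
    right; left; apply/scroll_1_10_3P; split=> //; exists z2, z3, z4, z5; split=> //.
    by rewrite z10; congr pt; apply: (mulfI z20); rewrite mulr0.
  have h12 : (z4 + z5) * (z5 + z3) = 0.
    by apply: (eq_linN h1'); rewrite z20; ring.
  have [z35|z35] := eqVneq (z3 + z5) 0.
    have z5E : z5 = - z3 by by_eq z35.
    do 4 right; apply/scroll_6_7_8P; split=> //; exists z3, z4, z6, z7.
    rewrite z10 z20 z5E; split=> //.
    by rewrite h6 z5E.
  have z60 : z6 = 0 by apply: (mulIf z35); rewrite mul0r.
  have z5E : z5 = - z4.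
    have e : z4 + z5 = 0 by apply: (mulIf z35); rewrite mul0r [z3 + _]addrC.
    by by_eq e.
  left; apply/plane_0_9P; split=> //; exists z3, z4, z7.
  by rewrite z10 z20 z60 z5E.
move=> [/plane_0_9P[x0 [z3 [z4 [z7 xE]]]]|[/scroll_1_10_3P[x0 [z2 [z3 [z4 [z5 [xE q0]]]]]]|
  [/plane_2_4P[x0 [z1 [z2 [z4 xE]]]]|[/plane_5_11P[x0 [z1 [z4 [z6 xE]]]]|
  /scroll_6_7_8P[x0 [z3 [z4 [z6 [z7 [xE q0]]]]]]]]]];
  rewrite xE; apply/Y_pt; rewrite -xE; split=> //=;
  split; split; by_eqs.
Qed.

End NodalSectionAtOne.

Lemma plinear2_left (K : fieldType) n (a b : 'rV[K]_n) : a != 0 ->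
  plinear (col_mx a b) a.
Proof.
by move=> a0; apply/plinear2P; split=> //; exists 1, 0; rewrite scale0r addr0 scale1r.
Qed.

Lemma plinear2_right (K : fieldType) n (a b : 'rV[K]_n) : b != 0 ->
  plinear (col_mx a b) b.
Proof. by rewrite plinear_swap; apply: plinear2_left. Qed.

Ltac pt_nonzero t0 := apply: (pt_neq0 t0 erefl); rewrite /= ?oppr_eq0 ?oner_eq0 ?orbT //.

Ltac pt_absurd k0 := exfalso; subst;
  match goal with H : _ = _ |- _ =>
    solve [apply: (absurd_lin k0 H); ring | apply: (absurd_lin k0 (esym H)); ring]
  end.

(** * Irreducibility, dimension and distinctness of the components at t = 1 *)

Section ComponentsAtOne.
Variable K : fieldType.
Hypothesis natK : injective (fun k : nat => k%:R : K).
Notation one := ((1, 1) : K * K).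
Implicit Types x : 'rV[K]_16.
Let o0 : one.1 != 0 := oner_neq0 K.

Lemma plane_0_9_free s r q : s *: pt one 0 0 1 0 0 0 0 +
  (r *: pt one 0 0 0 0 0 0 1 + q *: pt one 0 0 0 1 (- 1) 0 0) = 0 ->
  [/\ s = 0, r = 0 & q = 0].
Proof.
rewrite !(pt_scale, ptD) -(pt0 one) => /(pt_inj o0)[h1 h2 h3 h4 [h5 h6 h7]].
by split; [by_eq h3|by_eq h7|by_eq h4].
Qed.

Lemma plane_2_4_free s r q : s *: pt one 1 0 0 0 0 0 0 +
  (r *: pt one 0 1 1 0 0 0 0 + q *: pt one (- 1) 0 0 1 0 0 0) = 0 ->
  [/\ s = 0, r = 0 & q = 0].
Proof.
rewrite !(pt_scale, ptD) -(pt0 one) => /(pt_inj o0)[h1 h2 h3 h4 [h5 h6 h7]].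
have q0 : q = 0 by by_eq h4.
by rewrite q0 in h1 *; split; [by_eq h1|by_eq h2|].
Qed.

Lemma plane_5_11_free s r q : s *: pt one 1 0 0 0 0 0 0 +
  (r *: pt one 0 0 0 0 0 1 0 + q *: pt one (- 1) 0 0 1 0 0 0) = 0 ->
  [/\ s = 0, r = 0 & q = 0].
Proof.
rewrite !(pt_scale, ptD) -(pt0 one) => /(pt_inj o0)[h1 h2 h3 h4 [h5 h6 h7]].
have q0 : q = 0 by by_eq h4.
by rewrite q0 in h1 *; split; [by_eq h1|by_eq h6|].
Qed.

Lemma scroll_1_10_3_free s r s' r' : (s *: pt one 0 0 1 0 0 0 0 + r *: pt one 0 1 0 0 0 0 0) +
  (s' *: L3a K + r' *: L3b K) = 0 -> [/\ s = 0, r = 0, s' = 0 & r' = 0].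
Proof.
rewrite /L3a /L3b !(pt_scale, ptD) -(pt0 one) => /(pt_inj o0)[h1 h2 h3 h4 [h5 h6 h7]].
have s'0 : s' = 0 by by_eq h4.
rewrite s'0 in h2 h3 h5 *; have r'0 : r' = 0 by by_eq h5.
by rewrite r'0 in h2 h3 *; split; [by_eq h3|by_eq h2| |].
Qed.

Lemma scroll_6_7_8_free s r s' r' :
  (s *: pt one 0 0 0 1 0 1 0 + r *: pt one 0 0 (- 1) (- 1) 1 0 (- 1)) +
  (s' *: pt one 0 0 0 0 0 1 0 + r' *: pt one 0 0 0 0 0 0 (- 1)) = 0 ->
  [/\ s = 0, r = 0, s' = 0 & r' = 0].
Proof.
rewrite !(pt_scale, ptD) -(pt0 one) => /(pt_inj o0)[h1 h2 h3 h4 [h5 h6 h7]].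
have r0 : r = 0 by by_eq h5.
rewrite r0 in h4 h6 h7 *; have s0 : s = 0 by by_eq h4.
by rewrite s0 in h6 h7 *; split; [| |by_eq h6|by_eq h7].
Qed.

Definition Y_one_components : seq (set 'rV[K]_16) :=
  [:: @plane_0_9 K; @scroll_1_10_3 K; @plane_2_4 K; @plane_5_11 K; @scroll_6_7_8 K].


Lemma has_components_Y_one : has_components (Y one) Y_one_components.
Proof.
pose p := [:: pt one 0 0 0 1 (- 1) 0 1; pt one 0 1 0 0 0 0 0; pt one 1 1 1 0 0 0 0;
  pt one 1 0 0 0 0 1 0; pt one 0 0 1 (1 + 1) (- 1) 1 1].
apply: (has_components_witness (p := nth 0 p)).
- apply/forall_cons; split; first exact: (plane_irreducible natK plane_0_9_free).
  apply/forall_cons; split; first exact: (scroll_irreducible natK scroll_1_10_3_free).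
  apply/forall_cons; split; first exact: (plane_irreducible natK plane_2_4_free).
  apply/forall_cons; split; first exact: (plane_irreducible natK plane_5_11_free).
  apply/forall_cons; split; first exact: (scroll_irreducible natK scroll_6_7_8_free).
  by [].
- rewrite Y_oneE; apply/seteqP; split=> x.
    move=> [?|[?|[?|[?|?]]]];
    [exists (@plane_0_9 K)|exists (@scroll_1_10_3 K)|exists (@plane_2_4 K)|exists (@plane_5_11 K)|exists (@scroll_6_7_8 K)];
    by rewrite //= !inE eqxx ?orbT.
  move=> [Z /=]; rewrite !inE => /or4P[|||/orP[]] /eqP -> Zx;
    [left|right; left|do 2 right; left|do 3 right; left|do 4 right] => //.
- case=> [|[|[|[|[|//]]]]] _ /=.
  + by apply/plane_0_9P; split; [pt_nonzero o0|exists 0, 1, 1].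
  + apply/scroll_1_10_3P; split; [pt_nonzero o0|exists 1, 0, 0, 0; split=> //; ring].
  + by apply/plane_2_4P; split; [pt_nonzero o0|exists 1, 1, 0].
  + by apply/plane_5_11P; split; [pt_nonzero o0|exists 1, 0, 1].
  + apply/scroll_6_7_8P; split; [pt_nonzero o0|exists 1, (1 + 1), 1, 1; split=> //; ring].
- case=> [|[|[|[|[|//]]]]] [|[|[|[|[|//]]]]] _ _ //=;
  first [move=> /plane_0_9P[_ [? [? [? /(pt_inj o0)[? ? ? ? [? ? ?]]]]]]
        |move=> /plane_2_4P[_ [? [? [? /(pt_inj o0)[? ? ? ? [? ? ?]]]]]]
        |move=> /plane_5_11P[_ [? [? [? /(pt_inj o0)[? ? ? ? [? ? ?]]]]]]
        |move=> /scroll_1_10_3P[_ [? [? [? [? [/(pt_inj o0)[? ? ? ? [? ? ?]] _]]]]]]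
        |move=> /scroll_6_7_8P[_ [? [? [? [? [/(pt_inj o0)[? ? ? ? [? ? ?]] _]]]]]]];
  pt_absurd (oner_neq0 K).
Qed.

Lemma has_dim_Y_one Z : Z \in Y_one_components -> has_dim Z 2.
Proof.
move: Z; apply/forall_cons; split; first exact: (plane_dim natK plane_0_9_free).
apply/forall_cons; split; first exact: (scroll_dim natK scroll_1_10_3_free).
apply/forall_cons; split; first exact: (plane_dim natK plane_2_4_free).
apply/forall_cons; split; first exact: (plane_dim natK plane_5_11_free).
by apply/forall_cons; split; first exact: (scroll_dim natK scroll_6_7_8_free).
Qed.

End ComponentsAtOne.

(** * The lines of X_1 inside the components *)

Section LinesAtOne.
Variable K : fieldType.
Hypothesis natK : injective (fun k : nat => k%:R : K).
Notation one := ((1, 1) : K * K).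
Implicit Types x : 'rV[K]_16.
Let o0 : one.1 != 0 := oner_neq0 K.

Lemma is_line_L3 : is_line (@L3 K).
Proof.
apply: is_line_span => s r.
rewrite /L3a /L3b !(pt_scale, ptD) -(pt0 one) => /(pt_inj o0)[h1 h2 h3 h4 [h5 h6 h7]].
by split; [by_eq h4|by_eq h2].
Qed.

Lemma is_line_L4 : is_line (@L4 K).
Proof.
apply: is_line_span => s r.
rewrite /L4a /L4b !(pt_scale, ptD) -(pt0 one) => /(pt_inj o0)[h1 h2 h3 h4 [h5 h6 h7]].
by split; [by_eq h2|by_eq h4].
Qed.

Lemma L3P x : L3 x <->
  x != 0 /\ exists z2 z4, x = pt one 0 z2 z2 z4 (- z2 - z4) 0 0.
Proof.
split=> [/plinear2P[x0 [s [r xE]]]|[x0 [z2 [z4 xE]]]].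
  by split=> //; exists r, (- s); rewrite xE /L3a /L3b pt_comb; congr pt; ring.
apply/plinear2P; split=> //; exists (- z4), z2.
by rewrite xE /L3a /L3b pt_comb; congr pt; ring.
Qed.

Lemma L4P x : L4 x <->
  x != 0 /\ exists z2 z4, x = pt one (- z2 - z4) z2 z2 z4 0 0 0.
Proof.
split=> [/plinear2P[x0 [s [r xE]]]|[x0 [z2 [z4 xE]]]].
  by split=> //; exists (- s), r; rewrite xE /L4a /L4b pt_comb; congr pt; ring.
apply/plinear2P; split=> //; exists (- z2), z4.
by rewrite xE /L4a /L4b pt_comb; congr pt; ring.
Qed.

Lemma L3_cap_L4 : @L3 K `&` @L4 K = plinear (pt one 0 1 1 (- 1) 0 0 0).
Proof.
apply/seteqP; split=> x.
  move=> [/L3P[x0 [z2 [z4 xE]]] /L4P[_ [w2 [w4]]]]; rewrite xE.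
  move=> /(pt_inj o0)[h1 h2 h3 h4 [h5 h6 h7]]; apply/plinear1P; split; first by rewrite -xE.
  by exists z2; rewrite pt_scale; congr pt; try ring; by_eq h5.
move=> /plinear1P[x0 [s xE]]; split; [apply/L3P|apply/L4P]; split=> //;
  by exists s, (- s); rewrite xE pt_scale; congr pt; ring.
Qed.

Lemma lines34_one : lines34 (@L3 K) (@L4 K).
Proof.
split; [exact: is_line_L3|exact: is_line_L4|exact: Xlim_conic_one| |] => x;
  rewrite ?(nodelim_c34_c9 natK o0) ?(nodelim_c34_c10 natK o0)
    ?(nodelim_c2_c34 natK o0) ?(nodelim_c34_c5 natK o0) /=;
  case=> /plinear1P[x0 [s xE]].
- by apply/L3P; split=> //; exists 0, s; rewrite xE pt_scale; congr pt; ring.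
- by apply/L3P; split=> //; exists s, 0; rewrite xE pt_scale; congr pt; ring.
- by apply/L4P; split=> //; exists (- s), 0; rewrite xE pt_scale; congr pt; ring.
- by apply/L4P; split=> //; exists 0, s; rewrite xE pt_scale; congr pt; ring.
Qed.

Lemma scroll_1_10_3_is_scroll : is_scroll_of (Xlim one c1) (@L3 K)
  [:: (nodelim one c0 c1, nodelim one c34 c9); (nodelim one c1 c2, @L3 K `&` @L4 K);
      (nodelim one c1 c10, nodelim one c34 c10)] (@scroll_1_10_3 K).
Proof.
have := scroll_is_scroll (@scroll_1_10_3_free K); rewrite /L3a /L3b !ptD.
rewrite Xlim_line // /line /lineA /lineB plinear_swap.
rewrite (nodelim_c0_c1 natK o0) (nodelim_c34_c9 natK o0) (nodelim_c1_c2 natK o0) L3_cap_L4.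
rewrite (nodelim_c1_c10 natK o0) (nodelim_c34_c10 natK o0).
rewrite -[plinear (pt _ 0 0 0 1 _ _ _)](@plinear_scale K 16 _ (- 1)) ?oppr_eq0 ?oner_eq0 //.
by rewrite pt_scale !(mulN1r, oppr0, opprK, addr0, add0r, addNr, subrr).
Qed.

Lemma scroll_6_7_8_is_scroll : is_scroll_of (Xlim one c6) (Xlim one c8)
  [:: (nodelim one c5 c6, nodelim one c8 c11); (nodelim one c6 c7, nodelim one c7 c8);
      (nodelim one c6 c9, nodelim one c0 c8)] (@scroll_6_7_8 K).
Proof.
have := scroll_is_scroll (@scroll_6_7_8_free K); rewrite !ptD.
rewrite !Xlim_line // /line /lineA /lineB /=.
have n1 : (- 1 : K) != 0 by rewrite oppr_eq0 oner_eq0.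
rewrite (nodelim_c5_c6 natK o0) (nodelim_c8_c11 natK o0) (nodelim_c6_c7 natK o0).
rewrite (nodelim_c7_c8 natK o0) (nodelim_c6_c9 natK o0) (nodelim_c0_c8 natK o0) /=.
have swap (a b : 'rV[K]_16) : plinear (col_mx a (- 1 *: b)) = plinear (col_mx a b).
  apply/seteqP; split=> x /plinear2P[x0 [s [r xE]]]; apply/plinear2P; split=> //;
    by exists s, (- r); rewrite xE !scalerA; congr (_ + _ *: _); ring.
rewrite -[plinear (col_mx _ (pt _ 0 0 1 1 _ _ _))]swap -[plinear (col_mx _ (pt _ 0 0 0 0 0 0 1))]swap.
rewrite -[plinear (pt _ 0 0 1 1 _ _ _)](plinear_scale _ n1).
rewrite -[plinear (pt _ 0 0 0 0 0 0 1)](plinear_scale _ n1).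
by rewrite !pt_scale !(mulN1r, oppr0, opprK, addr0, add0r, addNr, subrr).
Qed.

Lemma scroll_1_10_3_lines : Xlim one c1 `|` Xlim one c10 `|` @L3 K `<=` @scroll_1_10_3 K.
Proof.
rewrite !Xlim_line // => x [[/plinear2P[x0 [s [r xE]]]|/plinear2P[x0 [s [r xE]]]]|].
- apply/scroll_1_10_3P; split=> //; exists s, r, 0, 0.
  by rewrite xE pt_comb; split; [congr pt|]; ring.
- apply/scroll_1_10_3P; split=> //; exists s, (- r), 0, r.
  by rewrite xE pt_comb; split; [congr pt|]; ring.
move=> /L3P[x0 [z2 [z4 xE]]]; apply/scroll_1_10_3P; split=> //.
by exists z2, z2, z4, (- z2 - z4); split=> //; ring.
Qed.

Lemma scroll_6_7_8_lines : Xlim one c6 `|` Xlim one c7 `|` Xlim one c8 `<=` @scroll_6_7_8 K.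
Proof.
rewrite !Xlim_line // => x [[]|] /plinear2P[x0 [s [r xE]]]; apply/scroll_6_7_8P; split=> //.
- exists r, (s + r), s, r.
  by rewrite xE pt_comb /=; split; [congr pt|]; ring.
- exists (- s), 0, (- r), r.
  by rewrite xE pt_comb; split; [congr pt|]; ring.
exists 0, 0, s, r.
by rewrite xE pt_comb; split; [congr pt|]; ring.
Qed.

Lemma pspan_c0_c9 : pspan (Xlim one c0 `|` Xlim one c9) = @plane_0_9 K.
Proof.
rewrite !Xlim_line //; apply: pspan_plane.
- by left; apply: plinear2_left; pt_nonzero o0.
- by left; apply: plinear2_right; pt_nonzero o0.
- by right; apply: plinear2_left; pt_nonzero o0.
rewrite -/plane_0_9 => x [] /plinear2P[x0 [s [r xE]]]; apply/plane_0_9P; split=> //.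
- by exists s, 0, r; rewrite xE pt_comb; congr pt; ring.
- by exists r, s, r; rewrite xE pt_comb; congr pt => /=; ring.
Qed.

Lemma pspan_c2_L4 : pspan (Xlim one c2 `|` @L4 K) = @plane_2_4 K.
Proof.
rewrite !Xlim_line //; apply: pspan_plane.
- by left; apply: plinear2_left; pt_nonzero o0.
- by left; apply: plinear2_right; pt_nonzero o0.
- by right; apply: plinear2_right; pt_nonzero o0.
rewrite -/plane_2_4 => x [/plinear2P[x0 [s [r xE]]]|/L4P[x0 [z2 [z4 xE]]]]; apply/plane_2_4P; split=> //.
- by exists s, r, 0; rewrite xE pt_comb; congr pt; ring.
- by exists (- z2 - z4), z2, z4.
Qed.

Lemma pspan_c5_c11 : pspan (Xlim one c5 `|` Xlim one c11) = @plane_5_11 K.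
Proof.
rewrite !Xlim_line //; apply: pspan_plane.
- by right; apply: plinear2_left; pt_nonzero o0.
- by right; apply: plinear2_right; pt_nonzero o0.
- by left; apply: plinear2_left; pt_nonzero o0.
rewrite -/plane_5_11 => x [] /plinear2P[x0 [s [r xE]]]; apply/plane_5_11P; split=> //.
- by exists (r - s), s, r; rewrite xE pt_comb; congr pt => /=; ring.
- by exists s, 0, r; rewrite xE pt_comb; congr pt; ring.
Qed.

End LinesAtOne.

(** * The section at t = infinity *)

Section NodalSectionAtInfty.
Variable K : fieldType.
Hypothesis natK : injective (fun k : nat => k%:R : K).
Notation infty := ((1, 0) : K * K).
Implicit Types x : 'rV[K]_16.
Let o0 : infty.1 != 0 := oner_neq0 K.

Definition plane_5_6_8_9 : set 'rV[K]_16 := plinear (col_mx (pt infty 0 0 0 1 0 0 0)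
  (col_mx (pt infty 0 0 0 0 0 1 0) (pt infty 0 0 0 0 0 0 1))).

Lemma line0P x : line c0 infty x <-> x != 0 /\ exists z3 z7, x = pt infty 0 0 z3 0 0 0 z7.
Proof.
split=> [/plinear2P[x0 [s [r xE]]]|[x0 [s [r xE]]]]; last apply/plinear2P;
  by split=> //; exists s, r; rewrite xE pt_comb; congr pt; ring.
Qed.

Lemma line1P x : line c1 infty x <-> x != 0 /\ exists z2 z3, x = pt infty 0 z2 z3 0 0 0 0.
Proof.
split=> [/plinear2P[x0 [s [r xE]]]|[x0 [s [r xE]]]]; last apply/plinear2P;
  by split=> //; exists s, r; rewrite xE pt_comb; congr pt; ring.
Qed.

Lemma line2P x : line c2 infty x <-> x != 0 /\ exists z1 z2, x = pt infty z1 z2 z2 0 0 0 0.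
Proof.
split=> [/plinear2P[x0 [s [r xE]]]|[x0 [s [r xE]]]]; last apply/plinear2P;
  by split=> //; exists s, r; rewrite xE pt_comb; congr pt; ring.
Qed.

Lemma line7P x : line c7 infty x <->
  x != 0 /\ exists z5 z7, x = pt infty 0 0 (- z5) 0 z5 (- z7) z7.
Proof.
split=> [/plinear2P[x0 [s [r xE]]]|[x0 [s [r xE]]]]; last apply/plinear2P;
  by split=> //; exists s, r; rewrite xE pt_comb; congr pt; ring.
Qed.

Lemma line10P x : line c10 infty x <->
  x != 0 /\ exists z2 z5, x = pt infty 0 z2 (- z5) 0 z5 0 0.
Proof.
split=> [/plinear2P[x0 [s [r xE]]]|[x0 [s [r xE]]]]; last apply/plinear2P;
  by split=> //; exists s, r; rewrite xE pt_comb; congr pt; ring.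
Qed.

Lemma line11P x : line c11 infty x <-> x != 0 /\ exists z1 z6, x = pt infty z1 0 0 0 0 z6 0.
Proof.
split=> [/plinear2P[x0 [s [r xE]]]|[x0 [s [r xE]]]]; last apply/plinear2P;
  by split=> //; exists s, r; rewrite xE pt_comb; congr pt; ring.
Qed.

Lemma plane_5_6_8_9P x : plane_5_6_8_9 x <-> x != 0 /\ exists z4 z6 z7, x = pt infty 0 0 0 z4 0 z6 z7.
Proof.
split=> [/plinear3P[x0 [s [r [q xE]]]]|[x0 [s [r [q xE]]]]]; last apply/plinear3P;
  by split=> //; exists s, r, q; rewrite xE !pt_scale !ptD; congr pt; ring.
Qed.

Lemma plane_5_6_8_9_free s r q : s *: pt infty 0 0 0 1 0 0 0 +
  (r *: pt infty 0 0 0 0 0 1 0 + q *: pt infty 0 0 0 0 0 0 1) = 0 ->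
  [/\ s = 0, r = 0 & q = 0].
Proof.
rewrite !(pt_scale, ptD) -(pt0 infty) => /(pt_inj o0)[h1 h2 h3 h4 [h5 h6 h7]].
by split; [by_eq h4|by_eq h6|by_eq h7].
Qed.

Lemma Y_inftyE : Y infty = line c0 infty `|` (line c1 infty `|` (line c2 infty `|`
  (line c7 infty `|` (line c10 infty `|` (line c11 infty `|` (@conic_infty K `|` plane_5_6_8_9)))))).
Proof.
apply/seteqP; split=> x.
  move=> Yx; have [/PnodP[x0 [z1 [z2 [z3 [z4 [z5 [z6 [z7 xE]]]]]]]] _] := Yx.
  rewrite xE in x0 Yx; have /Y_pt[_ /=] := Yx.
  move=> [[h1 h2 h3 h4 h5] [h6 h7 h8 h9 h10]]; rewrite xE.
  have g1 : z2 * z4 = z5 * (z5 + z3) by by_eq h1.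
  have g3 : z4 * z3 = - (z1 * z5) by by_eq h3.
  have g5 : z4 * z2 = - (z1 * z5) by by_eq h5.
  have g6 : z3 * z6 = z5 * z7 by by_eq h6.
  have g7 : z1 * z4 + z4 * z5 = z1 * z5 by by_eq h7.
  have g10 : z5 * (z6 + z7) = 0 by by_eq h10.
  have [z10|z10] := eqVneq z1 0; last first.
    have z70 : z7 = 0 by apply: (mulfI z10); rewrite mulr0.
    have z23 : z2 = z3 by exact: (mulfI z10).
    have [z20|z20] := eqVneq z2 0.
      have z50 : z5 = 0 by apply: (mulfI z10); move: g5; rewrite z20 => g5; by_eq g5.
      have z40 : z4 = 0 by apply: (mulfI z10); move: g7; rewrite z50 => g7; by_eq g7.
      do 5 right; left; apply/line11P; split=> //; exists z1, z6.
      by rewrite -z23 z20 z40 z50 z70.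
    have z60 : z6 = 0 by apply: (mulfI z20); rewrite mulr0.
    have [z50|z50] := eqVneq z5 0.
      have z40 : z4 = 0 by apply: (mulIf z20); move: g5; rewrite z50 => g5; by_eq g5.
      do 2 right; left; apply/line2P; split=> //; exists z1, z2.
      by rewrite -z23 z40 z50 z60 z70.
    (* Comparing the two expressions [g1] and [g5] for z_2 z_4, with z_3 = z_2, gives z_5 (z_5 + z_1
       + z_2) = 0: the plane of component 34 appears. *)
    have z5E : z5 = - z1 - z2.
      have e : z5 + z1 + z2 = 0.
        apply: (mulfI z50); move: g5; rewrite [z4 * _]mulrC g1 -z23 => g5; by_eq g5.
      by_eq e.
    do 6 right; left; split=> //; exists z1, z2, z4.
    rewrite -z23 z60 z70 -z5E; split=> //.
    by move: g5; rewrite z5E => g5; by_eq g5.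
  rewrite z10 in g3 g5 g7.
  have [z40|z40] := eqVneq z4 0; last first.
    have z30 : z3 = 0 by apply: (mulfI z40); by_eq g3.
    have z20 : z2 = 0 by apply: (mulfI z40); by_eq g5.
    have z50 : z5 = 0 by apply: (mulfI z40); by_eq g7.
    by do 7 right; apply/plane_5_6_8_9P; split=> //; exists z4, z6, z7; rewrite z10 z20 z30 z50.
  rewrite z40 in g1; have [z50|z50] := eqVneq z5 0; last first.
    have z35 : z3 = - z5.
      have e : z5 + z3 = 0 by apply: (mulfI z50); by_eq g1.
      by_eq e.
    have z67 : z6 = - z7.
      have e : z6 + z7 = 0 by apply: (mulfI z50); by_eq g10.
      by_eq e.
    have [z60|z60] := eqVneq z6 0.
      do 4 right; left; apply/line10P; split=> //; exists z2, z5.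
      have z70 : z7 = 0 by move: z67; rewrite z60 => z67; by_eq z67.
      by rewrite z10 z35 z40 z60 z70.
    have z20 : z2 = 0 by apply: (mulIf z60); by_eq h4.
    do 3 right; left; apply/line7P; split=> //; exists z5, z7.
    by rewrite z10 z20 z35 z40 z67.
  rewrite z50 in g6; have [z20|z20] := eqVneq z2 0; last first.
    have z60 : z6 = 0 by apply: (mulfI z20); by_eq h4.
    have z70 : z7 = 0 by apply: (mulfI z20); by_eq h8.
    right; left; apply/line1P; split=> //; exists z2, z3.
    by rewrite z10 z40 z50 z60 z70.
  have [z30|z30] := eqVneq z3 0.
    by do 7 right; apply/plane_5_6_8_9P; split=> //; exists z4, z6, z7; rewrite z10 z20 z30 z50.
  have z60 : z6 = 0 by apply: (mulfI z30); by_eq g6.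
  left; apply/line0P; split=> //; exists z3, z7.
  by rewrite z10 z20 z40 z50 z60.
move=> [/line0P|[/line1P|[/line2P|[/line7P|[/line10P|[/line11P|[|/plane_5_6_8_9P]]]]]]];
  first [move=> [x0 [z1 [z2 [z4 [xE q0]]]]]|move=> [x0 [? [? [? xE]]]]|move=> [x0 [? [? xE]]]];
  rewrite xE; apply/Y_pt; rewrite -xE; split=> //=;
  split; split; by_eqs.
Qed.

End NodalSectionAtInfty.

Section HomogeneousMaps.
Variables (K : fieldType) (n : nat).

Lemma dhomog_map (R : comNzRingType) (h : {rmorphism R -> K}) d (f : {mpoly R[n]}) :
  f \is d.-homog -> map_mpoly h f \is d.-homog.
Proof.
move=> fd; apply/dhomogP => m; rewrite mcoeff_msupp mcoeff_map_mpoly => hm.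
apply: (dhomog_mf fd); rewrite mcoeff_msupp.
by apply: contraNneq hm => ->; rewrite raddf0.
Qed.

Lemma linear_homog (l : {mpoly K[n]}) (x x' : 'rV[K]_n) : l \is 1.-homog ->
  l.@[(x + x') 0] = l.@[x 0] + l.@[x' 0].
Proof.
move=> l1; rewrite !mevalE -big_split /= big_seq [RHS]big_seq; apply: eq_bigr => m ml.
have /mdeg1P[i /eqP ->] : mdeg m == 1%N by apply/eqP; exact: (dhomog_mf l1).
have prodE (w : 'rV[K]_n) : \prod_j w 0 j ^+ U_(i)%MM j = w 0 i.
  rewrite (bigD1 i) //= mnmE eqxx expr1 big1 ?mulr1 // => j ij.
  by rewrite mnmE eq_sym (negbTE ij) expr0.
by rewrite !prodE mxE mulrDr.
Qed.

End HomogeneousMaps.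

(** * Component 34 at infinity as an irreducible conic *)

Section ComponentsAtInfty.
Variable K : fieldType.
Hypothesis natK : injective (fun k : nat => k%:R : K).
Notation infty := ((1, 0) : K * K).
Implicit Types x : 'rV[K]_16.
Let o0 : infty.1 != 0 := oner_neq0 K.

(** The defining forms of the limit, specialized at tau, are homogeneous over K. *)
Lemma zclosed_limit tau F : zclosed (@limit K tau F).
Proof.
apply: zclosedP => [x []//|x [x0 clx]]; split=> // d f fd f0.
apply: (clx d) => [|z [_ limz]]; first exact: dhomog_map.
exact: (limz d).
Qed.

(** Closedness is inherited from the limit; the paths interpolate the parameters c, a, b of
    [conic_lim]. *)
Lemma conic_infty_irreducible : irreducible_closed (@conic_infty K).
Proof.
apply: irreducible_paths => //.
- by rewrite -(Xlim_conic_infty natK); apply: zclosed_limit.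
- exists (pt infty 0 0 0 1 0 0 0); split; first by pt_nonzero o0.
  by exists 0, 0, 1; split; [congr pt|]; ring.
move=> x x' /conic_infty_lim[c [a [b xE]]] /conic_infty_lim[c' [a' [b' xE']]].
have pl (k k' : K) : ispoly (fun u => k + u * (k' - k)) by prove_ispoly.
exists (fun u => (c + u * (c' - c)) *:
  conic_lim infty (a + u * (a' - a)) (b + u * (b' - b))); split.
- apply: ispathZ; first exact: pl.
  move=> i; apply: (ispoly_ext (g := fun u => let a := a + u * (a' - a) in
    let b := b + u * (b' - b) in nth 0 (ptseq infty (- (a * b)) (b * b)
    (b * b) (a * (a - b)) (b * (a - b)) 0 0) i)) => [u|].
    by rewrite mxE /=; congr (nth 0 (ptseq _ _ _ _ _ _ _ _) i); ring.
  by case: i => [[|[|[|[|[|[|[|[|[|[|[|[|[|[|[|[|//]]]]]]]]]]]]]]]] ?] /=; prove_ispoly.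
- by rewrite !mul0r !addr0.
- by rewrite !mul1r ![_ + (_ - _)]addrC !subrK.
by move=> u u0; rewrite -(Xlim_conic_infty natK); apply: Xlim_conic_lim.
Qed.

Let ca : 'rV[K]_16 := pt infty 1 0 0 0 (- 1) 0 0.
Let cb : 'rV[K]_16 := pt infty 0 1 1 0 (- 1) 0 0.
Let cc : 'rV[K]_16 := pt infty 0 0 0 1 0 0 0.

(** On the plane the quadric is s^2 + s r - r k. In a product of linear forms the coefficient 1 of
    s^2 together with the coefficients 0 of k^2 and s k forces both factors to be free of k, against
    the coefficient -1 of r k. *)
Lemma irreducible_conic_infty : irreducible_conic (@conic_infty K).
Proof.
have free s r q : s *: ca + (r *: cb + q *: cc) = 0 -> [/\ s = 0, r = 0 & q = 0].
  rewrite !(pt_scale, ptD) -(pt0 infty) => /(pt_inj o0)[h1 h2 h3 h4 [h5 h6 h7]].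
  by split; [by_eq h1|by_eq h2|by_eq h4].
pose X k : {mpoly K[16]} := 'X_(inord k).
have Xk k : X k \is 1.-homog by rewrite dhomogX /= mdeg1.
pose q := X 1%N * (X 1%N + X 6) - X 6 * X 9.
have qE x : q.@[x 0] = co x 1 * (co x 1 + co x 6) - co x 6 * co x 9.
  by rewrite mevalB !mevalM mevalD !mevalXU.
have qpt z1 z2 z4 : q.@[pt infty z1 z2 z2 z4 (- z1 - z2) 0 0 0] =
    z1 * (z1 + z2) - z2 * z4.
  by rewrite qE !co_pt //= mul1r.
have comb s r k : s *: ca + (r *: cb + k *: cc) = pt infty s r r k (- s - r) 0 0.
  by rewrite !(pt_scale, ptD); congr pt; ring.
exists (<<col_mx ca (col_mx cb cc)>>)%MS, q; split.
- by rewrite mxrank_gen; apply/eqP/row_free3.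
- by apply: rpredB; apply: (dhomogM (d := 1) (e := 1)) => //; apply: rpredD.
- have pl x : plinear (<<col_mx ca (col_mx cb cc)>>)%MS x <-> plinear (col_mx ca (col_mx cb cc)) x.
    by rewrite /plinear /= genmxE.
  apply/seteqP; split=> x.
    move=> [x0 [z1 [z2 [z4 [xE zq]]]]]; split; last by rewrite xE qpt zq subrr.
    by apply/pl/plinear3P; split=> //; exists z1, z2, z4; rewrite comb.
  move=> [/pl/plinear3P[x0 [s [r [k]]]]]; rewrite comb => xE; rewrite xE qpt => /eqP.
  by rewrite subr_eq0 => /eqP e; split; [rewrite -xE|exists s, r, k].
move=> [l [m [l1 m1 lm]]].
have lmU s r k : s * (s + r) - r * k =
    l.@[(s *: ca + (r *: cb + k *: cc)) 0] * m.@[(s *: ca + (r *: cb + k *: cc)) 0].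
  rewrite -lm; first by rewrite comb qpt.
  rewrite genmxE; apply/submxP; exists (row_mx s%:M (row_mx r%:M k%:M)).
  by rewrite !mul_row_col !mul_scalar_mx.
have lin (f : {mpoly K[16]}) s r k : f \is 1.-homog ->
    f.@[(s *: ca + (r *: cb + k *: cc)) 0] =
    s * f.@[ca 0] + r * f.@[cb 0] + k * f.@[cc 0].
  by move=> f1; rewrite !linear_homog // !(mevalZ_homog _ _ f1) expr1 addrA.
have E s r k : s * (s + r) - r * k =
    (s * l.@[ca 0] + r * l.@[cb 0] + k * l.@[cc 0]) *
    (s * m.@[ca 0] + r * m.@[cb 0] + k * m.@[cc 0]) by rewrite lmU !lin.
move: (l.@[ca 0]) (l.@[cb 0]) (l.@[cc 0]) (m.@[ca 0]) (m.@[cb 0]) (m.@[cc 0]) E.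
move=> al be ga al' be' ga' E.
have e1 : al * al' = 1 by have e := E 1 0 0; by_eq e.
have e2 : be * be' = 0 by have e := E 0 1 0; by_eq e.
have e3 : ga * ga' = 0 by have e := E 0 0 1; by_eq e.
have e4 : al * ga' + ga * al' = 0.
  have e : 1 = al * al' + ga * ga' + (al * ga' + ga * al') by have e := E 1 0 1; by_eq e.
  by rewrite e1 e3 in e; by_eq e.
have e5 : be * ga' + ga * be' = - 1.
  have e : - 1 = be * be' + ga * ga' + (be * ga' + ga * be') by have e := E 0 1 1; by_eq e.
  by rewrite e2 e3 in e; by_eq e.
have al0 : al != 0 by apply: contra_eq_neq e1 => ->; rewrite mul0r eq_sym oner_eq0.
have al'0 : al' != 0 by apply: contra_eq_neq e1 => ->; rewrite mulr0 eq_sym oner_eq0.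
have [ga0|ga0] := eqVneq ga 0.
  have ga'0 : ga' = 0 by apply: (mulfI al0); move: e4; rewrite ga0 => e; by_eq e.
  move/eqP: e5; rewrite ga0 ga'0 mulr0 mul0r addr0 eq_sym oppr_eq0.
  by rewrite (negbTE (oner_neq0 K)).
have ga'0 : ga' = 0 by apply: (mulfI ga0); rewrite e3 mulr0.
move/eqP: e4; rewrite ga'0 mulr0 add0r mulf_eq0.
by rewrite (negbTE ga0) (negbTE al'0).
Qed.

End ComponentsAtInfty.

Section LinesAtInfty.
Variable K : fieldType.
Hypothesis natK : injective (fun k : nat => k%:R : K).
Notation infty := ((1, 0) : K * K).
Implicit Types x : 'rV[K]_16.
Let o0 : infty.1 != 0 := oner_neq0 K.

Lemma line_irreducible v (t : K * K) : v <> c34 -> t.1 != 0 -> irreducible_closed (line v t).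
Proof.
move=> vc t0; apply: irreducible_plinear => //; rewrite col_mx_eq0 negb_and.
by case: v vc => // _; apply/orP; first
  [left; solve [pt_nonzero t0] | right; solve [pt_nonzero t0]].
Qed.

Lemma has_components_Y_infty : has_components (Y infty)
  [:: line c0 infty; line c1 infty; line c2 infty; line c7 infty; line c10 infty;
      line c11 infty; @conic_infty K; @plane_5_6_8_9 K].
Proof.
pose p := [:: pt infty 0 0 1 0 0 0 1; pt infty 0 1 (- 1) 0 0 0 0; pt infty 1 1 1 0 0 0 0;
  pt infty 0 0 (- 1) 0 1 (- 1) 1; pt infty 0 1 (- 1) 0 1 0 0;
  pt infty 1 0 0 0 0 1 0; pt infty 1 1 1 (1 + 1) (- 1 - 1) 0 0; pt infty 0 0 0 1 0 1 1].
have n2 : 1 + 1 != 0 :> K by apply/eqP => e; have /natK : 2%:R = 0%:R :> K.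
apply: (has_components_witness (p := nth 0 p)).
- do 6 (apply/forall_cons; split; first by apply: line_irreducible).
  apply/forall_cons; split; first exact: conic_infty_irreducible.
  by apply/forall_cons; split; first exact: (plane_irreducible natK (@plane_5_6_8_9_free K)).
- rewrite Y_inftyE; apply/seteqP; split=> x.
    move=> [?|[?|[?|[?|[?|[?|[?|?]]]]]]];
    [exists (line c0 infty)|exists (line c1 infty)|exists (line c2 infty)
    |exists (line c7 infty)|exists (line c10 infty)|exists (line c11 infty)
    |exists (@conic_infty K)|exists (@plane_5_6_8_9 K)];
    by rewrite //= !inE eqxx ?orbT.
  move=> [Z /=]; rewrite !inE => /or4P[|||/orP[|/or4P[|||]]] /eqP -> Zx;
    [left|right; left|do 2 right; left|do 3 right; left|do 4 right; left
    |do 5 right; left|do 6 right; left|do 7 right] => //.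
- case=> [|[|[|[|[|[|[|[|//]]]]]]]] _ /=.
  + by apply/line0P; split; [pt_nonzero o0|exists 1, 1].
  + by apply/line1P; split; [pt_nonzero o0|exists 1, (- 1)].
  + by apply/line2P; split; [pt_nonzero o0|exists 1, 1].
  + by apply/line7P; split; [pt_nonzero o0|exists 1, 1].
  + by apply/line10P; split; [pt_nonzero o0|exists 1, 1].
  + by apply/line11P; split; [pt_nonzero o0|exists 1, 1].
  + by split; [pt_nonzero o0|exists 1, 1, (1 + 1); split=> //; ring].
  + by apply/plane_5_6_8_9P; split; [pt_nonzero o0|exists 1, 1, 1].
- case=> [|[|[|[|[|[|[|[|//]]]]]]]] [|[|[|[|[|[|[|[|//]]]]]]]] _ _ //=;
  first [move=> /line0P[_ [? [? /(pt_inj o0)[? ? ? ? [? ? ?]]]]]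
        |move=> /line1P[_ [? [? /(pt_inj o0)[? ? ? ? [? ? ?]]]]]
        |move=> /line2P[_ [? [? /(pt_inj o0)[? ? ? ? [? ? ?]]]]]
        |move=> /line7P[_ [? [? /(pt_inj o0)[? ? ? ? [? ? ?]]]]]
        |move=> /line10P[_ [? [? /(pt_inj o0)[? ? ? ? [? ? ?]]]]]
        |move=> /line11P[_ [? [? /(pt_inj o0)[? ? ? ? [? ? ?]]]]]
        |move=> /plane_5_6_8_9P[_ [? [? [? /(pt_inj o0)[? ? ? ? [? ? ?]]]]]]
        |move=> [_ [? [? [? [/(pt_inj o0)[? ? ? ? [? ? ?]] _]]]]]];
  first [pt_absurd (oner_neq0 K) | pt_absurd n2].
Qed.

Lemma pspan_c5_c6_c8_c9 : pspan (Xlim infty c5 `|` Xlim infty c6 `|` Xlim infty c8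
  `|` Xlim infty c9) = @plane_5_6_8_9 K.
Proof.
rewrite !Xlim_line //; apply: pspan_plane.
- right; rewrite (_ : pt infty _ _ _ _ _ _ _ = pt infty 0 0 0 1 (- infty.2) 0 0).
    by apply: plinear2_left; pt_nonzero o0.
  by rewrite /= oppr0.
- by left; right; apply: plinear2_left; pt_nonzero o0.
- by left; right; apply: plinear2_right; pt_nonzero o0.
rewrite -/plane_5_6_8_9 => x [[[]|]|] /plinear2P[x0 [s [r xE]]]; apply/plane_5_6_8_9P; split=> //.
- by exists s, r, 0; rewrite xE pt_comb /=; congr pt; ring.
- by exists (s + r), s, r; rewrite xE pt_comb /=; congr pt; ring.
- by exists 0, s, r; rewrite xE pt_comb /=; congr pt; ring.
- by exists s, 0, r; rewrite xE pt_comb /=; congr pt; ring.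
Qed.

Lemma is_plane_5_6_8_9 : is_plane (@plane_5_6_8_9 K).
Proof. by apply: (@is_plinear_free K 16 2); apply: row_free3 (@plane_5_6_8_9_free K). Qed.

End LinesAtInfty.

Theorem proposition5p3 (R : realType) :
  let C : fieldType := R[i] in
  (let one : C * C := (1, 1) in
   let line v := Xlim one v in
   let node u v := nodelim one u v in
   exists L3 L4 : set 'rV[C]_16, lines34 L3 L4 /\
   exists S S' : set 'rV[C]_16,
     [/\ is_scroll_of (line c1) L3
           [:: (node c0 c1, node c34 c9); (node c1 c2, L3 `&` L4);
               (node c1 c10, node c34 c10)] S,
         is_scroll_of (line c6) (line c8)
           [:: (node c5 c6, node c8 c11); (node c6 c7, node c7 c8);
               (node c6 c9, node c0 c8)] S',
         line c1 `|` line c10 `|` L3 `<=` S,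
         line c6 `|` line c7 `|` line c8 `<=` S' &
         let Zs := [:: pspan (line c0 `|` line c9); S;
                       pspan (line c2 `|` L4);
                       pspan (line c5 `|` line c11); S'] in
         has_components (Y one) Zs /\ forall Z, Z \in Zs -> has_dim Z 2])
  /\
  (let infty : C * C := (1, 0) in
   let line v := Xlim infty v in
   let P := pspan (line c5 `|` line c6 `|` line c8 `|` line c9) in
   [/\ has_components (Y infty)
         [:: line c0; line c1; line c2; line c7; line c10; line c11;
             line c34; P],
       irreducible_conic (line c34) &
       is_plane P]).
Proof.
have natK : injective (fun k : nat => k%:R : R[i]).
  by move=> k m /eqP; rewrite Num.Theory.eqr_nat => /eqP.
split=> /=.
  exists (@L3 (R[i] : fieldType)), (@L4 (R[i] : fieldType)); split; first exact: lines34_one.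
  exists (@scroll_1_10_3 (R[i] : fieldType)), (@scroll_6_7_8 (R[i] : fieldType)); split.
  - exact: scroll_1_10_3_is_scroll.
  - exact: scroll_6_7_8_is_scroll.
  - exact: scroll_1_10_3_lines.
  - exact: scroll_6_7_8_lines.
  rewrite pspan_c0_c9 // pspan_c2_L4 // pspan_c5_c11 //.
  split; first exact: has_components_Y_one.
  exact: has_dim_Y_one.
have o0 : ((1, 0) : R[i] * R[i]).1 != 0 by exact: oner_neq0.
rewrite pspan_c5_c6_c8_c9 // Xlim_conic_infty // !Xlim_line //.
split; [exact: has_components_Y_infty|exact: irreducible_conic_infty|exact: is_plane_5_6_8_9].
Qed.
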